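(* Any solitary wave with $\sup u<c$ satisfying, for some $0<\alpha<1$ and $r=2/(1-\alpha)$, the regularity $u,v,P\in W^{1,r}_{\mathrm{loc}}(\overline{D_\eta})$, $\eta\in C^{1+\alpha}(\mathbb{R})$, $U\in W^{1,r}(-d,0)$, satisfies $$\Big(\frac1{F^2}-1\Big)\int_{-M}^M\eta\,dx+\int_{-M}^M\int_{-m}^0\frac{H_p^3h_q^2+(2h_p+H_p)(h_p-H_p)^2}{2h_p^2}\,dp\,dq\to0\qquad\text{as }M\to\infty .$$
   Context: Fix constants $g>0$, $d>0$, $c>0$. A solitary wave consists of $\eta:\mathbb{R}\to\mathbb{R}$ with $\eta>-d$, functions $u,v,P$ on $\overline{D_\eta}$, where $D_\eta=\{(x,y):-d<y<\eta(x)\}$, and $U:[-d,0]\to\mathbb{R}$, satisfying the steady incompressible Euler equations (in $L^r_{\mathrm{loc}}(\overline{D_\eta})$) $$(u-c)u_x+vu_y=-P_x,\quad (u-c)v_x+vv_y=-P_y-g,\quad u_x+v_y=0,$$ the boundary conditions $v=0$ on $y=-d$, $v=(u-c)\eta_x$ and $P=0$ on $y=\eta(x)$, and $\eta\to0$, $v\to0$, $u\to U(y)$ as $x\to\pm\infty$, uniformly in $y$. Here $w\in W^{1,r}_{\mathrm{loc}}(\overline{D_\eta})$ means $w\in W^{1,r}(D')$ whenever $\overline{D'}\subset\overline{D_\eta}$ is compact. Froude number $F>0$: $\frac1{F^2}=g\int_{-d}^0\frac{dy}{(c-U(y))^2}$. Flux: $m=\int_{-d}^{\eta(x)}(c-u(x,y))\,dy=\int_{-d}^0(c-U(y))\,dy>0$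 (independent of $x$). Stream function $\psi$: $\psi_y=u-c$, $\psi_x=-v$, $\psi=0$ on $y=\eta(x)$, hence $\psi=m$ on $y=-d$. With $q=x$, $p=-\psi$, the height function $h(q,p)$ on $\{-m\le p\le0\}$ is defined by $h(x,-\psi(x,y))=y+d$, and the asymptotic height function $H(p)$ by $H(-\Psi(y))=y+d$, where $\Psi(y)=\int_0^y(U(s)-c)\,ds$. Subscripts denote partial derivatives. *)

(* Defs.v *)
From HB Require Import structures.
From mathcomp Require Import all_boot all_order all_algebra.
From mathcomp Require Import all_classical all_reals all_analysis.
Import Order.TTheory GRing.Theory Num.Theory.
Import numFieldNormedType.Exports.

Set Implicit Arguments.
Unset Strict Implicit.
Unset Printing Implicit Defensive.

Local Open Scope classical_set_scope.
Local Open Scope ring_scope.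

Notation leb := lebesgue_measure.
Notation leb2 := (lebesgue_measure \x lebesgue_measure)%E.

(* Unit vectors of the plane: 'D_(e_x R) f and 'D_(e_y R) f are the classical
   first-order partial derivatives of f : R * R -> R. *)
Definition e_x (R : realType) : R * R := (1, 0).
Definition e_y (R : realType) : R * R := (0, 1).

Section TestFunctions.
Context {R : realType} {V : normedModType R}.

(* C^oo, through iterated directional derivatives of every order (s lists the
   directions). *)
Definition smooth (f : V -> R) : Prop :=
  forall s : seq V, let g := foldr (fun e k => 'D_e k) f s in
    continuous g /\ forall z e, derivable g z e.

Definition test_function (Om : set V) (phi : V -> R) : Prop :=
  smooth phi /\
  exists K : set V,
    [/\ compact K, K `<=` Om & forall z, ~ K z -> phi z = 0].

End TestFunctions.

Section Sobolev.
Context {R : realType}.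

Definition in_Lr2 (r : R) (Om : set (R * R)) (f : R * R -> R) : Prop :=
  f \_ Om \in Lfun (@leb R \x @leb R)%E r%:E.

Definition in_Lr1 (r : R) (Om : set R) (f : R -> R) : Prop :=
  f \_ Om \in Lfun (@leb R) r%:E.

Definition weak_partial (Om : set (R * R)) (e : R * R)
    (f fe : R * R -> R) : Prop :=
  forall phi, test_function Om phi ->
    \int[leb2]_(z in Om) (f z * 'D_e phi z) =
    - \int[leb2]_(z in Om) (fe z * phi z).

Definition weak_deriv (Om : set R) (f f' : R -> R) : Prop :=
  forall phi : R -> R, test_function Om phi ->
    \int[leb]_(x in Om) (f x * derive1 phi x) =
    - \int[leb]_(x in Om) (f' x * phi x).

Definition in_W1r2 (r : R) (Om : set (R * R)) (f : R * R -> R) : Prop :=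
  in_Lr2 r Om f /\
  exists fx fy : R * R -> R,
    [/\ in_Lr2 r Om fx, in_Lr2 r Om fy,
        weak_partial Om (e_x R) f fx & weak_partial Om (e_y R) f fy].

Definition in_W1r1 (r : R) (Om : set R) (f : R -> R) : Prop :=
  in_Lr1 r Om f /\
  exists f' : R -> R, in_Lr1 r Om f' /\ weak_deriv Om f f'.

(* "Locally in S" means: on every open D' whose closure is compact and
   contained in S; for S a closed domain this is local up to the boundary. *)
Definition locally_in (X : set (R * R) -> Prop) (S : set (R * R)) : Prop :=
  forall D', open D' -> compact (closure D') -> closure D' `<=` S -> X D'.

Definition in_Lr_loc (r : R) (S : set (R * R)) (f : R * R -> R) : Prop :=
  locally_in (fun D' => in_Lr2 r D' f) S.

Definition in_W1r_loc (r : R) (S : set (R * R)) (f : R * R -> R) : Prop :=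
  locally_in (fun D' => in_W1r2 r D' f) S.

(* C^(1+alpha)(R), with the Hoelder bound on bounded intervals only. *)
Definition in_C1alpha (alpha : R) (f : R -> R) : Prop :=
  [/\ forall x, derivable f x 1,
      continuous (derive1 f) &
      forall A : R, exists C : R, forall x y, `|x| <= A -> `|y| <= A ->
        `|derive1 f x - derive1 f y| <= C * `|x - y| `^ alpha].

End Sobolev.

Section SolitaryWave.
Context {R : realType}.

Definition fluid (d : R) (eta : R -> R) : set (R * R) :=
  [set z | - d < z.2 < eta z.1].

(* The derivatives are weak ones, and the equations hold as identities between
   functions in L^r_loc, that is, almost everywhere. *)
Definition steady_euler (g c r : R) (D : set (R * R))
    (u v P : R * R -> R) : Prop :=
  exists ux uy vx vy Px Py : R * R -> R,
    [/\ weak_partial D (e_x R) u ux /\ weak_partial D (e_y R) u uy,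
        weak_partial D (e_x R) v vx /\ weak_partial D (e_y R) v vy,
        weak_partial D (e_x R) P Px /\ weak_partial D (e_y R) P Py,
        [/\ in_Lr_loc r (closure D) ux, in_Lr_loc r (closure D) uy,
            in_Lr_loc r (closure D) vx & in_Lr_loc r (closure D) vy] /\
        (in_Lr_loc r (closure D) Px /\ in_Lr_loc r (closure D) Py) &
        {ae leb2, forall z, D z ->
          [/\ (u z - c) * ux z + v z * uy z = - Px z,
              (u z - c) * vx z + v z * vy z = - Py z - g &
              ux z + vy z = 0]}].

(* f(x, y) - l(y) -> 0 as x -> +oo and as x -> -oo, uniformly over y in J(x). *)
Definition cvg_unif_in_y (J : R -> set R) (f : R * R -> R) (l : R -> R) :
    Prop :=
  forall e : R, 0 < e ->
    (\forall x \near +oo, forall y, J x y -> `|f (x, y) - l y| < e) /\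
    (\forall x \near -oo, forall y, J x y -> `|f (x, y) - l y| < e).

(* Functions in W^(1,r) with r > 2 (r > 1 in dimension one) are identified with
   their continuous representatives, for which the pointwise boundary
   conditions make sense.  As U lives on [-d, 0] only, u - U is considered for
   those y in [-d, eta(x)] that also lie in [-d, 0]. *)
Record solitary_wave (g d c r : R) (eta : R -> R) (u v P : R * R -> R)
    (U : R -> R) : Prop := {
  sw_depth : forall x, - d < eta x;
  sw_cont_u : {within closure (fluid d eta), continuous u};
  sw_cont_v : {within closure (fluid d eta), continuous v};
  sw_cont_P : {within closure (fluid d eta), continuous P};
  sw_cont_U : {within `[- d, 0], continuous U};
  sw_euler : steady_euler g c r (fluid d eta) u v P;
  sw_bottom : forall x, v (x, - d) = 0;
  sw_kinematic : forall x, v (x, eta x) = (u (x, eta x) - c) * derive1 eta x;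
  sw_dynamic : forall x, P (x, eta x) = 0;
  sw_eta_cvg : eta x @[x --> +oo] --> (0 : R) /\ eta x @[x --> -oo] --> (0 : R);
  sw_v_cvg : cvg_unif_in_y (fun x => [set y | - d <= y <= eta x]) v (fun=> 0);
  sw_u_cvg :
    cvg_unif_in_y (fun x => [set y | - d <= y <= Num.min (eta x) 0]) u U
}.

Definition froude (g d c : R) (U : R -> R) (F : R) : Prop :=
  0 < F /\ F ^- 2 = g * \int[leb]_(y in `[- d, 0]) (c - U y) ^- 2.

(* The flux is computed at infinity; that it equals the integral of c - u(x, .)
   over [-d, eta(x)] for every x is a consequence of the wave equations. *)
Definition flux (d c : R) (U : R -> R) : R :=
  \int[leb]_(y in `[- d, 0]) (c - U y).

Definition stream_function (d c : R) (eta : R -> R) (u v psi : R * R -> R) :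
    Prop :=
  [/\ {within closure (fluid d eta), continuous psi},
      forall z, fluid d eta z -> is_derive z (e_y R) psi (u z - c),
      forall z, fluid d eta z -> is_derive z (e_x R) psi (- v z) &
      forall x, psi (x, eta x) = 0].

(* Requirements on [-d, eta(x)] determine h exactly on the strip -m <= p <= 0. *)
Definition height_function (d : R) (eta : R -> R) (psi h : R * R -> R) : Prop :=
  forall x y, closure (fluid d eta) (x, y) -> h (x, - psi (x, y)) = y + d.

(* Psi(y) = \int_0^y (U - c) for y <= 0, written with increasing bounds. *)
Definition asymptotic_stream (c : R) (U : R -> R) (y : R) : R :=
  \int[leb]_(s in `[y, 0]) (c - U s).

Definition asymptotic_height (d c : R) (U H : R -> R) : Prop :=
  forall y, - d <= y <= 0 -> H (- asymptotic_stream c U y) = y + d.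

(* Two-sided derivatives: meaningful for -m < p < 0. *)
Definition integrand (h : R * R -> R) (H : R -> R) (q p : R) : R :=
  let hq := 'D_(e_x R) h (q, p) in
  let hp := 'D_(e_y R) h (q, p) in
  let Hp := derive1 H p in
  (Hp ^+ 3 * hq ^+ 2 + (2 * hp + Hp) * (hp - Hp) ^+ 2) / (2 * hp ^+ 2).

End SolitaryWave.

(* Main.v *)
Require Import Defs.
From HB Require Import structures.
From mathcomp Require Import all_boot all_order all_algebra.
From mathcomp Require Import all_classical all_reals all_analysis.
From mathcomp Require Import measurable_realfun.
From mathcomp Require Import ring lra.
Import Order.TTheory GRing.Theory Num.Theory.
Import numFieldNormedType.Exports.
Local Open Scope classical_set_scope.
Local Open Scope ring_scope.
Set Implicit Arguments.
Unset Strict Implicit.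
Unset Printing Implicit Defensive.

(** The quantity in the theorem is, up to sign, an integral over the stream
    labels p of H_p^3 times a difference of vertical momentum fluxes through the
    sections x = M and x = -M, and these vanish at infinity because v does.

    Let Y(q, p) be the ordinate of the streamline with label p, so that
    h = Y + d, and let T(q, p) = P + g Y on that streamline.  With w = c - u one
    has h_p = 1 / w and h_q = - v / w.  Along streamlines the Bernoulli function
    (w^2 + v^2) / 2 + P + g y is constant, and its value is that of the
    undisturbed stream, (c - U)^2 / 2 = 1 / (2 H_p^2); hence
    T = 1 / (2 H_p^2) - (w^2 + v^2) / 2, and the integrand becomes
    h_p - H_p - H_p^3 T.  Its integral in p is eta - int H_p^3 T dp, while the
    change of variables from p to the undisturbed level turns 1 / F^2 into
    g int H_p^3 dp.  What is left is the integral of H_p^3 (g eta - T) in p and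
    q ([integral_identity]).  The vertical momentum equation, integrated between
    a streamline and the surface where P = 0, gives
    int (T - g eta) dq = L(M, p) - L(-M, p), where L is the flux of (u - c) v
    through the section above the streamline ([lift_balance]); it is bounded by
    the flux of c - u times sup |v| ([lift_bound]).

    Two points need care.

    The equations hold only weakly, so the conservation laws are first proved
    as flux balances over rectangles.  Smooth plateau functions test the weak
    derivatives and make u, v, P absolutely continuous on almost every
    line ([ae_lines]); the product rule for absolutely continuous functions
    ([ac_onM]) then puts the Euler equations in divergence form
    ([euler_balance]).  As psi is of class C^1, these balances can be followed
    along the moving streamlines ([is_derive_flux]), which gives Bernoulli's law
    and the lift balance.

    The limit u -> U is required only below min(eta, 0), so it is not immediate
    that no flux hides in the shrinking layer above.  It cannot: the mean of T
    over unit windows tends to zero by the lift balance, so Bernoulli's law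
    bounds the mean square speed on each streamline, and fluid of bounded speed
    cannot carry a fixed flux through a layer of vanishing thickness
    ([bed_flux_limit]).  The same vanishing mean of T identifies Bernoulli's
    constant ([stream_pressureE]). *)

(** * Integrals and derivatives in one and two variables *)

Section Calculus1D.
Context {R : realType}.
Implicit Types (f g : R -> R) (a b x y : R).
Notation mu := (@lebesgue_measure R).

Lemma continuous_integrable_itv f a b : continuous f ->
  mu.-integrable `[a, b] (EFin \o f).
Proof.
move=> cf; apply: continuous_compact_integrable; first exact: segment_compact.
exact: continuous_subspaceT.
Qed.

Lemma Rintegral_itv_chasles f a b c : a <= b <= c ->
  mu.-integrable `[a, c] (EFin \o f) ->
  \int[mu]_(t in `[a, c]) f t =
  \int[mu]_(t in `[a, b]) f t + \int[mu]_(t in `[b, c]) f t.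
Proof.
move=> /andP[ab bc] fi.
have := @Rintegral_itvB R f (BLeft a) (BRight c) b fi.
rewrite !bnd_simp => /(_ ab bc) /eqP; rewrite subr_eq => /eqP ->.
rewrite addrC; congr (_ + _); apply: Rintegral_itv_obnd_cbnd.
apply: integrableS fi => //; apply: subset_itvr.
by rewrite bnd_simp.
Qed.

Lemma Rintegral_itv_id f a : \int[mu]_(t in `[a, a]) f t = 0.
Proof. by rewrite set_itv1 Rintegral_set1. Qed.

(** The oriented integral from 0, whatever the sign of x. *)
Definition primitive f x : R :=
  if 0 <= x then \int[mu]_(t in `[0, x]) f t
  else - \int[mu]_(t in `[x, 0]) f t.

Lemma primitiveE f a x : continuous f -> a <= 0 -> a <= x ->
  primitive f x = \int[mu]_(t in `[a, x]) f t - \int[mu]_(t in `[a, 0]) f t.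
Proof.
move=> cf a0 ax; rewrite /primitive; case: ifPn => [x0|].
  rewrite (@Rintegral_itv_chasles f a 0 x) ?a0//; last exact: continuous_integrable_itv.
  by rewrite addrAC subrr add0r.
rewrite -ltNge => /ltW x0.
rewrite (@Rintegral_itv_chasles f a x 0) ?ax//; last exact: continuous_integrable_itv.
by rewrite opprD addrA subrr add0r.
Qed.

Lemma Rintegral_primitive f a b : continuous f -> a <= b ->
  \int[mu]_(t in `[a, b]) f t = primitive f b - primitive f a.
Proof.
move=> cf ab; pose m := Num.min a 0.
have ma : m <= a by rewrite ge_min lexx.
have m0 : m <= 0 by rewrite ge_min lexx orbT.
rewrite !(@primitiveE f m)// ?(le_trans ma)//.
rewrite (@Rintegral_itv_chasles f m a b) ?ma//; last exact: continuous_integrable_itv.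
by ring.
Qed.

Lemma is_derive_primitive f x : continuous f -> is_derive x 1 (primitive f) (f x).
Proof.
move=> cf; pose a := Num.min x 0 - 1.
have ax : a < x by rewrite /a ltrBlDr ltr_pwDr// ge_min lexx.
have a0 : a <= 0 by rewrite /a lerBlDr ler_wpDr// ge_min lexx orbT.
have xu : x < x + 1 by rewrite ltrDl.
have [dF F'] := @continuous_FTC1_closed R f a x (x + 1) xu
  (@continuous_integrable_itv f a (x+1) cf) ax (cf x).
rewrite derive1E in F'.
have D1 : is_derive x 1 (fun y => \int[mu]_(t in `[a, y]) f t - \int[mu]_(t in `[a, 0]) f t) (f x).
  rewrite -[f x]subr0; apply: is_deriveB.
  by apply: DeriveDef.
apply: near_eq_is_derive D1; near=> y; rewrite (@primitiveE f a)//.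
by apply: ltW; near: y; exact: lt_nbhsr.
Unshelve. all: by end_near.
Qed.


(** F and the primitive of f differ by a continuous function with zero
    derivative inside.  At the ends of the range of stream labels no two-sided
    derivative of F will be available. *)
Lemma Rintegral_FTC2 f F a b : a <= b -> continuous f ->
  {within `[a, b], continuous F} ->
  (forall x, a < x < b -> is_derive x 1 F (f x)) ->
  \int[mu]_(t in `[a, b]) f t = F b - F a.
Proof.
move=> ab cf cF dF; rewrite Rintegral_primitive//.
have [||c _] := @MVT_segment R (F \- primitive f) (fun=> 0) a b ab.
- move=> x; rewrite in_itv/= => xab; rewrite -(subrr (f x)).
  by apply: is_deriveB; [exact: dF|exact: is_derive_primitive].
- apply: within_continuousB; first exact: cF.
  apply: continuous_subspaceT => x.
  by apply: differentiable_continuous; apply/derivable1_diffP; apply: (@ex_derive _ _ _ _ _ _ _ (is_derive_primitive x cf)).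
by rewrite mul0r /= => /eqP; rewrite subr_eq0 => /eqP; lra.
Qed.

Lemma Rintegral_itv_cst (k : R) a b : a <= b ->
  \int[mu]_(t in `[a, b]) k = k * (b - a).
Proof.
move=> ab; rewrite Rintegral_cst//= lebesgue_measure_itv/= lte_fin; case: ltP => //= ba.
by rewrite (le_anti (introT andP (conj ab ba))) subrr.
Qed.

Lemma Rintegral_itvoo f a b : continuous f ->
  \int[mu]_(t in `]a, b[) f t = \int[mu]_(t in `[a, b]) f t.
Proof.
move=> cf; have fi := @continuous_integrable_itv _ a b cf.
rewrite (@Rintegral_itv_bndo_bndc R (BRight a) b); last first.
  by apply: integrableS fi => //; exact: subset_itv_oo_cc.
rewrite (@Rintegral_itv_obnd_cbnd R a (BRight b))//.
by apply: integrableS fi => //; exact: subset_itv_oc_cc.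
Qed.

Lemma le_normr_Rintegral_itvoo f a b C : continuous f -> a <= b ->
  (forall x, a < x < b -> `|f x| <= C) ->
  `|\int[mu]_(t in `[a, b]) f t| <= C * (b - a).
Proof.
move=> cf ab fC.
have fi : mu.-integrable `]a, b[ (EFin \o f).
  by apply: integrableS (@continuous_integrable_itv _ a b cf) => //; exact: subset_itv_oo_cc.
have ccst (k : R) : continuous (fun _ : R => k) by move=> x; exact: cvg_cst.
rewrite -Rintegral_itvoo// -Rintegral_itv_cst// -Rintegral_itvoo//.
apply: (le_trans (le_normr_Rintegral _ fi)) => //.
apply: le_Rintegral => //.
- exact: integrable_norm.
- by apply: integrableS (@continuous_integrable_itv _ a b (ccst C)) => //; exact: subset_itv_oo_cc.
Qed.

Lemma le_normr_Rintegral_cst f a b C : continuous f -> a <= b ->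
  (forall x, a <= x <= b -> `|f x| <= C) ->
  `|\int[mu]_(t in `[a, b]) f t| <= C * (b - a).
Proof.
move=> cf ab fC; apply: le_normr_Rintegral_itvoo => // x /andP[ax xb].
by apply: fC; rewrite !ltW.
Qed.

End Calculus1D.

Section Calculus2D.
Context {R : realType}.
Implicit Types (f g : R * R -> R) (z : R * R) (x y : R).

Lemma is_derive_exE f z d :
  is_derive z (e_x R) f d <-> is_derive z.1 1 (fun t => f (t, z.2)) d.
Proof.
have E : (fun h : R => h^-1 *: ((f \o shift z) (h *: e_x R) - f z)) =
    (fun h : R => h^-1 *: (((fun t => f (t, z.2)) \o shift z.1) (h *: 1) - f (z.1, z.2))).
  apply/funext => h; case: z => x y /=; congr (_ *: (f _ - _)).
  by congr (_, _); rewrite /= scaler0 add0r.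
by split => -[D1 D2]; split; move: D1 D2; rewrite /derivable /derive E.
Qed.

Lemma is_derive_eyE f z d :
  is_derive z (e_y R) f d <-> is_derive z.2 1 (fun t => f (z.1, t)) d.
Proof.
have E : (fun h : R => h^-1 *: ((f \o shift z) (h *: e_y R) - f z)) =
    (fun h : R => h^-1 *: (((fun t => f (z.1, t)) \o shift z.2) (h *: 1) - f (z.1, z.2))).
  apply/funext => h; case: z => x y /=; congr (_ *: (f _ - _)).
  by congr (_, _); rewrite /= scaler0 add0r.
by split => -[D1 D2]; split; move: D1 D2; rewrite /derivable /derive E.
Qed.

Lemma is_derive_epsP (k : R -> R) x d :
  is_derive x 1 k d <->
  forall e, 0 < e -> \forall y \near x, `|k y - k x - d * (y - x)| <= e * `|y - x|.
Proof.
split.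
  move=> [D1 D2] e e0.
  have : (fun h => h^-1 *: ((k \o shift x) (h *: 1) - k x)) h @[h --> 0^'] --> d.
    by rewrite -D2; exact: D1.
  move=> /cvgrPdist_le /(_ e e0); rewrite near_withinE near_simpl => H.
  have : \forall y \near x, y - x != 0 ->
     `|d - (y - x)^-1 *: (k ((y - x) *: 1 + x) - k x)| <= e.
    have : (y - x) @[y --> x] --> (0 : R).
      by rewrite -(subrr x); apply: cvgB; [exact: cvg_id|exact: cvg_cst].
    by move=> /(_ _ H).
  apply: filterS => y; have [-> _|yx] := eqVneq y x.
    by rewrite !subrr !mulr0 subr0 normr0 mulr0.
  have {}yx : y - x != 0 by rewrite subr_eq0.
  move=> /(_ yx).
  rewrite scaler1 subrK => L.
  have yx0 : 0 < `|y - x| by rewrite normr_gt0.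
  rewrite -ler_pdivrMr// -normrV ?unitfE// -normrM.
  apply: le_trans L; rewrite distrC le_eqVlt; apply/orP; left; apply/eqP.
  by congr (`|_|); rewrite -[_ *: _]/(_ * _); field.
move=> H.
have : (fun h => h^-1 *: ((k \o shift x) (h *: 1) - k x)) h @[h --> 0^'] --> d.
  apply/cvgrPdist_le => e e0; rewrite near_withinE.
  have : (h + x) @[h --> (0:R)] --> x.
    by rewrite -[X in _ --> X]add0r; apply: cvgD; [exact: cvg_id|exact: cvg_cst].
  move=> /(_ _ (H e e0)) K.
  have {}K : \forall h \near (0 : R),
    `|k (h + x) - k x - d * (h + x - x)| <= e * `|h + x - x| by exact: K.
  apply: filterS K => h /= L h0; rewrite scaler1.
  have {}h0 : h != 0 by [].
  have hh0 : 0 < `|h| by rewrite normr_gt0.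
  move: L; rewrite addrK -ler_pdivrMr// -normrV ?unitfE// -normrM.
  apply: le_trans; rewrite distrC le_eqVlt; apply/orP; left; apply/eqP.
  by congr (`|_|); rewrite -[_ *: _]/(_ * _); field.
move=> C; split; first by apply/cvg_ex; exists d.
by rewrite /derive; apply: cvg_lim; [exact: Rhausdorff|exact: C].
Qed.

Lemma near_boxP (P : R * R -> Prop) x0 y0 :
  (\forall z \near (x0, y0), P z) <->
  exists2 r, 0 < r & forall x y, `|x - x0| < r -> `|y - y0| < r -> P (x, y).
Proof.
split.
  move=> H; have /(@nbhs_ballP R _ (x0, y0) _)[r /= r0 Hr] := H.
  by exists r => // x y xr yr; apply: Hr; split; rewrite /ball /= distrC.
move=> [r r0 H]; apply/(@nbhs_ballP R _ (x0, y0) _); exists r => //= -[x y] [].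
by rewrite /ball /= => xr yr; apply: H; rewrite distrC.
Qed.

Lemma MVT_near (k k' : R -> R) x y :
  (forall t, `|t - x| <= `|y - x| -> is_derive t 1 k (k' t)) ->
  exists2 c, `|c - x| <= `|y - x| & k y - k x = k' c * (y - x).
Proof.
have H (a b : R) : a < b -> (forall t : R, a <= t <= b -> is_derive t 1 k (k' t)) ->
    exists2 c, a <= c <= b & k b - k a = k' c * (b - a).
  move=> ab dk; have [||c] := @MVT R k k' a b ab.
  - by move=> t; rewrite in_itv/= => /andP[at_ tb]; apply: dk; rewrite !ltW.
  - apply: derivable_within_continuous => t; rewrite in_itv/= => /dk [D _]; exact: D.
  - by rewrite in_itv/= => /andP[ac cb] E; exists c => //; rewrite !ltW.
move=> dk; have [xy|yx|<-] := ltgtP x y.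
- have [|c cxy E] := H _ _ xy.
    by move=> t txy; apply: dk; rewrite !ger0_norm; lra.
  by exists c => //; rewrite !ger0_norm; lra.
- have [|c cxy E] := H _ _ yx.
    by move=> t txy; apply: dk; rewrite !ler0_norm; lra.
  by exists c => //; [rewrite !ler0_norm; lra|lra].
- by exists x; rewrite ?subrr ?mulr0.
Qed.

(** Continuity of the partial derivatives at one point already gives the first
    order expansion there, as the increment splits into a horizontal and a
    vertical one. *)
Lemma C1_expansion f (a b : R * R -> R) x0 y0 :
  (\forall z \near (x0, y0), is_derive z (e_x R) f (a z)) ->
  (\forall z \near (x0, y0), is_derive z (e_y R) f (b z)) ->
  {for (x0, y0), continuous a} -> {for (x0, y0), continuous b} ->
  forall e, 0 < e -> \forall z \near (x0, y0),
    `|f z - f (x0, y0) - a (x0, y0) * (z.1 - x0) - b (x0, y0) * (z.2 - y0)|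
    <= e * (`|z.1 - x0| + `|z.2 - y0|).
Proof.
move=> da db ca cb e e0.
have ca' : \forall z \near (x0, y0), `|a (x0, y0) - a z| <= e.
  by move/cvgrPdist_le : ca; apply.
have cb' : \forall z \near (x0, y0), `|b (x0, y0) - b z| <= e.
  by move/cvgrPdist_le : cb; apply.
have /near_boxP[r r0 H] : \forall z \near (x0, y0),
    (is_derive z (e_x R) f (a z) /\ is_derive z (e_y R) f (b z)) /\
    (`|a (x0, y0) - a z| <= e /\ `|b (x0, y0) - b z| <= e).
  by apply: filterI; exact: filterI.
apply/near_boxP; exists r => //= x y bx yb.
have ball_sub t s (tx : `|t - x0| <= `|x - x0|) (sy : `|s - y0| <= `|y - y0|) :=
  H t s (le_lt_trans tx bx) (le_lt_trans sy yb).
have [|c cx Ex] := @MVT_near (fun t => f (t, y)) (fun t => a (t, y)) x0 x.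
  move=> t tx; have [[/is_derive_exE/= D _] _] := ball_sub t y tx (lexx _).
  exact: D.
have [|s sy Ey] := @MVT_near (fun t => f (x0, t)) (fun t => b (x0, t)) y0 y.
  move=> t ty; have [|[_ /is_derive_eyE/= D] _] := ball_sub x0 t _ ty.
    by rewrite subrr normr0.
  exact: D.
have [_ [/= A _]] := ball_sub c y cx (lexx _).
have [|_ [/= _ B]] := ball_sub x0 s _ sy; first by rewrite subrr normr0.
have -> : f (x, y) - f (x0, y0) - a (x0, y0) * (x - x0) - b (x0, y0) * (y - y0) =
    (a (c, y) - a (x0, y0)) * (x - x0) + (b (x0, s) - b (x0, y0)) * (y - y0).
  by rewrite !mulrBl -Ex -Ey; ring.
apply: (le_trans (ler_normD _ _)); rewrite !normrM mulrDr.
by apply: lerD; apply: ler_wpM2r => //; rewrite distrC.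
Qed.

Lemma near_curve (k : R -> R) x (P : set (R * R)) : {for x, continuous k} ->
  (\forall z \near (x, k x), P z) -> \forall t \near x, P (t, k t).
Proof.
move=> ck /near_boxP[r r0 H].
have ck' : \forall t \near x, `|k x - k t| < r by move/cvgrPdist_lt : ck; apply.
have xr : \forall t \near x, `|x - t| < r.
  by have /cvgrPdist_lt := @cvg_id _ (nbhs x); apply.
by near=> t; apply: H; rewrite distrC; near: t.
Unshelve. all: by end_near.
Qed.

Lemma is_derive1_continuous (k : R -> R) x d :
  is_derive x 1 k d -> {for x, continuous k}.
Proof.
by move=> [D _]; apply: differentiable_continuous; apply/derivable1_diffP.
Qed.

Lemma is_derive_along_curve f (a b : R * R -> R) (k : R -> R) x d :
  (\forall z \near (x, k x), is_derive z (e_x R) f (a z)) ->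
  (\forall z \near (x, k x), is_derive z (e_y R) f (b z)) ->
  {for (x, k x), continuous a} -> {for (x, k x), continuous b} ->
  is_derive x 1 k d ->
  is_derive x 1 (fun t => f (t, k t)) (a (x, k x) + b (x, k x) * d).
Proof.
move=> da db ca cb dk; apply/is_derive_epsP => e e0.
have ck := is_derive1_continuous dk.
set B := `|b (x, k x)|; have B0 : 0 <= B by exact: normr_ge0.
pose e1 := e / (3 + 3 * `|d| + 3 * B).
have den : 0 < 3 + 3 * `|d| + 3 * B by have := normr_ge0 d; lra.
have e10 : 0 < e1 by exact: divr_gt0.
have D1 := near_curve ck (C1_expansion da db ca cb e10).
have D2 := (is_derive_epsP k x d).1 dk _ e10.
have D3 := (is_derive_epsP k x d).1 dk _ ltr01.
near=> t.
have H1 : `|f (t, k t) - f (x, k x) - a (x, k x) * (t - x) - b (x, k x) * (k t - k x)|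
    <= e1 * (`|t - x| + `|k t - k x|) by near: t.
have H2 : `|k t - k x - d * (t - x)| <= e1 * `|t - x| by near: t.
have H3 : `|k t - k x - d * (t - x)| <= 1 * `|t - x| by near: t.
have H4 : `|k t - k x| <= (1 + `|d|) * `|t - x|.
  rewrite -[k t - k x](subrK (d * (t - x))).
  by apply: (le_trans (ler_normD _ _)); rewrite normrM mulrDl lerD.
have -> : f (t, k t) - f (x, k x) - (a (x, k x) + b (x, k x) * d) * (t - x) =
  (f (t, k t) - f (x, k x) - a (x, k x) * (t - x) - b (x, k x) * (k t - k x)) +
  b (x, k x) * (k t - k x - d * (t - x)) by ring.
apply: (le_trans (ler_normD _ _)); rewrite normrM.
apply: (@le_trans _ _ (e1 * (`|t - x| + (1 + `|d|) * `|t - x|) + B * (e1 * `|t - x|))).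
  apply: lerD; last by apply: ler_wpM2l.
  by apply: (le_trans H1); apply: ler_wpM2l; [exact: ltW|rewrite lerD2l].
have -> : e1 * (`|t - x| + (1 + `|d|) * `|t - x|) + B * (e1 * `|t - x|) =
  e1 * (2 + `|d| + B) * `|t - x| by ring.
apply: ler_wpM2r => //; rewrite /e1 mulrAC ler_pdivrMr//; apply: ler_wpM2l; first exact: ltW.
by have := normr_ge0 d; lra.
Unshelve. all: by end_near.
Qed.

(** Only the continuity of k is assumed: the first order expansion of f bounds
    the increment of k by that of t, and then determines its slope. *)
Lemma is_derive_implicit f (a b : R * R -> R) (k : R -> R) x :
  (\forall z \near (x, k x), is_derive z (e_x R) f (a z)) ->
  (\forall z \near (x, k x), is_derive z (e_y R) f (b z)) ->
  {for (x, k x), continuous a} -> {for (x, k x), continuous b} ->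
  {for x, continuous k} -> b (x, k x) != 0 ->
  (\forall t \near x, f (t, k t) = f (x, k x)) ->
  is_derive x 1 k (- a (x, k x) / b (x, k x)).
Proof.
move=> da db ca cb ck b0 fk; apply/is_derive_epsP => e e0.
set A := `|a (x, k x)|; have A0 : 0 <= A by exact: normr_ge0.
set B := `|b (x, k x)|; have B0 : 0 < B by rewrite normr_gt0.
have den : 0 < 2 * B + 2 * A by lra.
pose e1 := Num.min (B / 2) (e * B * B / (2 * B + 2 * A)).
have e10 : 0 < e1 by rewrite lt_min; apply/andP; split; apply: divr_gt0 => //; rewrite !mulr_gt0.
have e1B : e1 <= B / 2 by rewrite ge_min lexx.
have e1e : e1 * (2 * B + 2 * A) <= e * B * B.
  by rewrite -ler_pdivlMr// ge_min lexx orbT.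
have D1 := near_curve ck (C1_expansion da db ca cb e10).
near=> t.
have : `|f (t, k t) - f (x, k x) - a (x, k x) * (t - x) - b (x, k x) * (k t - k x)|
    <= e1 * (`|t - x| + `|k t - k x|) by near: t.
have -> : f (t, k t) = f (x, k x) by near: t.
rewrite subrr sub0r -opprD normrN => H1.
have H2 : B * `|k t - k x| <= (A + e1) * `|t - x| + e1 * `|k t - k x|.
  rewrite -normrM -[_ * (k t - k x)](addKr (a (x, k x) * (t - x))).
  apply: (le_trans (ler_normD _ _)); rewrite normrN normrM.
  by move: H1; rewrite -/A; lra.
have H3 : B * `|k t - k x| <= 2 * (A + e1) * `|t - x|.
  have : e1 * `|k t - k x| <= B / 2 * `|k t - k x| by rewrite ler_wpM2r.
  by lra.
have -> : k t - k x - - a (x, k x) / b (x, k x) * (t - x) =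
   (b (x, k x))^-1 * (a (x, k x) * (t - x) + b (x, k x) * (k t - k x)).
  by field.
rewrite normrM normrV ?unitfE// -/B mulrC ler_pdivrMr//.
apply: (le_trans H1).
rewrite -(ler_pM2l B0).
have -> : B * (e1 * (`|t - x| + `|k t - k x|)) = e1 * (B * `|t - x| + B * `|k t - k x|) by ring.
have H4 : B * `|t - x| + B * `|k t - k x| <= (B + 2 * A + 2 * e1) * `|t - x| by lra.
apply: (le_trans (ler_wpM2l (ltW e10) H4)).
have -> : B * (e * `|t - x| * B) = e * B * B * `|t - x| by ring.
rewrite mulrA; apply: ler_wpM2r => //; apply: le_trans e1e.
by apply: ler_wpM2l; [exact: ltW|lra].
Unshelve. all: by end_near.
Qed.

Lemma continuous_pairing (T : topologicalType) (k l : T -> R) t :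
  {for t, continuous k} -> {for t, continuous l} ->
  {for t, continuous (fun s => (k s, l s))}.
Proof. by move=> ck cl; exact: (cvg_pair ck cl). Qed.

Lemma continuous_xsection f x : continuous f -> continuous (fun y => f (x, y)).
Proof.
move=> cf y; apply: (@continuous_comp _ _ _ (fun y => (x, y)) f); last exact: cf.
by apply: continuous_pairing; [exact: cvg_cst|exact: cvg_id].
Qed.

Lemma continuous_ysection f y : continuous f -> continuous (fun x => f (x, y)).
Proof.
move=> cf x; apply: (@continuous_comp _ _ _ (fun x => (x, y)) f); last exact: cf.
by apply: continuous_pairing; [exact: cvg_id|exact: cvg_cst].
Qed.

End Calculus2D.

(** * Fubini's theorem on rectangles *)

Section Fubini2D.
Context {R : realType}.
Notation mu := (@lebesgue_measure R).
Notation mu2 := (lebesgue_measure \x lebesgue_measure)%E.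
Implicit Types (f g : R * R -> R) (A B : set R).

Lemma open_measurable_prod (U : set (R * R)) : open U -> measurable U.
Proof.
move=> oU.
pose box (q : (rat * rat) * (rat * rat)) : set (R * R) :=
  `]ratr q.1.1, ratr q.1.2[%classic `*` `]ratr q.2.1, ratr q.2.2[%classic.
have -> : U = \bigcup_q (if pselect (box q `<=` U) then box q else set0).
  apply/seteqP; split=> [[x y] Uxy|z [q _]]; last by case: pselect => // qU /qU.
  have /near_boxP[r r0 H] : \forall z \near (x, y), U z by exact: open_nbhs_nbhs.
  have [a aI] := @rat_in_itvoo R (x - r) x ltac:(lra).
  have [b bI] := @rat_in_itvoo R x (x + r) ltac:(lra).
  have [c cI] := @rat_in_itvoo R (y - r) y ltac:(lra).
  have [d dI] := @rat_in_itvoo R y (y + r) ltac:(lra).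
  move: aI bI cI dI; rewrite !in_itv/= => aI bI cI dI.
  exists ((a, b), (c, d)) => //; case: pselect => [bs|nb]; last first.
    case: nb => -[x' y'] [] /=; rewrite !in_itv/= => ? ?.
    by apply: H; rewrite ltr_norml; lra.
  by split => /=; rewrite in_itv/=; lra.
apply: countable_bigcupT_measurable => [|q].
  exact: countableP.
case: pselect => bs; last exact: measurable0.
by rewrite /=; apply: measurableX; exact: measurable_itv.
Qed.

Lemma continuous_measurable_fun2 f : continuous f -> measurable_fun setT f.
Proof.
move=> cf; apply: (measurability _ (RGenOpens.measurableE R)).
move=> X [Y [a [b ->] XE]]; rewrite -XE setTI; apply: open_measurable_prod.
by apply: open_comp => // x _; exact: cf.
Qed.

Lemma ae_impl d (T : measurableType d) (nu : {measure set T -> \bar R})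
    (P Q : T -> Prop) : (forall x, P x -> Q x) ->
  {ae nu, forall x, P x} -> {ae nu, forall x, Q x}.
Proof.
by move=> PQ; apply: filterS => //; exact: (ae_filter_ringOfSetsType nu).
Qed.

Lemma measurable_rect A B : measurable A -> measurable B ->
  measurable (A `*` B : set (measurableTypeR R * measurableTypeR R)).
Proof.
by move=> mA mB; exact: (@measurableX _ _ (measurableTypeR R) (measurableTypeR R)).
Qed.

Section Rfubini.
Variables (A B : set R) (f : R * R -> R).
Hypotheses (mA : measurable (A : set (measurableTypeR R))) (mB : measurable (B : set (measurableTypeR R))).
Hypothesis fi : mu2.-integrable (A `*` B) (EFin \o f).

Let g := (EFin \o f) \_ (A `*` B).

Let gi : mu2.-integrable setT g.
Proof. exact: ((integrable_mkcond _ (measurable_rect mA mB)).1 fi). Qed.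

Let gx x : A x -> (fun y => g (x, y)) = (fun y => (f (x, y))%:E) \_ B.
Proof.
move=> Ax; apply/funext => y; rewrite /g /patch.
by congr (if _ then _ else _); apply/idP/idP; rewrite !inE => //= -[].
Qed.

Let gx0 x : ~ A x -> (fun y => g (x, y)) = cst 0%E.
Proof.
by move=> Ax; apply/funext => y; rewrite /g patchE memNset// => -[].
Qed.

Lemma ae_integrable_xsection :
  {ae mu, forall x, A x -> mu.-integrable B (fun y => (f (x, y))%:E)}.
Proof.
apply: ae_impl (ae_integrable1 gi) => x + Ax; rewrite gx// => gxi.
apply: (integrable_mkcond _ mB).2; exact: gxi.
Qed.

Let F' : measurableTypeR R -> \bar R :=
  (fun x => (\int[mu]_(y in B) f (x, y))%:E) \_ A.

Let FE : {ae mu, forall x, fubini_F mu g x = F' x}.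
Proof.
apply: ae_impl ae_integrable_xsection => x xi.
rewrite /fubini_F /F' patchE; case: ifPn => [/set_mem Ax|/negP Ax].
  rewrite gx// -integral_mkcond /Rintegral fineK//.
  by apply: integrable_fin_num => //; exact: xi.
by rewrite gx0 ?integral_cst ?mul0e// => Ax'; apply: Ax; rewrite inE.
Qed.

Let F'E : F' = fun x => ((fine (fubini_F mu g x))%:E).
Proof.
apply/funext => x; rewrite /F' patchE /fubini_F; case: ifPn => [/set_mem Ax|/negP Ax].
  by rewrite gx// -integral_mkcond.
by rewrite gx0 ?integral_cst ?mul0e// => Ax'; apply: Ax; rewrite inE.
Qed.

Let mF' : measurable_fun setT F'.
Proof.
rewrite F'E; apply/measurable_EFinP; apply: measurableT_comp => //.
exact: (measurable_int _ (integrable_fubini_F gi)).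
Qed.

Lemma integrable_xsection_integral :
  mu.-integrable A (fun x => (\int[mu]_(y in B) f (x, y))%:E).
Proof.
apply: (integrable_mkcond _ mA).2; rewrite -/F'.
apply: (le_integrable measurableT mF' _ (integrable_fubini_F gi)) => x _.
have fine_le (z : \bar R) : (`|(fine z)%:E| <= `|z|)%E.
  by case: z => [r| |]//=; rewrite normr0 leey.
by rewrite F'E; exact: fine_le.
Qed.

Lemma Rintegral_xy : \int[mu]_(x in A) \int[mu]_(y in B) f (x, y) =
  \int[mu2]_(z in A `*` B) f z.
Proof.
rewrite /Rintegral; congr fine.
rewrite [RHS]integral_mkcond -/g -integral12_prod_meas1// [LHS]integral_mkcond.
apply: ae_eq_integral => //; first exact: (measurable_int _ (integrable_fubini_F gi)).
by apply: ae_impl FE => x.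
Qed.

End Rfubini.

Section Rfubini_swap.
Variables (A B : set R) (f : R * R -> R).
Hypotheses (mA : measurable (A : set (measurableTypeR R))) (mB : measurable (B : set (measurableTypeR R))).
Hypothesis fi : mu2.-integrable (A `*` B) (EFin \o f).

Let g : R * R -> \bar R := (EFin \o f) \_ (A `*` B).
Let g' : R * R -> \bar R := (EFin \o (f \o swap_pair)) \_ (B `*` A).

Let gi : mu2.-integrable setT g.
Proof. exact: ((integrable_mkcond _ (measurable_rect mA mB)).1 fi). Qed.

Let g'E : g' = g \o swap_pair.
Proof.
apply/funext => -[y x]; rewrite /g' /g /patch /=.
by congr (if _ then _ else _); apply/idP/idP; rewrite !inE => -[].
Qed.

Let g'i : mu2.-integrable setT g'.
Proof.
have mg' : measurable_fun setT g'.
  by rewrite g'E; apply: measurableT_comp; [exact: (measurable_int _ gi)|exact: (@measurable_fun_pair _ _ _ (measurableTypeR R * measurableTypeR R)%type (measurableTypeR R) (measurableTypeR R) _ _ measurable_snd measurable_fst)].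
apply: (integrable12ltyP mu mu mg').2.
have := (integrable21ltyP mu mu (measurable_int _ gi)).1 gi.
by rewrite g'E.
Qed.

Lemma integrable_rect_swap : mu2.-integrable (B `*` A) (EFin \o (f \o swap_pair)).
Proof. exact: ((integrable_mkcond _ (measurable_rect mB mA)).2 g'i). Qed.

Lemma Rintegral_rect_swap :
  \int[mu2]_(z in B `*` A) (f \o swap_pair) z = \int[mu2]_(z in A `*` B) f z.
Proof.
rewrite /Rintegral; congr fine.
rewrite [LHS]integral_mkcond [RHS]integral_mkcond.
by rewrite -(integral12_prod_meas1 g'i) -(integral21_prod_meas1 gi) g'E.
Qed.

Lemma integrable_ysection_integral :
  mu.-integrable B (fun y => (\int[mu]_(x in A) f (x, y))%:E).
Proof. exact: (integrable_xsection_integral mB mA integrable_rect_swap). Qed.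

Lemma ae_integrable_ysection :
  {ae mu, forall y, B y -> mu.-integrable A (fun x => (f (x, y))%:E)}.
Proof. exact: (ae_integrable_xsection mB mA integrable_rect_swap). Qed.

Lemma Rintegral_yx : \int[mu]_(y in B) \int[mu]_(x in A) f (x, y) =
  \int[mu2]_(z in A `*` B) f z.
Proof.
by rewrite -Rintegral_rect_swap -(Rintegral_xy mB mA integrable_rect_swap).
Qed.

End Rfubini_swap.

Lemma measure_rect_lty (a b c d : R) : (mu2 (`[a, b] `*` `[c, d]) < +oo)%E.
Proof.
have := @product_measure1E _ _ _ _ R mu mu `[a, b]%classic `[c, d]%classic
  (measurable_itv _) (measurable_itv _).
  move=> /= E; rewrite (le_lt_trans (_ : _ <= mu `[a, b] * mu `[c, d])%E)//.
    by rewrite -E.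
  by rewrite !lebesgue_measure_itv/=; do 2 case: ifP => //= _;
    rewrite ?mule0 ?mul0e ?ltry// -EFinM ltry.
Qed.

Lemma continuous_integrable_rect f a b c d : continuous f ->
  mu2.-integrable (`[a, b] `*` `[c, d]) (EFin \o f).
Proof.
move=> cf; apply: measurable_bounded_integrable.
- exact: measurable_rect.
- exact: measure_rect_lty.
- by apply: measurable_funS (continuous_measurable_fun2 cf) => //; exact: measurableT.
- have [M [Mr HM]] : bounded_set (f @` (`[a, b] `*` `[c, d])).
    apply: compact_bounded; apply: continuous_compact.
      exact: continuous_subspaceT.
    by apply: compact_setX; exact: segment_compact.
  by exists M; split => // x Mx z zK; apply: HM Mx _ _; exists z.
Qed.

Lemma Rintegral_continuous_swap f a b c d : continuous f ->
  \int[mu]_(x in `[a, b]) \int[mu]_(y in `[c, d]) f (x, y) =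
  \int[mu]_(y in `[c, d]) \int[mu]_(x in `[a, b]) f (x, y).
Proof.
move=> cf; have fi := continuous_integrable_rect a b c d cf.
by rewrite Rintegral_xy// Rintegral_yx.
Qed.

End Fubini2D.

(** * Smooth plateaus *)

Section Bump.
Context {R : realType}.
Variables (x0 x1 lam : R).
Hypotheses (x01 : x0 < x1) (lam0 : 0 < lam).
Implicit Types (p : {poly R}) (k : nat) (x y : R).

Definition bump_base : {poly R} := ('X - x0%:P) * (x1%:P - 'X).
Notation w := bump_base.

Lemma bump_baseE x : w.[x] = (x - x0) * (x1 - x).
Proof. by rewrite /w !hornerE. Qed.

Lemma bump_base_gt0 x : x0 < x < x1 -> 0 < w.[x].
Proof. by move=> /andP[a b]; rewrite bump_baseE mulr_gt0// subr_gt0. Qed.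

Definition bump_core p k x : R := p.[x] * (w.[x])^-1 ^+ k * expR (- lam * (w.[x])^-1).

(** Bumps with a polynomial factor and a pole of order k at the end points:
    a family closed under differentiation, hence made of smooth functions. *)
Definition bump p k x : R := if x0 < x < x1 then bump_core p k x else 0.

(** Numerator of the derivative, over the denominator w^(k+2). *)
Definition bump_deriv_poly p k : {poly R} :=
  p^`() * w ^+ 2 - k%:R *: (p * w^`() * w) + lam *: (p * w^`()).

Lemma is_derive_bump_core p k x : x0 < x < x1 ->
  is_derive x 1 (bump_core p k) (bump_core (bump_deriv_poly p k) k.+2 x).
Proof.
move=> xI; have w0 := bump_base_gt0 xI.
have wn0 : w.[x] != 0 by rewrite gt_eqF.
pose V y := (w.[y])^-1.
have dV : is_derive x 1 V (- (w^`().[x] * V x ^+ 2)).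
  apply: is_derive_eq (is_deriveV wn0 (is_derive_poly w x)) _.
  by rewrite /V -[_ *: _]/(_ * _) exprVn mulrC mulrN.
have dVk : is_derive x 1 (fun y => V y ^+ k) (- (k%:R * w^`().[x] * V x ^+ k.+1)).
  have -> : (fun y => V y ^+ k) = V ^+ k by apply/funext => y; rewrite fctE.
  case: k => [|k].
    rewrite expr0 !mul0r oppr0; exact: is_derive_cst.
  apply: is_derive_eq (is_deriveX k.+1 dV) _.
  by rewrite -[_ *: _]/(_ * _) /= !exprS; ring.
have dE : is_derive x 1 (fun y => expR (- lam * V y))
    (lam * w^`().[x] * V x ^+ 2 * expR (- lam * V x)).
  have d1 : is_derive x 1 (fun y => - lam * V y) (lam * w^`().[x] * V x ^+ 2).
    have -> : (fun y => - lam * V y) = (- lam) \*: V by [].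
    by apply: is_derive_eq (is_deriveZ _ dV) _; rewrite -[_ *: _]/(_ * _); ring.
  have := @is_derive1_comp _ _ (fun y => - lam * V y) x _ _ (is_derive_expR _) d1.
  by rewrite -[_ \o _]/(fun y => expR (- lam * V y)) => H; apply: is_derive_eq H _; rewrite mulrC.
have -> : bump_core p k = (horner p * (fun y => V y ^+ k)) * (fun y => expR (- lam * V y)) by [].
apply: is_derive_eq (is_deriveM (is_deriveM (is_derive_poly p x) dVk) dE) _.
have HP (q : {poly R}) :
    (p^`() * q ^+ 2 - k%:R *: (p * q^`() * q) + lam *: (p * q^`())).[x] =
    p^`().[x] * q.[x] ^+ 2 - k%:R * (p.[x] * q^`().[x] * q.[x]) +
    lam * (p.[x] * q^`().[x]).
  by rewrite !(hornerD, hornerN, hornerM, hornerZ, horner_exp).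
have sc (a b : R) : a *: b = a * b by [].
rewrite /bump_core HP fctE !sc -!/(V x) !(exprS _ k.+1) (exprS _ k).
set E := expR _; set vk := V x ^+ k; rewrite /V.
by field.
Qed.

Lemma is_derive_bump p k x :
  is_derive x 1 (bump p k) (bump (bump_deriv_poly p k) k.+2 x).
Proof.
rewrite {2}/bump; case: ifPn => xI.
  apply: near_eq_is_derive (is_derive_bump_core p k xI).
  have /andP[a b] := xI.
  near=> y; rewrite /bump ifT//; apply/andP; split; near: y.
    exact: lt_nbhsr.
  exact: lt_nbhsl.
(* Outside ]x0, x1[ the bump is quadratically small: exp beats the pole. *)
have [M M0 HM] : exists2 M, 0 < M & forall y, x0 < y < x1 -> `|p.[y]| <= M.
  have [|M [Mr HM]] := @compact_bounded _ _ ((horner p) @` `[x0, x1]).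
    apply: continuous_compact; last exact: segment_compact.
    apply: continuous_subspaceT => y; exact: continuous_horner.
  exists (`|M| + 1); first by rewrite ltr_wpDl.
  move=> y yI; apply: HM; first by rewrite ltr_pwDr// ler_norm.
  by exists y => //=; rewrite in_itv/=; case/andP: yI => a b; rewrite !ltW.
pose N := k.+2; pose C := N`!%:R / lam ^+ N.
have C0 : 0 < C by rewrite divr_gt0// ?exprn_gt0// ltr0n fact_gt0.
have small y : x0 < y < x1 -> `|bump_core p k y| <= M * C * w.[y] ^+ 2.
  move=> yI; have wy := bump_base_gt0 yI; rewrite /bump_core !normrM.
  have vk0 : 0 <= (w.[y])^-1 ^+ k by rewrite exprn_ge0// invr_ge0 ltW.
  rewrite (ger0_norm (expR_ge0 _)) (ger0_norm vk0) -!mulrA.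
  apply: ler_pM; rewrite ?mulr_ge0 ?expR_ge0//; first exact: HM.
  rewrite mulNr expRN.
  have tpos : 0 <= lam * (w.[y])^-1 by rewrite mulr_ge0 ?invr_ge0 ?ltW.
  have := expR_ge1Dxn k.+1 tpos => B.
  have {}B : (lam * (w.[y])^-1) ^+ N / N`!%:R <= expR (lam * (w.[y])^-1) by lra.
  rewrite ler_pdivrMr ?expR_gt0//.
  have Cw0 : 0 <= C * w.[y] ^+ 2 by apply: mulr_ge0; [exact: ltW|exact: sqr_ge0].
  rewrite [X in X * expR _]mulrA -/C; apply: le_trans (ler_wpM2l Cw0 B).
  rewrite le_eqVlt; apply/orP; left; apply/eqP.
  rewrite /C exprMn /N !exprS; set vk := _ ^-1 ^+ k; set lk := lam ^+ k.
  have lk0 : lk != 0 by rewrite expf_neq0// gt_eqF.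
  have f0 : (k.+2)`!%:R != 0 :> R by rewrite pnatr_eq0 -lt0n fact_gt0.
  by field; rewrite f0 lk0 !gt_eqF.
pose L := x1 - x0.
have L0 : 0 < L by rewrite subr_gt0.
have wL y : x0 < y < x1 -> w.[y] <= L * `|y - x|.
  move=> /andP[a b]; rewrite bump_baseE; move: xI; rewrite negb_and -!leNgt => /orP[xx|xx].
    rewrite ger0_norm ?subr_ge0; last by rewrite (le_trans xx)// ltW.
    by rewrite mulrC /L; apply: ler_pM; lra.
  rewrite ler0_norm ?subr_le0; last by apply: le_trans xx; rewrite ltW.
  by rewrite opprB /L; apply: ler_pM; lra.
apply/is_derive_epsP => e e0.
have bx : bump p k x = 0 by rewrite /bump (negbTE xI).
pose K := M * C * L ^+ 2.
have K0 : 0 < K by apply: mulr_gt0; [exact: mulr_gt0|exact: exprn_gt0].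
near=> y; rewrite bx mul0r !subr0 /bump; case: ifPn => [yI|_]; last by rewrite normr0 mulr_ge0// ltW.
apply: (le_trans (small y yI)).
have wy := bump_base_gt0 yI.
apply: (@le_trans _ _ (K * `|y - x| ^+ 2)).
  rewrite /K -(mulrA (M * C)) -exprMn; apply: ler_wpM2l; first by apply: mulr_ge0; exact: ltW.
  apply: lerXn2r; rewrite ?nnegrE; [exact: ltW| |exact: wL].
  by apply: mulr_ge0 => //; exact: ltW.
rewrite expr2 mulrA ler_wpM2r//.
rewrite mulrC -ler_pdivlMr//; near: y.
have /cvgrPdist_le := @cvg_id _ (nbhs x) => /(_ (e / K) (divr_gt0 e0 K0)).
by apply: filterS => y; rewrite distrC.
Unshelve. all: by end_near.
Qed.

End Bump.

Section TensorBump.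
Context {R : realType}.
Variables (x0 x1 y0 y1 lam : R).
Hypotheses (x01 : x0 < x1) (y01 : y0 < y1) (lam0 : 0 < lam).

(** A class of functions of two variables that contains products of bumps and
    is stable under directional derivatives, so that smoothness follows by
    induction on the list of directions. *)
Inductive tensor_bump : (R * R -> R) -> Prop :=
| tensor_bump_prod p k q l : tensor_bump
    (fun z => bump x0 x1 lam p k z.1 * bump y0 y1 lam q l z.2)
| tensor_bump_lin a b f g : tensor_bump f -> tensor_bump g ->
    tensor_bump (fun z => a * f z + b * g z).

Lemma is_derive_dir (A : R -> R) (x v d : R) :
  is_derive x 1 A d -> is_derive x v A (v * d).
Proof.
move=> [D1 D2]; have dA : differentiable A x by apply/derivable1_diffP.
split; first exact: diff_derivable.
rewrite deriveE// -[v in 'd A x v]mulr1 -[v * 1]/(v *: 1) linearZ /=.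
by rewrite -deriveE// D2.
Qed.

Lemma is_derive_fst (A : R -> R) (z e : R * R) (d : R) :
  is_derive z.1 1 A d -> is_derive z e (fun z => A z.1) (e.1 * d).
Proof. by move=> /(is_derive_dir e.1) [D1 D2]; split. Qed.

Lemma is_derive_snd (A : R -> R) (z e : R * R) (d : R) :
  is_derive z.2 1 A d -> is_derive z e (fun z => A z.2) (e.2 * d).
Proof. by move=> /(is_derive_dir e.2) [D1 D2]; split. Qed.

Lemma is_derive_tensor (A B A' B' : R -> R) (z e : R * R) :
  is_derive z.1 1 A (A' z.1) -> is_derive z.2 1 B (B' z.2) ->
  is_derive z e (fun z => A z.1 * B z.2)
    (e.1 * (A' z.1 * B z.2) + e.2 * (A z.1 * B' z.2)).
Proof.
move=> dA dB.
have := is_deriveM (is_derive_fst e dA) (is_derive_snd e dB) => H.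
apply: is_derive_eq H _; rewrite -![_ *: _]/(_ * _); ring.
Qed.

Lemma tensor_bump_derive f e : tensor_bump f ->
  exists2 g, tensor_bump g & forall z, is_derive z e f (g z).
Proof.
elim=> [p k q l|a b {}f g _ [f' tf' df] _ [g' tg' dg]].
  exists (fun z => e.1 * (bump x0 x1 lam (bump_deriv_poly x0 x1 lam p k) k.+2 z.1 *
                          bump y0 y1 lam q l z.2) +
                   e.2 * (bump x0 x1 lam p k z.1 *
                          bump y0 y1 lam (bump_deriv_poly y0 y1 lam q l) l.+2 z.2)).
    by apply: tensor_bump_lin; exact: tensor_bump_prod.
  by move=> z; apply: is_derive_tensor; exact: is_derive_bump.
exists (fun z => a * f' z + b * g' z); first exact: tensor_bump_lin.
move=> z; have := is_deriveD (is_deriveZ a (df z)) (is_deriveZ b (dg z)) => H.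
exact: is_derive_eq H _.
Qed.

Lemma continuous_bump (a b : R) p k : a < b -> continuous (bump a b lam p k).
Proof. by move=> ab x; apply: is_derive1_continuous; exact: is_derive_bump. Qed.

Lemma continuous_tensor_bump f : tensor_bump f -> continuous f.
Proof.
elim=> [p k q l|a b {}f g _ cf _ cg] z.
  apply: cvgM.
    by apply: (continuous_comp (f := fst)); [exact: cvg_fst|exact: continuous_bump].
  by apply: (continuous_comp (f := snd)); [exact: cvg_snd|exact: continuous_bump].
by apply: cvgD; apply: cvgM; [exact: cvg_cst|exact: cf|exact: cvg_cst|exact: cg].
Qed.

Lemma tensor_bump_smooth f : tensor_bump f -> smooth f.
Proof.
move=> tf s.
have {tf} : tensor_bump (foldr (fun e k => 'D_e k) f s).
  elim: s => [|e s] //= /(tensor_bump_derive e) [g tg dg].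
  suff -> : 'D_e (foldr (fun e k => 'D_e k) f s) = g by [].
  by apply/funext => z; have [] := dg z.
move=> tg; split; first exact: continuous_tensor_bump.
by move=> z e; have [g _ dg] := tensor_bump_derive e tg; have [] := dg z.
Qed.

Lemma tensor_bump_test (Om : set (R * R)) p k q l :
  `[x0, x1] `*` `[y0, y1] `<=` Om ->
  test_function Om (fun z => bump x0 x1 lam p k z.1 * bump y0 y1 lam q l z.2).
Proof.
move=> KOm; split; first by apply: tensor_bump_smooth; exact: tensor_bump_prod.
exists (`[x0, x1] `*` `[y0, y1]); split => //.
  by apply: compact_setX; exact: segment_compact.
move=> [x y] nK; rewrite /bump /=; case: ifPn => xI; last by rewrite mul0r.
case: ifPn => yI; last by rewrite mulr0.
by exfalso; apply: nK; split; rewrite /= in_itv/=; lra.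
Qed.

End TensorBump.

Section PlainBump.
Context {R : realType}.
Variables (a b : R).
Hypothesis ab : a < b.

Definition lam_ n : R := (n.+1%:R)^-1.

Lemma lam_gt0 n : 0 < lam_ n. Proof. by rewrite invr_gt0. Qed.

(** exp(-1/((n+1)(x-a)(b-x))): smooth approximations of the indicator of
    ]a, b[ which increase up to the midpoint and decrease beyond it, so that the
    mass of their derivative concentrates at the two end points. *)
Definition plateau n : R -> R := bump a b (lam_ n) 1 0.
Definition plateau' n : R -> R :=
  bump a b (lam_ n) (bump_deriv_poly a b (lam_ n) 1 0) 2.

Lemma plateauE n x : a < x < b ->
  plateau n x = expR (- lam_ n * ((x - a) * (b - x))^-1).
Proof.
by move=> xI; rewrite /plateau /bump xI /bump_core expr0 mulr1 -[1]/(1%:P) hornerC mul1r bump_baseE.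
Qed.

Lemma is_derive_plateau n (x : R) : is_derive x 1 (plateau n) (plateau' n x).
Proof. by apply: is_derive_bump => //; exact: lam_gt0. Qed.

Lemma plateau_ge0 n x : 0 <= plateau n x.
Proof.
have [xI|xI] := boolP (a < x < b); first by rewrite plateauE// expR_ge0.
by rewrite /plateau /bump (negbTE xI).
Qed.

Lemma plateau_le1 n x : plateau n x <= 1.
Proof.
have [xI|xI] := boolP (a < x < b); last by rewrite /plateau /bump (negbTE xI).
rewrite plateauE// -expR0 ler_expR mulNr oppr_le0 mulr_ge0 ?(ltW (lam_gt0 _))//.
by rewrite invr_ge0; apply: mulr_ge0; lra.
Qed.

Lemma cvg_lam_ : lam_ n @[n --> \oo] --> (0 : R).
Proof. exact: cvg_harmonic. Qed.

Lemma cvg_plateau x : a < x < b -> plateau n x @[n --> \oo] --> (1 : R).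
Proof.
move=> xI; rewrite -[X in _ --> X]expR0.
under eq_cvg do rewrite plateauE//.
apply: (cvg_comp (fun n => - lam_ n * ((x - a) * (b - x))^-1) expR); last exact: continuous_expR.
have : (- lam_ n * ((x - a) * (b - x))^-1) @[n --> \oo] --> - 0 * ((x - a) * (b - x))^-1.
  by apply: cvgM; [apply: cvgN; exact: cvg_lam_|exact: cvg_cst].
by rewrite oppr0 mul0r.
Qed.

Lemma plateau'E n x : a < x < b ->
  plateau' n x = lam_ n * (a + b - 2 * x) * ((x - a) * (b - x))^-1 ^+ 2 * plateau n x.
Proof.
move=> xI; rewrite plateauE// /plateau' /bump xI /bump_core bump_baseE.
congr (_ * _ * _).
rewrite /bump_deriv_poly mulr0n scale0r subr0 !mul1r -[1]/(1%:P) derivC mul0r add0r.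
rewrite hornerZ; congr (_ * _).
rewrite /bump_base derivM !derivB derivX !derivC.
rewrite !(hornerD, hornerN, hornerM, hornerC, hornerX).
by ring.
Qed.

End PlainBump.

(** * Weak derivatives on rectangles *)

Section Concentration.
Context {R : realType}.
Notation mu := (@lebesgue_measure R).
Implicit Types (f g k : R -> R).

Lemma le_normr_Rintegral_dom f g (a b : R) : continuous f -> continuous g ->
  (forall x, a <= x <= b -> `|f x| <= g x) ->
  `|\int[mu]_(t in `[a, b]) f t| <= \int[mu]_(t in `[a, b]) g t.
Proof.
move=> cf cg fg; have fi := @continuous_integrable_itv R f a b cf.
apply: (le_trans (le_normr_Rintegral _ fi)) => //.
apply: le_Rintegral => //.
- by apply: continuous_integrable_itv => x; apply: continuous_comp; [exact: cf|exact: norm_continuous].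
- exact: continuous_integrable_itv.
Qed.

Lemma RintegralB_continuous f g (a b : R) : continuous f -> continuous g ->
  \int[mu]_(t in `[a, b]) (f t - g t) =
  \int[mu]_(t in `[a, b]) f t - \int[mu]_(t in `[a, b]) g t.
Proof. by move=> cf cg; rewrite RintegralB//; exact: continuous_integrable_itv. Qed.

Lemma RintegralZl_continuous f c (a b : R) : continuous f ->
  \int[mu]_(t in `[a, b]) (c * f t) = c * \int[mu]_(t in `[a, b]) f t.
Proof. by move=> cf; rewrite RintegralZl//; exact: continuous_integrable_itv. Qed.

Variables (a b : R).
Hypothesis ab : a < b.

Lemma continuous_plateau n : continuous (plateau a b n).
Proof. by apply: continuous_bump => //; exact: lam_gt0. Qed.

Lemma continuous_plateau' n : continuous (plateau' a b n).
Proof. by apply: continuous_bump => //; exact: lam_gt0. Qed.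

Lemma Rintegral_plateau' n s t : s <= t ->
  \int[mu]_(x in `[s, t]) plateau' a b n x = plateau a b n t - plateau a b n s.
Proof.
move=> st; apply: Rintegral_FTC2 => //; first exact: continuous_plateau'.
  by apply: continuous_subspaceT; exact: continuous_plateau.
by move=> x _; exact: is_derive_plateau.
Qed.

(** The derivative of the plateau is positive near a, negative near b, has mass
    1 and -1 there, and tends to zero uniformly in between; it thus converges to
    the difference of the Dirac masses at a and b. *)
Lemma cvg_Rintegral_plateau' k : continuous k ->
  \int[mu]_(x in `[a, b]) (k x * plateau' a b n x) @[n --> \oo] --> k a - k b.
Proof.
move=> ck; have cM n : continuous (fun x => k x * plateau' a b n x).
  by move=> x; apply: cvgM; [exact: ck|exact: continuous_plateau'].
apply/cvgrPdist_le => e e0.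
have e40 : 0 < e / 4 by rewrite divr_gt0.
have [d [d0 dab kda kdb]] : exists d, [/\ 0 < d, 2 * d < b - a,
    forall x, a <= x <= a + d -> `|k x - k a| <= e / 4 &
    forall x, b - d <= x <= b -> `|k x - k b| <= e / 4].
  have near_k x : exists2 d, 0 < d & forall y, `|y - x| < d -> `|k y - k x| <= e / 4.
    have /cvgrPdist_le/(_ _ e40) := ck x.
    move=> /(@nbhs_ballP _ _ x _)[d d0 H]; exists d => // y yx.
    by rewrite distrC; apply: H; rewrite /ball /= distrC.
  have [d1 d10 H1] := near_k a; have [d2 d20 H2] := near_k b.
  exists (Num.min (Num.min d1 d2) (b - a) / 3).
  have m1 : Num.min (Num.min d1 d2) (b - a) <= d1 by rewrite !ge_min lexx.
  have m2 : Num.min (Num.min d1 d2) (b - a) <= d2 by rewrite !ge_min lexx orbT.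
  have m3 : Num.min (Num.min d1 d2) (b - a) <= b - a by rewrite ge_min lexx orbT.
  have m0 : 0 < Num.min (Num.min d1 d2) (b - a) by rewrite !lt_min d10 d20 subr_gt0.
  split; [lra|lra| |].
  - by move=> x xI; apply: H1; rewrite ger0_norm; lra.
  - by move=> x xI; apply: H2; rewrite ler0_norm; lra.
have [C C0 HC] : exists2 C, 0 <= C & forall x, a <= x <= b -> `|k x| <= C.
  have [|M [Mr HM]] := @compact_bounded _ _ (k @` `[a, b]).
    by apply: continuous_compact; [exact: continuous_subspaceT|exact: segment_compact].
  exists (`|M| + 1); first by rewrite addr_ge0.
  move=> y yI; apply: HM; first by rewrite ltr_pwDr// ler_norm.
  by exists y => //=; rewrite in_itv.
pose K := C * ((b - a) * (d * d)^-1 ^+ 2) * (b - a).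
have P1 n : `|\int[mu]_(x in `[a, a + d]) (k x * plateau' a b n x) - k a * plateau a b n (a + d)| <= e / 4.
  have pa : plateau a b n a = 0 by rewrite /plateau /bump ltxx.
  have -> : k a * plateau a b n (a + d) = \int[mu]_(x in `[a, a + d]) (k a * plateau' a b n x).
    rewrite RintegralZl_continuous; last exact: continuous_plateau'.
    by rewrite Rintegral_plateau' ?pa ?subr0//; lra.
  rewrite -RintegralB_continuous//; last first.
    by move=> x; apply: cvgM; [exact: cvg_cst|exact: continuous_plateau'].
  apply: (@le_trans _ _ (\int[mu]_(x in `[a, a + d]) (e / 4 * plateau' a b n x))).
    apply: le_normr_Rintegral_dom.
    - by move=> x; apply: cvgB; [exact: cM|apply: cvgM; [exact: cvg_cst|exact: continuous_plateau']].
    - by move=> x; apply: cvgM; [exact: cvg_cst|exact: continuous_plateau'].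
    move=> x xI; rewrite -mulrBl normrM.
    have p0 : 0 <= plateau' a b n x.
      have [xI'|xI'] := boolP (a < x < b); last by rewrite /plateau' /bump (negbTE xI').
      rewrite plateau'E//; apply: mulr_ge0; last exact: plateau_ge0.
      apply: mulr_ge0; last exact: sqr_ge0.
      by apply: mulr_ge0; [exact: ltW (lam_gt0 _)|lra].
    by rewrite (ger0_norm p0); apply: ler_wpM2r => //; exact: kda.
  rewrite RintegralZl_continuous; last exact: continuous_plateau'.
  rewrite Rintegral_plateau' ?pa ?subr0; last lra.
  by rewrite -[leRHS]mulr1; apply: ler_wpM2l; [exact: ltW|apply: plateau_le1].
have P3 n : `|\int[mu]_(x in `[b - d, b]) (k x * plateau' a b n x) + k b * plateau a b n (b - d)| <= e / 4.
  have pb : plateau a b n b = 0 by rewrite /plateau /bump ltxx andbF.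
  have -> : k b * plateau a b n (b - d) = - \int[mu]_(x in `[b - d, b]) (k b * plateau' a b n x).
    rewrite RintegralZl_continuous; last exact: continuous_plateau'.
    by rewrite Rintegral_plateau' ?pb ?sub0r ?mulrN ?opprK//; lra.
  rewrite -RintegralB_continuous//; last first.
    by move=> x; apply: cvgM; [exact: cvg_cst|exact: continuous_plateau'].
  apply: (@le_trans _ _ (\int[mu]_(x in `[b - d, b]) (- (e / 4) * plateau' a b n x))).
    apply: le_normr_Rintegral_dom.
    - by move=> x; apply: cvgB; [exact: cM|apply: cvgM; [exact: cvg_cst|exact: continuous_plateau']].
    - by move=> x; apply: cvgM; [exact: cvg_cst|exact: continuous_plateau'].
    move=> x xI; rewrite -mulrBl normrM.
    have p0 : plateau' a b n x <= 0.
      have [xI'|xI'] := boolP (a < x < b); last by rewrite /plateau' /bump (negbTE xI').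
      rewrite plateau'E//; apply: mulr_le0_ge0; last exact: plateau_ge0.
      apply: mulr_le0_ge0; last exact: sqr_ge0.
      by apply: mulr_ge0_le0; [exact: ltW (lam_gt0 _)|lra].
    by rewrite (ler0_norm p0) mulNr -mulrN; apply: ler_wpM2r; [rewrite oppr_ge0|exact: kdb].
  rewrite RintegralZl_continuous; last exact: continuous_plateau'.
  rewrite Rintegral_plateau' ?pb ?sub0r; last lra.
  by rewrite mulrNN -[leRHS]mulr1; apply: ler_wpM2l; [exact: ltW|apply: plateau_le1].
have P2 n : `|\int[mu]_(x in `[a + d, b - d]) (k x * plateau' a b n x)| <= K * lam_ n.
  apply: (@le_trans _ _ (C * ((b - a) * (d * d)^-1 ^+ 2) * lam_ n * (b - d - (a + d)))).
    apply: le_normr_Rintegral_cst => //; first lra.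
    move=> x xI; have xI' : a < x < b by lra.
    rewrite normrM -!mulrA; apply: ler_pM => //; first by apply: HC; lra.
    rewrite plateau'E// 3!normrM (ger0_norm (ltW (lam_gt0 n))).
    rewrite (ger0_norm (plateau_ge0 _ _ _ _)) (ger0_norm (sqr_ge0 _)).
    apply: (@le_trans _ _ (lam_ n * `|a + b - 2 * x| * ((x - a) * (b - x))^-1 ^+ 2)).
      rewrite -[leRHS]mulr1; apply: ler_wpM2l; last exact: plateau_le1.
      by apply: mulr_ge0; [apply: mulr_ge0 => //; exact: ltW (lam_gt0 _)|exact: sqr_ge0].
    apply: (@le_trans _ _ (lam_ n * ((b - a) * (d * d)^-1 ^+ 2))); last first.
      by rewrite le_eqVlt; apply/orP; left; apply/eqP; ring.
    rewrite -mulrA; apply: ler_wpM2l; first exact: ltW (lam_gt0 _).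
    apply: ler_pM => //; first exact: sqr_ge0.
      by rewrite ler_norml; lra.
    rewrite lerXn2r ?nnegrE ?invr_ge0//; [| |].
    - by apply: mulr_ge0; lra.
    - by apply: mulr_ge0; lra.
    rewrite lef_pV2 ?posrE; [by apply: ler_pM; lra| |]; by apply: mulr_gt0; lra.
  rewrite /K -[leLHS]mulrA -[leRHS]mulrA; apply: ler_wpM2l.
    by apply: mulr_ge0 => //; apply: mulr_ge0; [lra|exact: sqr_ge0].
  by rewrite (mulrC (b - a)); apply: ler_wpM2l; [exact: ltW (lam_gt0 _)|lra].
have L1 : k a * plateau a b n (a + d) @[n --> \oo] --> k a * 1.
  by apply: cvgM; [exact: cvg_cst|apply: cvg_plateau => //; lra].
have L3 : k b * plateau a b n (b - d) @[n --> \oo] --> k b * 1.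
  by apply: cvgM; [exact: cvg_cst|apply: cvg_plateau => //; lra].
have L2 : K * lam_ n @[n --> \oo] --> K * (0 : R).
  by apply: cvgM; [exact: cvg_cst|exact: cvg_lam_].
have e80 : 0 < e / 8 by rewrite divr_gt0.
have /cvgrPdist_le/(_ _ e80) := L1; have /cvgrPdist_le/(_ _ e80) := L3.
have /cvgrPdist_le/(_ _ e80) := L2; rewrite !mulr1 mulr0 => M2 M3 M1.
near=> n.
have := P1 n; have := P2 n; have := P3 n.
have : `|k a - k a * plateau a b n (a + d)| <= e / 8 by near: n.
have : `|k b - k b * plateau a b n (b - d)| <= e / 8 by near: n.
have : `|0 - K * lam_ n| <= e / 8 by near: n.
rewrite (@Rintegral_itv_chasles R _ a (a + d) b); [|lra|exact: continuous_integrable_itv].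
rewrite (@Rintegral_itv_chasles R _ (a + d) (b - d) b); [|lra|exact: continuous_integrable_itv].
rewrite !ler_norml; lra.
Unshelve. all: by end_near.
Qed.

End Concentration.

Section WeakRectangle.
Context {R : realType}.
Notation mu := (@lebesgue_measure R).
Notation mu2 := (lebesgue_measure \x lebesgue_measure)%E.

Lemma cvg_Rintegral_dominated d (T : measurableType d) (nu : {measure set T -> \bar R})
    (D : set T) (f_ : nat -> T -> R) (f G : T -> R) :
  measurable D -> (forall n, measurable_fun D (f_ n)) ->
  nu.-integrable D (EFin \o G) ->
  (forall n x, D x -> `|f_ n x| <= G x) ->
  (forall x, D x -> f_ n x @[n --> \oo] --> f x) ->
  nu.-integrable D (EFin \o f) /\
  \int[nu]_(x in D) f_ n x @[n --> \oo] --> \int[nu]_(x in D) f x.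
Proof.
move=> mD mf_ Gi fG cf.
have mf : measurable_fun D f by exact: (measurable_fun_cvg mf_ cf).
have [|||||fi _ C] := @dominated_convergence _ _ _ nu D mD
   (fun n => EFin \o f_ n) (EFin \o f) (EFin \o G).
- by move=> n; apply/measurable_EFinP.
- exact/measurable_EFinP.
- by apply: aeW => x Dx; apply/cvg_EFin; [exact: nearW|exact: cf].
- exact: Gi.
- by apply: aeW => x n Dx; rewrite /= lee_fin fG.
split => //; apply/fine_cvg; rewrite /Rintegral fineK//; last exact: integrable_fin_num.
Qed.

Lemma cvgM1 (f g : nat -> R) (l : R) : f n @[n --> \oo] --> l ->
  g n @[n --> \oo] --> (1 : R) -> f n * g n @[n --> \oo] --> l.
Proof. by move=> cf cg; rewrite -[l]mulr1; exact: cvgM. Qed.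

(** Up to the midpoint and beyond it the plateau is monotone, so its total
    variation is twice its maximum. *)
Lemma plateau'_mass (a b : R) n : a < b ->
  \int[mu]_(x in `[a, b]) `|plateau' a b n x| <= 2.
Proof.
move=> ab; pose m := (a + b) / 2.
have am : a < m by rewrite /m ltr_pdivlMr//; lra.
have mb : m < b by rewrite /m ltr_pdivrMr//; lra.
have cp : continuous (fun x => `|plateau' a b n x|).
  by move=> x; apply: continuous_comp; [exact: continuous_plateau'|exact: norm_continuous].
rewrite (@Rintegral_itv_chasles R _ a m b); [|lra|exact: continuous_integrable_itv].
have -> : \int[mu]_(x in `[a, m]) `|plateau' a b n x| = plateau a b n m.
  transitivity (\int[mu]_(x in `[a, m]) (plateau' a b n x)).
    apply: eq_Rintegral => x; rewrite inE/= in_itv/= => xI; apply: ger0_norm.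
    have [xI'|xI'] := boolP (a < x < b); last by rewrite /plateau' /bump (negbTE xI').
    rewrite plateau'E//; apply: mulr_ge0; last exact: plateau_ge0.
    apply: mulr_ge0; last exact: sqr_ge0.
    apply: mulr_ge0; first exact: ltW (lam_gt0 _).
    by move: xI; rewrite /m ler_pdivlMr//; lra.
  by rewrite Rintegral_plateau' ?ltW// [X in _ - X]/plateau /bump ltxx subr0.
have -> : \int[mu]_(x in `[m, b]) `|plateau' a b n x| = plateau a b n m.
  transitivity (\int[mu]_(x in `[m, b]) ((-1) * plateau' a b n x)).
    apply: eq_Rintegral => x; rewrite inE/= in_itv/= mulN1r => xI; apply: ler0_norm.
    have [xI'|xI'] := boolP (a < x < b); last by rewrite /plateau' /bump (negbTE xI').
    rewrite plateau'E//; apply: mulr_le0_ge0; last exact: plateau_ge0.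
    apply: mulr_le0_ge0; last exact: sqr_ge0.
    apply: mulr_ge0_le0; first exact: ltW (lam_gt0 _).
    by move: xI; rewrite /m ler_pdivrMr//; lra.
  rewrite RintegralZl_continuous; last exact: continuous_plateau'.
  rewrite Rintegral_plateau' ?ltW// [X in X - _]/plateau /bump ltxx andbF.
  by rewrite sub0r mulN1r opprK.
by have := plateau_le1 a b n m; lra.
Qed.


Lemma bounded_rect (f : R * R -> R) a b c d : continuous f ->
  exists2 C, 0 <= C & forall x y, a <= x <= b -> c <= y <= d -> `|f (x, y)| <= C.
Proof.
move=> cf.
have [|M [Mr HM]] := @compact_bounded _ _ (f @` (`[a, b] `*` `[c, d])).
  apply: continuous_compact; first exact: continuous_subspaceT.
  by apply: compact_setX; exact: segment_compact.
exists (`|M| + 1); first by rewrite addr_ge0.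
move=> x y xI yI; apply: HM; first by rewrite ltr_pwDr// ler_norm.
by exists (x, y) => //=; rewrite !in_itv.
Qed.

Lemma continuous_prodM (A B : R -> R) : continuous A -> continuous B ->
  continuous (fun z : R * R => A z.1 * B z.2).
Proof.
move=> cA cB z; apply: cvgM.
  by apply: (continuous_comp (f := fst)); [exact: cvg_fst|exact: cA].
by apply: (continuous_comp (f := snd)); [exact: cvg_snd|exact: cB].
Qed.

Section Rectangle.
Variables (a b c d : R).
Hypotheses (ab : a < b) (cd : c < d).

(** Testing the horizontal derivative against a product of plateaus: in the
    limit the derivative of the first factor samples f on the two vertical
    sides. *)
Lemma cvg_rect_plateau' (f : R * R -> R) : continuous f ->
  \int[mu2]_(z in `]a, b[ `*` `]c, d[) (f z * (plateau' a b n z.1 * plateau c d n z.2))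
    @[n --> \oo] --> \int[mu]_(y in `]c, d[) (f (a, y) - f (b, y)).
Proof.
move=> cf.
have [C C0 HC] := bounded_rect a b c d cf.
pose F n y := \int[mu]_(x in `]a, b[) (f (x, y) * (plateau' a b n x * plateau c d n y)).
have cn n : continuous (fun z : R * R => f z * (plateau' a b n z.1 * plateau c d n z.2)).
  move=> z; apply: cvgM; first exact: cf.
  by apply: continuous_prodM; [exact: continuous_plateau'|exact: continuous_plateau].
have fi n : mu2.-integrable (`]a, b[ `*` `]c, d[)
    (EFin \o (fun z : R * R => f z * (plateau' a b n z.1 * plateau c d n z.2))).
  apply: integrableS (continuous_integrable_rect a b c d (cn n)).
  - by apply: measurable_rect; exact: measurable_itv.
  - by apply: measurable_rect; exact: measurable_itv.
  - by move=> -[x y] []; split; exact: subset_itv_oo_cc.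
have fiE n : \int[mu2]_(z in `]a, b[ `*` `]c, d[) (f z * (plateau' a b n z.1 * plateau c d n z.2)) =
    \int[mu]_(y in `]c, d[) F n y.
  by rewrite /F -(@Rintegral_yx R `]a, b[%classic `]c, d[%classic)//; exact: measurable_itv.
under eq_cvg do rewrite fiE.
have FE n y : F n y = (\int[mu]_(x in `[a, b]) (f (x, y) * plateau' a b n x)) * plateau c d n y.
  have cxy : continuous (fun x => f (x, y) * plateau' a b n x).
    by move=> x; apply: cvgM; [exact: (@continuous_ysection R f y cf x)|exact: continuous_plateau'].
  rewrite /F -RintegralZr//; last exact: continuous_integrable_itv.
  under eq_Rintegral do rewrite mulrA.
  have ci : mu.-integrable `[a, b] (EFin \o (fun x => f (x, y) * plateau' a b n x * plateau c d n y)).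
    by apply: continuous_integrable_itv => x; apply: cvgM; [exact: cxy|exact: cvg_cst].
  rewrite -Rintegral_itv_obnd_cbnd; last first.
    by apply: integrableS ci => //; apply: subset_itvr; rewrite bnd_simp.
  rewrite Rintegral_itv_bndo_bndc//.
  by apply: integrableS ci => //; exact: subset_itv_oo_cc.
have [//|||||_ ] := @cvg_Rintegral_dominated _ _ mu `]c, d[%classic F (fun y => f (a, y) - f (b, y)) (cst (2 * C)).
- move=> n; apply/measurable_EFinP; apply: measurable_int.
  exact: (integrable_ysection_integral (measurable_itv _) (measurable_itv _) (fi n)).
- apply: integrableS (@continuous_integrable_itv R (cst (2 * C)) c d _) => //.
    exact: subset_itv_oo_cc.
  by move=> x; exact: cvg_cst.
- move=> n y /=; rewrite in_itv/= => /andP[cy yd]; rewrite FE normrM.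
  apply: (@le_trans _ _ (C * 2 * 1)); last by rewrite mulr1 mulrC.
  apply: ler_pM => //; last by rewrite ger0_norm ?plateau_ge0// plateau_le1.
  apply: (@le_trans _ _ (\int[mu]_(x in `[a, b]) (C * `|plateau' a b n x|))).
    apply: le_normr_Rintegral_dom.
    - by move=> x; apply: cvgM; [exact: (@continuous_ysection R f y cf x)|exact: continuous_plateau'].
    - move=> x; apply: cvgM; first exact: cvg_cst.
      by apply: continuous_comp; [exact: continuous_plateau'|exact: norm_continuous].
    by move=> x xI; rewrite normrM; apply: ler_wpM2r => //; apply: HC => //; rewrite !ltW.
  rewrite RintegralZl_continuous; last first.
    by move=> x; apply: continuous_comp; [exact: continuous_plateau'|exact: norm_continuous].
  by apply: ler_wpM2l => //; exact: plateau'_mass.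
- move=> y /=; rewrite in_itv/= => yI; under eq_cvg do rewrite FE.
  apply: cvgM1; last exact: cvg_plateau.
  by apply: (@cvg_Rintegral_plateau' R a b ab (fun x => f (x, y))); exact: continuous_ysection.
by [].
Qed.

Lemma cvg_rect_plateau (g : R * R -> R) :
  mu2.-integrable (`]a, b[ `*` `]c, d[) (EFin \o g) ->
  \int[mu2]_(z in `]a, b[ `*` `]c, d[) (g z * (plateau a b n z.1 * plateau c d n z.2))
    @[n --> \oo] --> \int[mu2]_(z in `]a, b[ `*` `]c, d[) g z.
Proof.
move=> gi.
have mD : measurable (`]a, b[%classic `*` `]c, d[%classic : set (measurableTypeR R * measurableTypeR R)).
  by apply: measurable_rect; exact: measurable_itv.
have [//|||||_ ] := @cvg_Rintegral_dominated _ _ mu2 (`]a, b[ `*` `]c, d[)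
   (fun n z => g z * (plateau a b n z.1 * plateau c d n z.2)) g (fun z => `|g z|).
- move=> n; apply: measurable_funM.
    by apply/measurable_EFinP; exact: measurable_int gi.
  apply: measurable_funS (measurableT) _ (continuous_measurable_fun2 _) => //.
  by apply: continuous_prodM; exact: continuous_plateau.
- exact: integrable_norm.
- move=> n z _; rewrite normrM -[leRHS]mulr1; apply: ler_wpM2l => //.
  rewrite ger0_norm; last by rewrite mulr_ge0 ?plateau_ge0.
  by rewrite -[leRHS]mulr1; apply: ler_pM; rewrite ?plateau_ge0 ?plateau_le1.
- move=> [x y] [/=]; rewrite !in_itv/= => xI yI.
  apply: cvgM1; first exact: cvg_cst.
  by apply: cvgM1; exact: cvg_plateau.
by [].
Qed.

End Rectangle.

End WeakRectangle.

Section WeakToLines.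
Context {R : realType}.
Notation mu := (@lebesgue_measure R).
Notation mu2 := (lebesgue_measure \x lebesgue_measure)%E.
Implicit Types (a b c d x y : R).

Lemma Rintegral_vanish (D E : set (R * R)) (g : R * R -> R) : E `<=` D ->
  (forall z, ~ E z -> g z = 0) ->
  \int[mu2]_(z in D) g z = \int[mu2]_(z in E) g z.
Proof.
move=> ED g0; rewrite [LHS]Rintegral_mkcond [RHS]Rintegral_mkcond.
congr (Rintegral _ _ _); apply/funext => z; rewrite !patchE.
have [zE|zE] := boolP (z \in E).
  by rewrite ifT// inE; apply: ED; rewrite -inE.
by rewrite g0 ?if_same// => Ez; move: zE; rewrite mem_set.
Qed.

Lemma bump_out (a b lam : R) p k x : ~ (x \in `]a, b[) -> bump a b lam p k x = 0.
Proof. by rewrite /bump in_itv/= => /negP/negbTE ->. Qed.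

Section Rect.
Variables (Om : set (R * R)) (a b c d : R) (u f g : R * R -> R).
Hypotheses (ab : a < b) (cd : c < d) (KOm : `[a, b] `*` `[c, d] `<=` Om).
Hypotheses (cf : continuous f) (fu : forall z, Om z -> f z = u z).
Hypothesis gi : mu2.-integrable (`[a, b] `*` `[c, d]) (EFin \o g).

Let K0 : set (R * R) := `]a, b[ `*` `]c, d[.

Let K0K : K0 `<=` `[a, b] `*` `[c, d].
Proof. by move=> [x y] [] /= ? ?; split; exact: subset_itv_oo_cc. Qed.

Let gi0 : mu2.-integrable K0 (EFin \o g).
Proof.
apply: integrableS gi => //; apply: measurable_rect; exact: measurable_itv.
Qed.

Let weak_plateau e n (w : R * R -> R) : weak_partial Om e u g ->
  (forall z, 'D_e (fun z => plateau a b n z.1 * plateau c d n z.2) z = w z) ->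
  (forall z, ~ K0 z -> w z = 0) ->
  \int[mu2]_(z in K0) (f z * w z) =
  - \int[mu2]_(z in K0) (g z * (plateau a b n z.1 * plateau c d n z.2)).
Proof.
move=> wk wE w0.
have := wk _ (tensor_bump_test ab cd (lam_gt0 n) 1 0 1 0 KOm).
have -> : (fun z : R * R => bump a b (lam_ n) 1 0 z.1 * bump c d (lam_ n) 1 0 z.2) =
  (fun z => plateau a b n z.1 * plateau c d n z.2) by [].
rewrite -(@Rintegral_vanish Om K0); first last.
- by move=> z Kz; rewrite w0// mulr0.
- by move=> z /K0K /KOm.
move=> E; have <- : \int[mu2]_(z in Om) (g z * (plateau a b n z.1 * plateau c d n z.2)) =
    \int[mu2]_(z in K0) (g z * (plateau a b n z.1 * plateau c d n z.2)).
  apply: Rintegral_vanish; first by move=> z /K0K /KOm.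
  move=> [x y] Kz /=; have [xI|xI] := boolP (x \in `]a, b[).
    rewrite [X in _ * (_ * X)]bump_out ?mulr0// => yI; apply: Kz; split => //.
  by rewrite [X in _ * (X * _)]bump_out ?mul0r ?mulr0//; exact/negP.
rewrite -E; apply: eq_Rintegral => z; rewrite inE => Oz.
by rewrite fu// wE.
Qed.

Lemma weak_rect_x : weak_partial Om (e_x R) u g ->
  \int[mu]_(y in `]c, d[) (f (b, y) - f (a, y)) =
  \int[mu2]_(z in `]a, b[ `*` `]c, d[) g z.
Proof.
move=> wk.
have E n : \int[mu2]_(z in K0) (f z * (plateau' a b n z.1 * plateau c d n z.2)) =
    - \int[mu2]_(z in K0) (g z * (plateau a b n z.1 * plateau c d n z.2)).
  apply: (weak_plateau wk) => [z|[x y] Kz /=].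
    have [_ ->] := is_derive_tensor (e_x R) (is_derive_plateau ab n z.1) (is_derive_plateau cd n z.2).
    by rewrite /= mul1r mul0r addr0.
  have [xI|xI] := boolP (x \in `]a, b[).
    by rewrite [X in _ * X]bump_out ?mulr0// => yI; apply: Kz; split => //.
  by rewrite [X in X * _]bump_out ?mul0r//; exact/negP.
have L1 := cvg_rect_plateau' ab cd cf.
have L2 := cvg_rect_plateau ab cd gi0.
have L3 : \int[mu2]_(z in `]a, b[ `*` `]c, d[) (f z * (plateau' a b n z.1 * plateau c d n z.2))
    @[n --> \oo] --> - \int[mu2]_(z in `]a, b[ `*` `]c, d[) g z.
  by under eq_cvg do rewrite E; exact: cvgN.
have := cvg_unique (@Rhausdorff R) L1 L3 => EQ.
apply: oppr_inj; rewrite -EQ -mulN1r -RintegralZl//.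
  by apply: eq_Rintegral => y _; ring.
apply: integrableS (@continuous_integrable_itv R (fun y => f (b, y) - f (a, y)) c d _) => //.
  exact: subset_itv_oo_cc.
by move=> y; apply: cvgB; exact: continuous_xsection.
Qed.

Lemma weak_rect_y : weak_partial Om (e_y R) u g ->
  \int[mu]_(x in `]a, b[) (f (x, d) - f (x, c)) =
  \int[mu2]_(z in `]a, b[ `*` `]c, d[) g z.
Proof.
move=> wk.
have cfs : continuous (f \o swap_pair).
  move=> z; apply: continuous_comp; last exact: cf.
  by apply: (@continuous_pairing R _ snd fst); [exact: cvg_snd|exact: cvg_fst].
have E n : \int[mu2]_(z in `]c, d[ `*` `]a, b[)
      ((f \o swap_pair) z * (plateau' c d n z.1 * plateau a b n z.2)) =
    - \int[mu2]_(z in K0) (g z * (plateau a b n z.1 * plateau c d n z.2)).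
  have <- : \int[mu2]_(z in K0) (f z * (plateau a b n z.1 * plateau' c d n z.2)) =
    - \int[mu2]_(z in K0) (g z * (plateau a b n z.1 * plateau c d n z.2)).
    apply: (weak_plateau wk) => [z|[x y] Kz /=].
      have [_ ->] := is_derive_tensor (e_y R) (is_derive_plateau ab n z.1) (is_derive_plateau cd n z.2).
      by rewrite /= mul1r mul0r add0r.
    have [xI|xI] := boolP (x \in `]a, b[).
      by rewrite [X in _ * X]bump_out ?mulr0// => yI; apply: Kz; split => //.
    by rewrite [X in X * _]bump_out ?mul0r//; exact/negP.
  rewrite -[RHS]Rintegral_rect_swap; [|exact: measurable_itv|exact: measurable_itv|].
    by apply: eq_Rintegral => -[x y] _; rewrite /= /swap_pair /= (mulrC (plateau a b n y)).
  apply: integrableS (@continuous_integrable_rect R _ a b c d _).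
  - by apply: measurable_rect; exact: measurable_itv.
  - by apply: measurable_rect; exact: measurable_itv.
  - exact: K0K.
  move=> z; apply: cvgM; first exact: cf.
  by apply: continuous_prodM; [exact: continuous_plateau|exact: continuous_plateau'].
have L1 := cvg_rect_plateau' cd ab cfs.
have L2 := cvg_rect_plateau ab cd gi0.
have L3 : \int[mu2]_(z in `]c, d[ `*` `]a, b[)
     ((f \o swap_pair) z * (plateau' c d n z.1 * plateau a b n z.2))
    @[n --> \oo] --> - \int[mu2]_(z in `]a, b[ `*` `]c, d[) g z.
  by under eq_cvg do rewrite E; exact: cvgN.
have := cvg_unique (@Rhausdorff R) L1 L3 => EQ.
apply: oppr_inj; rewrite -EQ -mulN1r -RintegralZl//.
  by apply: eq_Rintegral => y _ /=; rewrite /swap_pair/=; ring.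
apply: integrableS (@continuous_integrable_itv R (fun x => f (x, d) - f (x, c)) a b _) => //.
  exact: subset_itv_oo_cc.
by move=> x; apply: cvgB; exact: continuous_ysection.
Qed.

End Rect.

(** Lebesgue differentiation: G is almost everywhere the derivative of an
    integral which is constant. *)
Lemma ae0_of_Rintegral (G : R -> R) c d :
  mu.-integrable `]c, d[ (EFin \o G) ->
  (forall y, c < y < d -> \int[mu]_(t in `]c, y[) G t = 0) ->
  {ae mu, forall y, c < y < d -> G y = 0}.
Proof.
move=> Gi G0; pose H := G \_ `]c, d[.
have Hi : mu.-integrable setT (EFin \o H).
  by rewrite -restrict_EFin; apply/integrable_restrict => //; rewrite setTI.
have HL : locally_integrable setT H by exact: integrable_locally.
have HiS (y : R) : mu.-integrable [set` Interval (BRight c) (BRight y)] (EFin \o H).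
  by apply: integrableS Hi.
apply: ae_impl (FTC1 HiS HL) => y HF /[dup] yI /andP[cy yd].
have /HF[_] : (BRight c < BRight y)%O by rewrite bnd_simp.
have -> : H y = G y by rewrite /H patchE mem_set//= in_itv/= yI.
move=> <-; rewrite derive1E.
have [_ ->//] : is_derive y 1 (fun x => \int[mu]_(t in [set` Interval (BRight c) (BRight x)]) H t) 0.
apply: near_eq_is_derive (is_derive_cst (0 : R) y 1).
near=> x.
have cx : c < x by near: x; exact: lt_nbhsr.
have xd : x < d by near: x; exact: lt_nbhsl.
have cxd : c < x < d by rewrite cx xd.
rewrite -(G0 _ cxd).
rewrite -Rintegral_itv_bndo_bndc; last first.
  by apply: integrableS Hi.
apply: eq_Rintegral => t; rewrite inE /= in_itv/= => /andP[ct tx].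
by rewrite /H patchE mem_set//= in_itv/= ct (lt_trans tx).
Unshelve. all: by end_near.
Qed.

End WeakToLines.

(** * Absolute continuity on lines and the divergence theorem *)

Section AbsolutelyContinuous.
Context {R : realType}.
Notation mu := (@lebesgue_measure R).
Notation mu2 := (lebesgue_measure \x lebesgue_measure)%E.
Implicit Types (a b x y : R) (F G f g : R -> R).

Lemma integrable_prodM f g (A B : set R) :
  measurable (A : set (measurableTypeR R)) -> measurable (B : set (measurableTypeR R)) ->
  mu.-integrable A (EFin \o f) -> mu.-integrable B (EFin \o g) ->
  mu2.-integrable (A `*` B) (fun z => (f z.1 * g z.2)%:E).
Proof.
move=> mA mB fi gi.
apply: (integrable_mkcond _ (measurable_rect mA mB)).2.
pose f' : R -> R := f \_ A; pose g' : R -> R := g \_ B.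
have f'i : mu.-integrable setT (EFin \o f').
  by rewrite -restrict_EFin; exact: ((integrable_mkcond _ mA).1 fi).
have g'i : mu.-integrable setT (EFin \o g').
  by rewrite -restrict_EFin; exact: ((integrable_mkcond _ mB).1 gi).
have -> : (fun z : R * R => (f z.1 * g z.2)%:E) \_ (A `*` B) =
    (fun z => (f' z.1 * g' z.2)%:E).
  apply/funext => -[x y]; rewrite /f' /g' !patchE /=.
  have -> : ((x, y) \in A `*` B) = (x \in A) && (y \in B).
    by apply/idP/andP; rewrite !inE.
  by case: (x \in A); case: (y \in B); rewrite /= ?mulr0 ?mul0r.
have mf' : measurable_fun setT (fun z : R * R => f' z.1).
  apply: measurableT_comp measurable_fst.
  by apply/measurable_EFinP; exact: measurable_int f'i.
have mg' : measurable_fun setT (fun z : R * R => g' z.2).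
  apply: measurableT_comp measurable_snd.
  by apply/measurable_EFinP; exact: measurable_int g'i.
have mh : measurable_fun setT (fun z : R * R => (f' z.1 * g' z.2)%:E).
  by apply/measurable_EFinP; exact: measurable_funM.
apply: (integrable12ltyP mu mu mh).2.
have mg1 : measurable_fun setT (fun y => `|g' y|%:E).
  apply/measurable_EFinP; apply: measurableT_comp => //.
  by apply/measurable_EFinP; exact: measurable_int g'i.
have mf1 : measurable_fun setT (fun y => `|f' y|%:E).
  apply/measurable_EFinP; apply: measurableT_comp => //.
  by apply/measurable_EFinP; exact: measurable_int f'i.
have E x : (\int[mu]_y `|(f' x * g' y)%:E| = `|f' x|%:E * \int[mu]_y `|g' y|%:E)%E.
  rewrite -ge0_integralZl//.
  by apply: eq_integral => y _; rewrite abse_EFin normrM EFinM.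
have [_ gfin] := integrableP _ _ _ g'i; have [_ ffin] := integrableP _ _ _ f'i.
suff L : (\int[mu]_x (`|f' x|%:E * \int[mu]_y `|g' y|%:E) < +oo)%E.
  apply: le_lt_trans L; rewrite le_eqVlt; apply/orP; left; apply/eqP.
  by apply: eq_integral => x _; exact: E.
have gfin' : (\int[mu]_y `|g' y|%:E)%E \is a fin_num.
  by rewrite ge0_fin_numE//; apply: integral_ge0 => y _; rewrite lee_fin.
rewrite -(fineK gfin') ge0_integralZr//; last first.
  by rewrite lee_fin fine_ge0//; apply: integral_ge0 => y _; rewrite lee_fin.
rewrite lte_mul_pinfty//.
- by apply: integral_ge0 => y _; rewrite lee_fin.
- by rewrite ge0_fin_numE//; apply: integral_ge0 => y _; rewrite lee_fin.
- by rewrite ltry.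
Qed.

(** F is the primitive on [a, b] of the integrable function f: absolute
    continuity with an explicit almost everywhere derivative. *)
Definition ac_on a b F f := mu.-integrable `[a, b] (EFin \o f) /\
  forall x, a <= x <= b -> F x = F a + \int[mu]_(t in `[a, x]) f t.

Lemma ac_on_cst a b k : ac_on a b (fun=> k) (fun=> 0).
Proof.
split; first by apply: continuous_integrable_itv => x; exact: cvg_cst.
by move=> x _; rewrite Rintegral_cst// mul0r addr0.
Qed.

Lemma ac_on_integrableS a b F f x : ac_on a b F f -> a <= x <= b ->
  mu.-integrable `[a, x] (EFin \o f).
Proof.
move=> [fi _] /andP[_ xb]; apply: integrableS fi => //.
by apply: subset_itvl; rewrite bnd_simp.
Qed.

Lemma ac_onD a b F G f g : ac_on a b F f -> ac_on a b G g ->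
  ac_on a b (fun x => F x + G x) (fun x => f x + g x).
Proof.
move=> Ff Gg; split.
  by apply: (@integrableD _ _ _ mu _ _ (EFin \o f) (EFin \o g)) => //; [case: Ff|case: Gg].
move=> x xI; rewrite RintegralD//; [|exact: ac_on_integrableS Ff xI|exact: ac_on_integrableS Gg xI].
by rewrite Ff.2// Gg.2//; ring.
Qed.

Lemma ac_on_id a b : ac_on a b id (fun=> 1).
Proof.
split; first by apply: continuous_integrable_itv => x; exact: cvg_cst.
move=> x /andP[ax xb].
rewrite (@Rintegral_FTC2 R _ id)//; first by rewrite /=; ring.
- by move=> t; exact: cvg_cst.
- by apply: continuous_subspaceT => t; exact: cvg_id.
Qed.

Let below : set (R * R) := [set z | z.2 <= z.1].

Let mbelow : measurable (below : set (measurableTypeR R * measurableTypeR R)).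
Proof.
rewrite -[below]setCK; apply: measurableC; apply: open_measurable_prod.
have -> : ~` below = [set z : R * R | 0 < z.2 - z.1].
  by apply/seteqP; split => z /=; rewrite /below /= subr_gt0 ltNge => /negP.
apply: (@open_comp _ _ (fun z : R * R => z.2 - z.1) [set x | 0 < x]).
  by move=> z _; apply: cvgB; [exact: cvg_snd|exact: cvg_fst].
exact: open_gt.
Qed.

Lemma ac_on_continuous_integrableM a b F f : mu.-integrable `[a, b] (EFin \o f) ->
  continuous F -> mu.-integrable `[a, b] (EFin \o (fun x => f x * F x)).
Proof.
move=> fi cF.
have [|M [Mr HM]] := @compact_bounded _ _ (F @` `[a, b]).
  by apply: continuous_compact; [exact: continuous_subspaceT|exact: segment_compact].
have := @integrableMl _ _ _ mu `[a, b]%classic (measurable_itv _) (EFin \o f) F fi; apply.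
- exact: measurable_funS (continuous_measurable_fun cF).
- exists M; split => // x Mx z zI; apply: HM Mx _ _; by exists z.
Qed.

(** Integration by parts for absolutely continuous functions: the square
    [a, x]^2 is cut along its diagonal, and Fubini is applied on each half. *)
Lemma ac_onM a b F G f g : continuous F -> continuous G ->
  ac_on a b F f -> ac_on a b G g ->
  ac_on a b (fun x => F x * G x) (fun x => f x * G x + g x * F x).
Proof.
move=> cF cG Ff Gg; have [fi FE] := Ff; have [gi GE] := Gg; split.
  apply: (@integrableD _ _ _ mu _ _ (EFin \o (fun x => f x * G x)) (EFin \o (fun x => g x * F x))) => //.
  - exact: ac_on_continuous_integrableM.
  - exact: ac_on_continuous_integrableM.
move=> x xI; have [ax xb] := andP xI.
have {}fi := ac_on_integrableS Ff xI; have {}gi := ac_on_integrableS Gg xI.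
set D := `[a, x]%classic.
have mD : measurable (D : set (measurableTypeR R)) by exact: measurable_itv.
pose h (z : R * R) := f z.1 * g z.2.
have hi : mu2.-integrable (D `*` D) (EFin \o h) by exact: integrable_prodM.
pose h1 (z : R * R) := h z * \1_below z.
pose h2 (z : R * R) := h z * \1_(~` below) z.
have hsub (S : set (R * R)) : measurable (S : set (measurableTypeR R * measurableTypeR R)) ->
    mu2.-integrable (D `*` D) (EFin \o (fun z => h z * \1_S z)).
  move=> mS; have := @integrableMl _ _ _ mu2 (D `*` D) (measurable_rect mD mD) (EFin \o h) (\1_S : R * R -> R) hi.
  apply.
  - by apply: measurable_indic.
  - exists 1; split => // M M1 z _; rewrite /= indicE; case: (z \in S) => /=.
      by rewrite normr1 ltW.
    by rewrite normr0 ltW// (lt_trans _ M1).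
have h1i : mu2.-integrable (D `*` D) (EFin \o h1) by exact: hsub.
have h2i : mu2.-integrable (D `*` D) (EFin \o h2).
  by apply: hsub; exact: measurableC.
have S12 : \int[mu2]_(z in D `*` D) h1 z + \int[mu2]_(z in D `*` D) h2 z =
    \int[mu2]_(z in D `*` D) h z.
  rewrite -RintegralD//; last exact: measurable_rect.
  apply: eq_Rintegral => z _; rewrite /h1 /h2 -mulrDr !indicE in_setC.
  by case: (z \in below); rewrite /= ?addr0 ?add0r mulr1.
have E0 : \int[mu2]_(z in D `*` D) h z = (F x - F a) * (G x - G a).
  rewrite -(Rintegral_xy mD mD hi) FE// GE//.
  rewrite (addrC (F a)) (addrC (G a)) !addrK.
  transitivity (\int[mu]_(s in D) (f s * \int[mu]_(t in D) g t)).
    by apply: eq_Rintegral => s _; rewrite /h /= RintegralZl.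
  by rewrite RintegralZr.
have E1 : \int[mu2]_(z in D `*` D) h1 z = \int[mu]_(s in D) (f s * (G s - G a)).
  rewrite -(Rintegral_xy mD mD h1i); apply: eq_Rintegral => s.
  rewrite inE /D /= in_itv/= => /andP[as_ sx].
  rewrite GE ?as_ ?(le_trans sx)// (addrC (G a)) addrK -RintegralZl//; last first.
    by apply: integrableS gi => //; apply: subset_itvl; rewrite bnd_simp.
  have -> : `[a, s]%classic = D `&` [set t | t <= s].
    apply/seteqP; split => t; rewrite /D /= !in_itv/=.
      by move=> /andP[-> ts]; rewrite (le_trans ts sx).
    by move=> [/andP[-> _] ->].
  rewrite Rintegral_mkcondr; apply: eq_Rintegral => t _.
  rewrite /h1 /h patchE indicE /=.
  have -> : ((s, t) \in below) = (t <= s) by apply/idP/idP; rewrite inE.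
  have -> : (t \in [set t | t <= s]) = (t <= s) by apply/idP/idP; rewrite inE.
  by case: (t <= s) => /=; rewrite ?mulr1 ?mulr0.
have E2 : \int[mu2]_(z in D `*` D) h2 z = \int[mu]_(t in D) (g t * (F t - F a)).
  rewrite -(Rintegral_yx mD mD h2i); apply: eq_Rintegral => t.
  rewrite inE /D /= in_itv/= => /andP[at_ tx].
  have fit : mu.-integrable `[a, t] (EFin \o f).
    by apply: integrableS fi => //; apply: subset_itvl; rewrite bnd_simp.
  have fit' : mu.-integrable `[a, t[ (EFin \o f).
    by apply: integrableS fit => //; apply: subset_itvl; rewrite bnd_simp.
  rewrite FE ?at_ ?(le_trans tx)// (addrC (F a)) addrK.
  rewrite -Rintegral_itv_bndo_bndc// -RintegralZl//.
  have -> : `[a, t[%classic = D `&` [set s | s < t].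
    apply/seteqP; split => s; rewrite /D /= !in_itv/=.
      by move=> /andP[-> st]; rewrite (le_trans (ltW st) tx).
    by move=> [/andP[-> _] ->].
  rewrite Rintegral_mkcondr; apply: eq_Rintegral => s _.
  rewrite /h2 /h patchE indicE /= in_setC.
  have -> : ((s, t) \in below) = (t <= s) by apply/idP/idP; rewrite inE.
  have -> : (s \in [set s | s < t]) = ~~ (t <= s) by rewrite -ltNge; apply/idP/idP; rewrite inE.
  by case: (t <= s) => /=; rewrite ?mulr1 ?mulr0// mulrC.
have fGi : mu.-integrable D (EFin \o (fun s => f s * G s)) by exact: ac_on_continuous_integrableM.
have gFi : mu.-integrable D (EFin \o (fun s => g s * F s)) by exact: ac_on_continuous_integrableM.
have C1 : \int[mu]_(s in D) (f s * (G s - G a)) =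
    \int[mu]_(s in D) (f s * G s) - (F x - F a) * G a.
  under eq_Rintegral do rewrite mulrBr.
  rewrite RintegralB//; last first.
    by apply: ac_on_continuous_integrableM => //; move=> s; exact: cvg_cst.
  by rewrite RintegralZr// (FE x)// (addrC (F a)) addrK.
have C2 : \int[mu]_(s in D) (g s * (F s - F a)) =
    \int[mu]_(s in D) (g s * F s) - (G x - G a) * F a.
  under eq_Rintegral do rewrite mulrBr.
  rewrite RintegralB//; last first.
    by apply: ac_on_continuous_integrableM => //; move=> s; exact: cvg_cst.
  by rewrite RintegralZr// (GE x)// (addrC (G a)) addrK.
rewrite RintegralD//.
by move: S12; rewrite E0 E1 E2 C1 C2 => H; lra.
Qed.

End AbsolutelyContinuous.

Section Lines.
Context {R : realType}.
Notation mu := (@lebesgue_measure R).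
Notation mu2 := (lebesgue_measure \x lebesgue_measure)%E.
Implicit Types (a b c d x y : R) (f g F G : R * R -> R).

Lemma within_continuous_near (T : topologicalType) (A : set T) (w : T -> R) (x : T) :
  {within A, continuous w} -> A x ->
  forall e, 0 < e -> \forall t \near x, A t -> `|w x - w t| < e.
Proof.
move=> cw Ax e e0.
have : w @ within A (nbhs x) --> w x by rewrite (nbhs_subspace_in Ax); exact: (cw x).
by move=> /cvgrPdist_lt /(_ e e0); rewrite near_withinE.
Qed.

Lemma ae_and (P Q : R -> Prop) : {ae mu, forall x, P x} -> {ae mu, forall x, Q x} ->
  {ae mu, forall x, P x /\ Q x}.
Proof.
move=> HP HQ; have [F1 F2 _] : Filter (almost_everywhere mu) by exact: (ae_filter_ringOfSetsType mu).
exact: F2.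
Qed.

Lemma ae_neq (k : R) : {ae mu, forall x, x <> k}.
Proof.
exists [set k]; split; first exact: measurable_set1.
  exact: lebesgue_measure_set1.
by move=> x /= /contrapT ->.
Qed.

Lemma eq_within_rat a b (w : R -> R) : a < b -> {within `[a, b], continuous w} ->
  (forall q : rat, a < ratr q < b -> w (ratr q) = 0) ->
  forall x, a <= x <= b -> w x = 0.
Proof.
move=> ab cw wq x /andP[ax xb]; apply: contrapT => /eqP wx0.
have xab : `[a, b]%classic x by rewrite /= in_itv/= ax xb.
have wx : 0 < `|w x| by rewrite normr_gt0.
have := within_continuous_near cw xab wx.
move=> /(@nbhs_ballP _ _ x _)[r /= r0 H].
have [q] := @rat_in_itvoo R (Num.max a (x - r)) (Num.min b (x + r))
  ltac:(rewrite gt_max !lt_min; lra).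
rewrite in_itv/= gt_max lt_min => /andP[/andP[aq rq] /andP[qb qr]].
have : `|w x - w (ratr q)| < `|w x|.
  apply: H; last by rewrite /= in_itv/= !ltW.
  by rewrite /ball/= ltr_norml; lra.
by rewrite wq ?aq// subr0 ltxx.
Qed.

(** The rectangle identity holds on every subrectangle, so it localizes to
    almost every horizontal line, first at rational abscissae and then, by
    continuity, along the whole line. *)
Lemma ae_lines f g a b c d : a < b -> c < d -> continuous f ->
  mu2.-integrable (`[a, b] `*` `[c, d]) (EFin \o g) ->
  (forall x y, a < x <= b -> c < y <= d ->
    \int[mu]_(t in `]c, y[) (f (x, t) - f (a, t)) =
    \int[mu2]_(z in `]a, x[ `*` `]c, y[) g z) ->
  {ae mu, forall y, c <= y <= d ->
    ac_on a b (fun x => f (x, y)) (fun x => g (x, y))}.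
Proof.
move=> ab cd cf gi rect.
have section_int := ae_integrable_ysection (measurable_itv _) (measurable_itv _) gi.
have at_rat (x : R) : a < x < b -> {ae mu, forall y, c < y < d ->
    f (x, y) - f (a, y) - \int[mu]_(s in `]a, x[) g (s, y) = 0}.
  move=> /andP[ax xb].
  have cfx : continuous (fun y => f (x, y) - f (a, y)).
    by move=> y; apply: cvgB; exact: continuous_xsection.
  have gS (y : R) : y <= d -> mu2.-integrable (`]a, x[ `*` `]c, y[) (EFin \o g).
    move=> yd; apply: integrableS gi.
    - by apply: measurable_rect; exact: measurable_itv.
    - by apply: measurable_rect; exact: measurable_itv.
    by move=> -[s t] [] /=; rewrite !in_itv/= => ? ?; split; lra.
  have gI (y : R) : y <= d ->
      mu.-integrable `]c, y[ (EFin \o (fun y => \int[mu]_(s in `]a, x[) g (s, y))).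
    by move=> yd; exact: (integrable_ysection_integral (measurable_itv _) (measurable_itv _) (gS y yd)).
  have fI (y : R) : mu.-integrable `]c, y[ (EFin \o (fun y => f (x, y) - f (a, y))).
    by apply: integrableS (@continuous_integrable_itv R _ c y cfx) => //; exact: subset_itv_oo_cc.
  apply: ae0_of_Rintegral.
    exact: (@integrableB _ _ _ mu _ (measurable_itv _) (EFin \o (fun y => f (x, y) - f (a, y)))
      (EFin \o (fun y => \int[mu]_(s in `]a, x[) g (s, y))) (fI d) (gI d (lexx d))).
  move=> y /andP[cy yd].
  rewrite RintegralB//; last by apply: gI; exact: ltW.
  rewrite rect ?ax ?cy ?ltW//.
  rewrite (Rintegral_yx (measurable_itv _) (measurable_itv _) (gS y (ltW yd))).
  by rewrite subrr.
have all_rat : {ae mu, forall y, forall q : rat, a < ratr q < b -> c < y < d ->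
    f (ratr q, y) - f (a, y) - \int[mu]_(s in `]a, ratr q[) g (s, y) = 0}.
  have H : {ae mu, forall y, forall n : nat, a < ratr (odflt 0 (unpickle n : option rat)) < b -> c < y < d ->
    f (ratr (odflt 0 (unpickle n : option rat)), y) - f (a, y) -
    \int[mu]_(s in `]a, ratr (odflt 0 (unpickle n : option rat))[) g (s, y) = 0}.
    apply/ae_foralln => n; set q := odflt _ _.
    have [qI|qI] := boolP (a < (ratr q : R) < b).
      by apply: ae_impl (at_rat _ qI).
    by apply: aeW => y.
  apply: ae_impl H => y Hy q; have := Hy (pickle q); rewrite pickleK /=; exact.
apply: ae_impl (ae_and (ae_and section_int all_rat) (ae_and (ae_neq c) (ae_neq d))).
move=> y [[yi yq] [yc yd]] ycd.
have cyd : c < y < d.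
  have /andP[cy yd'] := ycd.
  by rewrite !lt_neqAle cy yd' !andbT; apply/andP; split; apply/eqP => E;
    [apply: yc|apply: yd].
have {}yi : mu.-integrable `[a, b] (EFin \o (fun s => g (s, y))).
  by apply: yi; rewrite /= in_itv.
split => // x xI.
pose w x := f (x, y) - f (a, y) - \int[mu]_(s in `[a, x]) g (s, y).
suff : w x = 0 by rewrite /w => /eqP; rewrite subr_eq0 subr_eq addrC => /eqP.
apply: (@eq_within_rat a b w) xI => //.
  apply: within_continuousB.
    apply: continuous_subspaceT => t; apply: cvgB; last exact: cvg_cst.
    exact: continuous_ysection.
  exact: (parameterized_integral_continuous (ltW ab) yi).
move=> q qI; rewrite -(yq _ qI cyd) /w; congr (_ - _).
have /andP[aq qb] := qI.
have yiq : mu.-integrable `]a, (ratr q : R)] (EFin \o (fun s => g (s, y))).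
  apply: integrableS yi => //; move=> s /=; rewrite !in_itv/=; lra.
rewrite -Rintegral_itv_obnd_cbnd// Rintegral_itv_bndo_bndc//.
by apply: integrableS yiq => //; move=> s /=; rewrite !in_itv/=; lra.
Qed.

Lemma Rintegral_ae_eq (D : set R) (k l : R -> R) : measurable (D : set (measurableTypeR R)) ->
  mu.-integrable D (EFin \o k) -> mu.-integrable D (EFin \o l) ->
  {ae mu, forall x, D x -> k x = l x} ->
  \int[mu]_(x in D) k x = \int[mu]_(x in D) l x.
Proof.
move=> mD ki li kl; rewrite /Rintegral; congr fine; apply: ae_eq_integral => //.
- exact: measurable_int ki.
- exact: measurable_int li.
by apply: ae_impl kl => x H Dx /=; rewrite H.
Qed.

(** Integrated form of the divergence theorem for a field whose components
    are absolutely continuous along almost every relevant line. *)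
Lemma flux_balance F G Fx Gy a b c d : a < b -> c < d ->
  continuous F -> continuous G ->
  mu2.-integrable (`[a, b] `*` `[c, d]) (EFin \o Fx) ->
  mu2.-integrable (`[a, b] `*` `[c, d]) (EFin \o Gy) ->
  {ae mu, forall y, c <= y <= d -> ac_on a b (fun x => F (x, y)) (fun x => Fx (x, y))} ->
  {ae mu, forall x, a <= x <= b -> ac_on c d (fun y => G (x, y)) (fun y => Gy (x, y))} ->
  {ae mu2, forall z, (`[a, b] `*` `[c, d]) z -> Fx z + Gy z = 0} ->
  \int[mu]_(y in `[c, d]) (F (b, y) - F (a, y)) +
  \int[mu]_(x in `[a, b]) (G (x, d) - G (x, c)) = 0.
Proof.
move=> ab cd cF cG Fi Gi acF acG div0.
have mI (x y : R) : measurable (`[x, y]%classic : set (measurableTypeR R)) by exact: measurable_itv.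
have -> : \int[mu]_(y in `[c, d]) (F (b, y) - F (a, y)) =
    \int[mu2]_(z in `[a, b] `*` `[c, d]) Fx z.
  rewrite -(Rintegral_yx (mI a b) (mI c d) Fi); apply: Rintegral_ae_eq => //.
  - by apply: continuous_integrable_itv => y; apply: cvgB; exact: continuous_xsection.
  - exact: (integrable_ysection_integral (mI a b) (mI c d) Fi).
  apply: ae_impl acF => y H; rewrite /= in_itv/= => /H [_ ->]; first by rewrite (addrC (F _)) addrK.
  by rewrite ltW// lexx.
have -> : \int[mu]_(x in `[a, b]) (G (x, d) - G (x, c)) =
    \int[mu2]_(z in `[a, b] `*` `[c, d]) Gy z.
  rewrite -(Rintegral_xy (mI a b) (mI c d) Gi); apply: Rintegral_ae_eq => //.
  - by apply: continuous_integrable_itv => x; apply: cvgB; exact: continuous_ysection.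
  - exact: (integrable_xsection_integral (mI a b) (mI c d) Gi).
  apply: ae_impl acG => x H; rewrite /= in_itv/= => /H [_ ->]; first by rewrite (addrC (G _)) addrK.
  by rewrite ltW// lexx.
rewrite -RintegralD//; last exact: measurable_rect.
have mK : measurable (`[a, b]%classic `*` `[c, d]%classic : set (measurableTypeR R * measurableTypeR R)).
  by apply: measurable_rect.
have FGi : mu2.-integrable (`[a, b] `*` `[c, d]) (EFin \o (fun z => Fx z + Gy z)).
  exact: (@integrableD _ _ _ mu2 _ mK (EFin \o Fx) (EFin \o Gy) Fi Gi).
have -> : 0 = \int[mu2]_(z in `[a, b] `*` `[c, d]) (0 : R) by rewrite Rintegral_cst// mul0r.
rewrite /Rintegral; congr fine; apply: ae_eq_integral => //.
  exact: (measurable_int _ FGi).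
by apply: (@ae_impl _ _ _ mu2) div0 => z H Kz /=; rewrite H.
Qed.

(** On a set of finite measure L^r is contained in L^1, since |t| is at most
    1 + |t|^r. *)
Lemma Lfun_integrable_sub (D' K : set (R * R)) f r : 1 <= r ->
  measurable (K : set (measurableTypeR R * measurableTypeR R)) -> (mu2 K < +oo)%E ->
  K `<=` D' -> f \_ D' \in Lfun mu2 r%:E -> mu2.-integrable K (EFin \o f).
Proof.
move=> r1 mK Kfin KD fL.
apply: (@eq_integrable _ _ _ mu2 K mK (EFin \o (f \_ D'))).
  by move=> z; rewrite inE => /KD Dz; rewrite /= patchE mem_set.
have mf : measurable_fun setT (f \_ D') by have := sub_Lfun_mfun fL; rewrite inE.
apply: (@le_integrable _ _ _ mu2 K mK _ (EFin \o (fun z => 1 + `|(f \_ D') z| `^ r))).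
- by apply/measurable_EFinP; exact: measurable_funS mf.
- move=> z _; rewrite /= lee_fin [leRHS]ger0_norm; last by rewrite addr_ge0// powR_ge0.
  set t := `|_|; have t0 : 0 <= t by exact: normr_ge0.
  have [t1|t1] := leP t 1; first by rewrite (le_trans t1)// lerDl powR_ge0.
  rewrite -[leLHS]powRr1// (le_trans (_ : _ <= t `^ r))//; last by rewrite lerDr.
  by rewrite ler_powR// ltW.
apply: (@integrableD _ _ _ mu2 K mK (EFin \o cst 1) (EFin \o (fun z => `|(f \_ D') z| `^ r))).
  apply: (@measurable_bounded_integrable _ _ _ mu2 (cst 1) K mK Kfin) => //.
  exists 1; split => // x x1 z _ /=; rewrite normr1; exact: ltW.
exact: (integrableS measurableT mK _ (Lfun_integrable r1 fL)).
Qed.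

End Lines.

(** * Conservation laws of the weak Euler equations *)

Section EulerBalance.
Context {R : realType}.
Notation mu := (@lebesgue_measure R).
Notation mu2 := (lebesgue_measure \x lebesgue_measure)%E.
Implicit Types (a b x y : R) (f h F G : R * R -> R).

Lemma continuous_sqr h z : {for z, continuous h} ->
  {for z, continuous (fun t => h t ^+ 2)}.
Proof.
move=> ch; have -> : (fun t => h t ^+ 2) = (fun t => h t * h t).
  by apply/funext => t; rewrite expr2.
exact: cvgM.
Qed.

Definition balance F G a b c d : Prop :=
  \int[mu]_(y in `[c, d]) (F (b, y) - F (a, y)) +
  \int[mu]_(x in `[a, b]) (G (x, d) - G (x, c)) = 0.

Lemma ac_on_eq a b (F F' f f' : R -> R) : ac_on a b F f ->
  (forall x, F x = F' x) -> (forall x, f x = f' x) -> ac_on a b F' f'.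
Proof. by move=> H /funext <- /funext <-. Qed.

Lemma integrable_rectM f h a b c d : continuous h ->
  mu2.-integrable (`[a, b] `*` `[c, d]) (EFin \o f) ->
  mu2.-integrable (`[a, b] `*` `[c, d]) (EFin \o (fun z => f z * h z)).
Proof.
move=> ch fi; have [C C0 HC] := bounded_rect a b c d ch.
have mK : measurable (`[a, b]%classic `*` `[c, d]%classic : set (measurableTypeR R * measurableTypeR R)).
  by apply: measurable_rect; exact: measurable_itv.
apply: (@integrableMl _ _ _ mu2 _ mK (EFin \o f) h fi).
  exact: measurable_funS (continuous_measurable_fun2 ch).
exists C; split; first exact: num_real.
move=> x Cx [s t] [/=]; rewrite !in_itv/= => sI tI.
by rewrite (le_trans (HC _ _ sI tI))// ltW.
Qed.

Lemma integrable_rectD f h a b c d :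
  mu2.-integrable (`[a, b] `*` `[c, d]) (EFin \o f) ->
  mu2.-integrable (`[a, b] `*` `[c, d]) (EFin \o h) ->
  mu2.-integrable (`[a, b] `*` `[c, d]) (EFin \o (fun z => f z + h z)).
Proof.
have mK : measurable (`[a, b]%classic `*` `[c, d]%classic : set (measurableTypeR R * measurableTypeR R)).
  by apply: measurable_rect; exact: measurable_itv.
exact: (@integrableD _ _ _ mu2 _ mK (EFin \o f) (EFin \o h)).
Qed.

Section Lines.
Variables (D : set (R * R)) (a b c d : R) (w wh wx wy : R * R -> R).
Hypotheses (ab : a < b) (cd : c < d) (KD : `[a, b] `*` `[c, d] `<=` D).
Hypotheses (cwh : continuous wh) (whE : forall z, D z -> wh z = w z).

Let subK x y : a < x <= b -> c < y <= d -> `[a, x] `*` `[c, y] `<=` `[a, b] `*` `[c, d].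
Proof. by move=> xI yI [s t] [/=]; rewrite !in_itv/= => ? ?; split; lra. Qed.

Lemma weak_lines_x : weak_partial D (e_x R) w wx ->
  mu2.-integrable (`[a, b] `*` `[c, d]) (EFin \o wx) ->
  {ae mu, forall y, c <= y <= d ->
    ac_on a b (fun x => wh (x, y)) (fun x => wx (x, y))}.
Proof.
move=> wk wi; apply: ae_lines => // x y xI yI.
have [ax xb] := andP xI; have [cy yd] := andP yI.
apply: (weak_rect_x ax cy _ cwh whE _ wk).
  exact: subset_trans (subK xI yI) KD.
apply: integrableS wi; last exact: subK.
  by apply: measurable_rect; exact: measurable_itv.
by apply: measurable_rect; exact: measurable_itv.
Qed.

Lemma weak_lines_y : weak_partial D (e_y R) w wy ->
  mu2.-integrable (`[a, b] `*` `[c, d]) (EFin \o wy) ->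
  {ae mu, forall x, a <= x <= b ->
    ac_on c d (fun y => wh (x, y)) (fun y => wy (x, y))}.
Proof.
move=> wk wi.
apply: (@ae_lines _ (wh \o swap_pair) (wy \o swap_pair) c d a b cd ab).
- move=> z; apply: continuous_comp; last exact: cwh.
  by apply: (@continuous_pairing R _ snd fst); [exact: cvg_snd|exact: cvg_fst].
- exact: (integrable_rect_swap (measurable_itv _) (measurable_itv _) wi).
move=> y x yI xI.
have [ax xb] := andP xI; have [cy yd] := andP yI.
have wiS : mu2.-integrable (`[a, x] `*` `[c, y]) (EFin \o wy).
  apply: integrableS wi; last exact: subK.
    by apply: measurable_rect; exact: measurable_itv.
  by apply: measurable_rect; exact: measurable_itv.
rewrite [RHS](@Rintegral_rect_swap _ `]a, x[%classic `]c, y[%classic wy (measurable_itv _) (measurable_itv _)).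
  apply: (weak_rect_y ax cy _ cwh whE wiS wk).
  exact: subset_trans (subK xI yI) KD.
apply: integrableS wiS.
- by apply: measurable_rect; exact: measurable_itv.
- by apply: measurable_rect; exact: measurable_itv.
- by move=> [s t] [] /= ? ?; split; exact: subset_itv_oo_cc.
Qed.

End Lines.

Section Euler.
Variables (g c r : R) (D : set (R * R)) (u v P uh vh Ph : R * R -> R).
Hypotheses (r1 : 1 <= r).
Hypotheses (cu : continuous uh) (cv : continuous vh) (cP : continuous Ph).
Hypotheses (uE : forall z, D z -> uh z = u z) (vE : forall z, D z -> vh z = v z)
  (PE : forall z, D z -> Ph z = P z).

Definition bernoulli z : R :=
  ((uh z - c) ^+ 2 + vh z ^+ 2) / 2 + Ph z + g * z.2.

Lemma continuous_bernoulli : continuous bernoulli.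
Proof.
move=> z; apply: cvgD; last by apply: cvgM; [exact: cvg_cst|exact: cvg_snd].
apply: cvgD; last exact: cP.
apply: cvgM; last exact: cvg_cst.
apply: cvgD; apply: (@continuous_sqr _ z); last exact: cv.
by apply: cvgB; [exact: cu|exact: cvg_cst].
Qed.

(** Both balances come from the product rule on lines.  For the second, the two
    momentum equations multiplied by u - c and by v add up to
    (u - c) Q_x + v Q_y = 0 for the Bernoulli function Q, and the field
    (u - c, v) has no divergence. *)
Lemma euler_balance a b y0 y1 e : 0 < e -> a < b -> y0 < y1 ->
  `[a - e, b + e] `*` `[y0 - e, y1 + e] `<=` D ->
  steady_euler g c r D u v P ->
  balance (fun z => (uh z - c) * vh z) (fun z => vh z ^+ 2 + Ph z + g * z.2) a b y0 y1 /\
  balance (fun z => bernoulli z * (uh z - c)) (fun z => bernoulli z * vh z) a b y0 y1.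
Proof.
move=> e0 ab y01 KD [ux [uy [vx [vy [Px [Py]]]]]].
move=> [[wux wuy] [wvx wvy] [wPx wPy] [[Lux Luy Lvx Lvy] [LPx LPy]] eqs].
set K := `[a, b]%classic `*` `[y0, y1]%classic.
have mK : measurable (K : set (measurableTypeR R * measurableTypeR R)).
  by apply: measurable_rect; exact: measurable_itv.
pose D' := `]a - e, b + e[%classic `*` `]y0 - e, y1 + e[%classic.
have KD' : K `<=` D' by move=> [s t] [/=]; rewrite !in_itv/= => ? ?; split => /=; rewrite in_itv/=; lra.
have oD' : open D'.
  by apply: (@openI _ (fst @^-1` `]a - e, b + e[) (snd @^-1` `]y0 - e, y1 + e[));
    apply: open_comp; [move=> z _; exact: cvg_fst|exact: interval_open|
                       move=> z _; exact: cvg_snd|exact: interval_open].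
have clD' : closure D' `<=` `[a - e, b + e] `*` `[y0 - e, y1 + e].
  move=> [s t] cl; split => /=.
    suff : closure `]a - e, b + e[%classic s by move=> /itv_closure.
    move=> U Us; have [|[p q] [[/= pA _] [/= Up _]]] := cl (U `*` setT).
      by exists (U, setT) => //; split => //; exact: filterT.
    by exists p.
  suff : closure `]y0 - e, y1 + e[%classic t by move=> /itv_closure.
  move=> U Ut; have [|[p q] [[/= _ qB] [/= _ Uq]]] := cl (setT `*` U).
    by exists (setT, U) => //; split => //; exact: filterT.
  by exists q.
have cD' : compact (closure D').
  apply: (subclosed_compact _ _ clD'); first exact: closed_closure.
  by apply: compact_setX; exact: segment_compact.
have KD2 : K `<=` D by apply: subset_trans (KD' ) _; apply: subset_trans KD => z /subset_closure/clD'.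
have Kfin : (mu2 K < +oo)%E by exact: measure_rect_lty.
have LI w : in_Lr_loc r (closure D) w -> mu2.-integrable K (EFin \o w).
  move=> Lw; have := Lw D' oD' cD'.
  move=> H; apply: (Lfun_integrable_sub r1 mK Kfin KD').
  by apply: H; apply: subset_trans clD' _; apply: subset_trans KD _; exact: subset_closure.
have uxi := LI _ Lux; have uyi := LI _ Luy; have vxi := LI _ Lvx; have vyi := LI _ Lvy.
have Pxi := LI _ LPx; have Pyi := LI _ LPy.
have ulx := weak_lines_x ab y01 KD2 cu uE wux uxi.
have vlx := weak_lines_x ab y01 KD2 cv vE wvx vxi.
have Plx := weak_lines_x ab y01 KD2 cP PE wPx Pxi.
have uly := weak_lines_y ab y01 KD2 cu uE wuy uyi.
have vly := weak_lines_y ab y01 KD2 cv vE wvy vyi.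
have Ply := weak_lines_y ab y01 KD2 cP PE wPy Pyi.
have cA : continuous (fun z => uh z - c) by move=> z; apply: cvgB; [exact: cu|exact: cvg_cst].
have cy : continuous (fun z : R * R => g * z.2) by move=> z; apply: cvgM; [exact: cvg_cst|exact: cvg_snd].
have cQ := continuous_bernoulli.
have ci (k : R) : mu2.-integrable K (EFin \o (fun=> k)).
  by apply: continuous_integrable_rect => z; exact: cvg_cst.
have A_x y : ac_on a b (fun x => uh (x, y)) (fun x => ux (x, y)) ->
    ac_on a b (fun x => uh (x, y) - c) (fun x => ux (x, y)).
  move=> H; apply: ac_on_eq (ac_onD H (ac_on_cst a b (- c))) _ _ => //.
  by move=> x; rewrite addr0.
have A_y x : ac_on y0 y1 (fun y => uh (x, y)) (fun y => uy (x, y)) ->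
    ac_on y0 y1 (fun y => uh (x, y) - c) (fun y => uy (x, y)).
  move=> H; apply: ac_on_eq (ac_onD H (ac_on_cst y0 y1 (- c))) _ _ => //.
  by move=> y; rewrite addr0.
have gy_y : ac_on y0 y1 (fun y => g * y) (fun=> g).
  apply: ac_on_eq (ac_onM _ _ (ac_on_cst y0 y1 g) (ac_on_id y0 y1)) _ _ => //.
  - by move=> x; exact: cvg_cst.
  - by move=> x; exact: cvg_id.
  - by move=> x; rewrite mul0r add0r mul1r.
have ccst (k : R) : continuous (fun _ : R => k) by move=> x; exact: cvg_cst.
have cs k (l : R * R -> R) : continuous l -> continuous (fun x => l (x, k)).
  exact: continuous_ysection.
have cs' k (l : R * R -> R) : continuous l -> continuous (fun y => l (k, y)).
  exact: continuous_xsection.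
pose Qx z := ux z * (uh z - c) + vx z * vh z + Px z.
pose Qy z := uy z * (uh z - c) + vy z * vh z + Py z + g.
have Q_x y : ac_on a b (fun x => uh (x, y)) (fun x => ux (x, y)) ->
    ac_on a b (fun x => vh (x, y)) (fun x => vx (x, y)) ->
    ac_on a b (fun x => Ph (x, y)) (fun x => Px (x, y)) ->
    ac_on a b (fun x => bernoulli (x, y)) (fun x => Qx (x, y)).
  move=> /A_x Ha Hv HP.
  have H1 := ac_onD (ac_onM (cs y _ cA) (cs y _ cA) Ha Ha) (ac_onM (cs y _ cv) (cs y _ cv) Hv Hv).
  have cH1 : continuous (fun x => (uh (x, y) - c) * (uh (x, y) - c) + vh (x, y) * vh (x, y)).
    move=> x; apply: cvgD; apply: cvgM; try exact: (cs y _ cA); exact: (cs y _ cv).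
  have H2 := ac_onM cH1 (ccst _) H1 (ac_on_cst a b (2^-1)).
  have H3 := ac_onD (ac_onD H2 HP) (ac_on_cst a b (g * y)).
  by apply: ac_on_eq H3 _ _ => x; rewrite /bernoulli /Qx /=; lra.
have Q_y x : ac_on y0 y1 (fun y => uh (x, y)) (fun y => uy (x, y)) ->
    ac_on y0 y1 (fun y => vh (x, y)) (fun y => vy (x, y)) ->
    ac_on y0 y1 (fun y => Ph (x, y)) (fun y => Py (x, y)) ->
    ac_on y0 y1 (fun y => bernoulli (x, y)) (fun y => Qy (x, y)).
  move=> /A_y Ha Hv HP.
  have H1 := ac_onD (ac_onM (cs' x _ cA) (cs' x _ cA) Ha Ha) (ac_onM (cs' x _ cv) (cs' x _ cv) Hv Hv).
  have cH1 : continuous (fun y => (uh (x, y) - c) * (uh (x, y) - c) + vh (x, y) * vh (x, y)).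
    move=> y; apply: cvgD; apply: cvgM; try exact: (cs' x _ cA); exact: (cs' x _ cv).
  have H2 := ac_onM cH1 (ccst _) H1 (ac_on_cst y0 y1 (2^-1)).
  have H3 := ac_onD (ac_onD H2 HP) gy_y.
  by apply: ac_on_eq H3 _ _ => y; rewrite /bernoulli /Qy /=; lra.
split.
- apply: (flux_balance (Fx := fun z => ux z * vh z + vx z * (uh z - c))
      (Gy := fun z => vy z * vh z + vy z * vh z + Py z + g)) => //.
  + by move=> z; apply: cvgM; [exact: cA|exact: cv].
  + move=> z; apply: cvgD; last exact: cy.
    by apply: cvgD; [apply: (@continuous_sqr _ z); exact: cv|exact: cP].
  + by apply: integrable_rectD; exact: integrable_rectM.
  + apply: integrable_rectD; last exact: ci.
    by apply: integrable_rectD => //; apply: integrable_rectD; exact: integrable_rectM.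
  + apply: ae_impl (ae_and ulx vlx) => y [Hu Hv] yI.
    exact: (ac_onM (cs y _ cA) (cs y _ cv) (A_x _ (Hu yI)) (Hv yI)).
  + apply: ae_impl (ae_and vly Ply) => x [Hv HP] xI.
    have H1 := ac_onD (ac_onD (ac_onM (cs' x _ cv) (cs' x _ cv) (Hv xI) (Hv xI)) (HP xI)) gy_y.
    by apply: ac_on_eq H1 _ _ => y //; rewrite expr2.
  + apply: (@ae_impl _ _ _ mu2) eqs => z Hz /KD2 Dz.
    have [_ E2 E3] := Hz Dz; rewrite !uE// !vE//.
    by move: E2 E3 => /eqP; rewrite -subr_eq0 => /eqP E2 E3; nra.
- apply: (flux_balance (Fx := fun z => Qx z * (uh z - c) + ux z * bernoulli z)
      (Gy := fun z => Qy z * vh z + vy z * bernoulli z)) => //.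
  + by move=> z; apply: cvgM; [exact: cQ|exact: cA].
  + by move=> z; apply: cvgM; [exact: cQ|exact: cv].
  + apply: integrable_rectD; apply: integrable_rectM => //.
    by apply: integrable_rectD => //; apply: integrable_rectD; exact: integrable_rectM.
  + apply: integrable_rectD; apply: integrable_rectM => //.
    apply: integrable_rectD; last exact: ci.
    by apply: integrable_rectD => //; apply: integrable_rectD; exact: integrable_rectM.
  + apply: ae_impl (ae_and (ae_and ulx vlx) Plx) => y [[Hu Hv] HP] yI.
    exact: (ac_onM (cs y _ cQ) (cs y _ cA) (Q_x _ (Hu yI) (Hv yI) (HP yI)) (A_x _ (Hu yI))).
  + apply: ae_impl (ae_and (ae_and uly vly) Ply) => x [[Hu Hv] HP] xI.
    exact: (ac_onM (cs' x _ cQ) (cs' x _ cv) (Q_y _ (Hu xI) (Hv xI) (HP xI)) (Hv xI)).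
  + apply: (@ae_impl _ _ _ mu2) eqs => z Hz /KD2 Dz.
    have [E1 E2 E3] := Hz Dz; rewrite /Qx /Qy !uE// !vE//.
    have -> : Px z = - ((u z - c) * ux z + v z * uy z) by rewrite E1 opprK.
    have -> : Py z = - ((u z - c) * vx z + v z * vy z) - g by rewrite E2; ring.
    have -> : ux z = - vy z by apply/eqP; rewrite -addr_eq0 E3.
    by ring.
Qed.

End Euler.
End EulerBalance.

(** * Streamlines *)

Section Pin.
Context {R : realType}.
Implicit Types a b t : R.

Definition pin a b t : R := Num.max a (Num.min t b).

Lemma pin_itv a b t : a <= b -> a <= pin a b t <= b.
Proof. by move=> ab; rewrite le_max lexx /= ge_max ge_min lexx orbT andbT. Qed.

Lemma pin_id a b t : a <= t <= b -> pin a b t = t.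
Proof. by move=> /andP[a_t tb]; rewrite /pin min_l// max_r. Qed.

Lemma continuous_pin a b : continuous (pin a b).
Proof.
move=> t; apply: (@continuous_max R R (fun=> a) (fun s => Num.min s b) t).
  exact: cvg_cst.
by apply: (@continuous_min R _ id (fun=> b)); [exact: cvg_id|exact: cvg_cst].
Qed.

End Pin.

Section Extension.
Context {R : realType}.
Variables (d : R) (eta : R -> R).
Hypotheses (ceta : continuous eta) (depth : forall x, - d < eta x).
Implicit Types (f : R * R -> R) (z : R * R).

Definition clamp z : R := pin (- d) (eta z.1) z.2.

Lemma clamp_itv z : - d <= clamp z <= eta z.1.
Proof. by apply: pin_itv; exact: ltW. Qed.

Lemma clamp_id x y : - d <= y <= eta x -> clamp (x, y) = y.
Proof. exact: pin_id. Qed.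

Lemma continuous_clamp : continuous clamp.
Proof.
move=> z.
have c1 : {for z, continuous (fun z : R * R => Num.min z.2 (eta z.1))}.
  apply: (@continuous_min R _ snd (fun z : R * R => eta z.1)); first exact: cvg_snd.
  by apply: continuous_comp; [exact: cvg_fst|exact: ceta].
exact: (@continuous_max R _ (fun=> - d) _ z (cvg_cst _) c1).
Qed.

Lemma closure_fluid x y : - d <= y <= eta x -> closure (fluid d eta) (x, y).
Proof.
move=> /andP[dy ye] U /near_boxP[r r0 HU].
pose m := (eta x - d) / 2.
have m1 : - d < m by rewrite /m ltr_pdivlMr//; have := depth x; lra.
have m2 : m < eta x by rewrite /m ltr_pdivrMr//; have := depth x; lra.
pose t := Num.min 1 (r / (2 * (`|m - y| + 1))).
have den : 0 < 2 * (`|m - y| + 1) by have := normr_ge0 (m - y); lra.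
have t0 : 0 < t by rewrite lt_min ltr01 divr_gt0.
have t1 : t <= 1 by rewrite ge_min lexx.
have tr : t * `|m - y| < r.
  have : t <= r / (2 * (`|m - y| + 1)) by rewrite ge_min lexx orbT.
  rewrite ler_pdivlMr// => H; have := normr_ge0 (m - y); nra.
exists (x, y + t * (m - y)); split.
  by rewrite /fluid /=; apply/andP; split; nra.
apply: HU; first by rewrite subrr normr0.
by rewrite addrAC subrr add0r normrM (gtr0_norm t0).
Qed.

(** Freezing the value at the surface and at the bed outside the fluid turns a
    function continuous on the closed fluid domain into one continuous on the
    plane. *)
Definition extend f z : R := f (z.1, clamp z).

Lemma extend_id f x y : - d <= y <= eta x -> extend f (x, y) = f (x, y).
Proof. by move=> xy; rewrite /extend clamp_id. Qed.

Lemma extend_fluid f z : fluid d eta z -> extend f z = f z.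
Proof. by case: z => x y /andP[/= a b]; rewrite extend_id// !ltW. Qed.

Lemma continuous_extend f : {within closure (fluid d eta), continuous f} ->
  continuous (extend f).
Proof.
move=> cf z; apply/cvgrPdist_lt => e e0.
have cz : closure (fluid d eta) (z.1, clamp z) by exact/closure_fluid/clamp_itv.
have H := within_continuous_near cf cz e0.
have cp : {for z, continuous (fun t => (t.1, clamp t))}.
  by apply: (@continuous_pairing R _ fst clamp); [exact: cvg_fst|exact: continuous_clamp].
have {}H : \forall t \near z, closure (fluid d eta) (t.1, clamp t) ->
    `|f (z.1, clamp z) - f (t.1, clamp t)| < e by exact: (cp _ H).
apply: filterS H => t; apply.
exact/closure_fluid/clamp_itv.
Qed.

Lemma near_fluid z : fluid d eta z -> \forall t \near z, fluid d eta t.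
Proof.
case: z => x y /andP[/= dy ye].
have e0 : 0 < (eta x - y) / 2 by rewrite divr_gt0// subr_gt0.
have /cvgrPdist_lt/(_ _ e0) := @ceta x => /(@nbhs_ballP _ _ x _)[r1 /= r10 H1].
apply/near_boxP; exists (Num.min r1 (Num.min ((eta x - y) / 2) (y + d))).
  by rewrite !lt_min r10 e0 /=; lra.
move=> s t; rewrite !lt_min => /and3P[s1 _ _] /and3P[_ t2 t3].
have := H1 s; rewrite /ball /= distrC => /(_ s1) etas.
rewrite /fluid /=; move: etas t2 t3; rewrite !ltr_norml; lra.
Qed.

End Extension.

(** What is needed of the flow, with all fields extended to the plane: psi is a
    C^1 stream function of a flow without stagnation, and h the height of its
    level lines. *)
Record stream_setting {R : realType} (d c dl : R) (eta : R -> R)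
    (psi uh vh h : R * R -> R) : Prop := {
  st_eta : continuous eta;
  st_depth : forall x, - d < eta x;
  st_psi : continuous psi;
  st_u : continuous uh;
  st_v : continuous vh;
  st_dl : 0 < dl;
  st_speed : forall z, dl <= c - uh z;
  st_psi_y : forall z, fluid d eta z -> is_derive z (e_y R) psi (uh z - c);
  st_psi_x : forall z, fluid d eta z -> is_derive z (e_x R) psi (- vh z);
  st_top : forall x, psi (x, eta x) = 0;
  st_bed : forall x, vh (x, - d) = 0;
  st_height : forall x y, - d <= y <= eta x -> h (x, - psi (x, y)) = y + d
}.

Section Streamlines.
Context {R : realType}.
Notation mu := (@lebesgue_measure R).
Variables (d c dl : R) (eta : R -> R) (psi uh vh h : R * R -> R).
Hypothesis S : stream_setting d c dl eta psi uh vh h.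
Let ceta : continuous eta := st_eta S.
Let depth : forall x, - d < eta x := st_depth S.
Let cpsi : continuous psi := st_psi S.
Let cu : continuous uh := st_u S.
Let cv : continuous vh := st_v S.
Let dl0 : 0 < dl := st_dl S.
Let uc : forall z, dl <= c - uh z := st_speed S.
Let psi_y : forall z, fluid d eta z -> is_derive z (e_y R) psi (uh z - c) := st_psi_y S.
Let psi_x : forall z, fluid d eta z -> is_derive z (e_x R) psi (- vh z) := st_psi_x S.
Let psi_top : forall x, psi (x, eta x) = 0 := st_top S.
Let v_bot : forall x, vh (x, - d) = 0 := st_bed S.
Let hE : forall x y, - d <= y <= eta x -> h (x, - psi (x, y)) = y + d := st_height S.
Implicit Types (q s x y : R).

Lemma psi_FTC q y1 y2 : - d <= y1 -> y1 <= y2 -> y2 <= eta q ->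
  \int[mu]_(t in `[y1, y2]) (c - uh (q, t)) = psi (q, y1) - psi (q, y2).
Proof.
move=> dy1 y12 y2e.
have -> : psi (q, y1) - psi (q, y2) = - psi (q, y2) - - psi (q, y1) by ring.
apply: (@Rintegral_FTC2 R _ (fun t => - psi (q, t))) => //.
- by move=> t; apply: cvgB; [exact: cvg_cst|exact: continuous_xsection].
- by apply: continuous_subspaceT => t; apply: cvgN; exact: continuous_xsection.
move=> t tI; rewrite -[c - _]opprB; apply: is_deriveN.
by apply/(is_derive_eyE psi (q, t)); apply: psi_y; rewrite /fluid /=; lra.
Qed.

Lemma continuous_speed q : continuous (fun t => c - uh (q, t)).
Proof. by move=> t; apply: cvgB; [exact: cvg_cst|exact: continuous_xsection]. Qed.

Lemma psi_decr q y1 y2 : - d <= y1 -> y1 <= y2 -> y2 <= eta q ->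
  dl * (y2 - y1) <= psi (q, y1) - psi (q, y2).
Proof.
move=> dy1 y12 y2e; rewrite -psi_FTC//.
have -> : dl * (y2 - y1) = \int[mu]_(t in `[y1, y2]) (cst dl) t.
  by rewrite Rintegral_itv_cst.
apply: le_Rintegral => //.
- by apply: continuous_integrable_itv => t; exact: cvg_cst.
- by apply: continuous_integrable_itv; exact: continuous_speed.
Qed.

Lemma psi_dist q y1 y2 : - d <= y1 <= eta q -> - d <= y2 <= eta q ->
  dl * `|y1 - y2| <= `|psi (q, y1) - psi (q, y2)|.
Proof.
move=> /andP[a1 b1] /andP[a2 b2]; have [y12|y21] := leP y1 y2.
  rewrite ler0_norm ?subr_le0// opprB; apply: le_trans (ler_norm _).
  exact: psi_decr.
rewrite distrC [X in _ <= X]distrC ler0_norm; last by rewrite subr_le0 ltW.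
rewrite opprB.
by apply: le_trans (ler_norm _); apply: psi_decr => //; exact: ltW.
Qed.

(** psi is differentiable only inside the fluid.  Slightly above the bed its
    horizontal derivative - v is small, because v vanishes on the bed and is
    continuous; letting the height tend to zero, x |-> psi (x, -d) has zero
    derivative. *)
Lemma psi_bottom_cst q q' : psi (q, - d) = psi (q', - d).
Proof.
apply: (@is_derive_0_is_cst R (fun x => psi (x, - d))) => {q'} {}q.
apply/is_derive_epsP => e e0.
pose rho := (eta q + d) / 2.
have rho0 : 0 < rho by rewrite /rho divr_gt0//; have := depth q; lra.
have /cvgrPdist_lt/(_ _ rho0) := @ceta q => /(@nbhs_ballP _ _ q _)[r1 /= r10 H1].
have : \forall z \near (q, - d), `|vh (q, - d) - vh z| <= e.
  by move/cvgrPdist_le : (@cv (q, - d)); apply.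
move=> /near_boxP[r2 r20 H2].
near=> x; rewrite mul0r subr0.
have xr1 : `|x - q| < r1.
  by near: x; apply/(@nbhs_ballP _ _ q _); exists r1 => // t; rewrite /ball /= distrC.
have xr2 : `|x - q| < r2.
  by near: x; apply/(@nbhs_ballP _ _ q _); exists r2 => // t; rewrite /ball /= distrC.
rewrite leNgt; apply/negP => contra.
have cA : continuous (fun y => psi (x, y) - psi (q, y)).
  by move=> y; apply: cvgB; exact: continuous_xsection.
have gap : 0 < `|psi (x, - d) - psi (q, - d)| - e * `|x - q| by rewrite subr_gt0.
have /cvgrPdist_lt/(_ _ gap) := cA (- d) => /(@nbhs_ballP _ _ (- d) _)[r3 /= r30 H3].
pose t := Num.min r2 (Num.min r3 rho) / 2.
have t0 : 0 < t by rewrite divr_gt0// !lt_min r20 r30 rho0.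
have tm : t < Num.min r2 (Num.min r3 rho) by rewrite /t; move: t0; rewrite /t; lra.
have [tr2 tr3 trho] : [/\ t < r2, t < r3 & t < rho] by move: tm; rewrite !lt_min => /and3P[].
have inside s : `|s - q| <= `|x - q| -> fluid d eta (s, - d + t).
  move=> sx; have := H1 s; rewrite /ball /= distrC => /(_ (le_lt_trans sx xr1)).
  by rewrite /fluid /= ltr_norml; move: trho; rewrite /rho; lra.
have [s sx E] := @MVT_near R (fun s => psi (s, - d + t)) (fun s => - vh (s, - d + t)) q x
  (fun s sx => (is_derive_exE psi (s, - d + t) _).1 (psi_x (inside s sx))).
have : `|psi (x, - d + t) - psi (q, - d + t)| <= e * `|x - q|.
  rewrite E normrM normrN; apply: ler_wpM2r => //.
  have := H2 s (- d + t) (le_lt_trans sx xr2).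
  rewrite v_bot sub0r normrN; apply.
  by have -> : - d + t - - d = t by [ring]; rewrite gtr0_norm.
have := H3 (- d + t); rewrite /ball /= opprD addrA subrr sub0r normrN gtr0_norm// => /(_ tr3).
move=> L1 L2; have := ler_normB (psi (x, - d) - psi (q, - d)) (psi (x, - d + t) - psi (q, - d + t)).
have := ler_dist_dist (psi (x, - d) - psi (q, - d)) (psi (x, - d + t) - psi (q, - d + t)).
by rewrite ler_norml; lra.
Unshelve. all: by end_near.
Qed.

Definition bed_flux : R := psi (0, - d).
Notation m := bed_flux.

Lemma psi_bottom q : psi (q, - d) = m. Proof. exact: psi_bottom_cst. Qed.

Lemma bed_flux_gt0 : 0 < m.
Proof.
have := @psi_decr 0 (- d) (eta 0) (lexx _) (ltW (depth 0)) (lexx _).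
rewrite psi_top subr0; apply: lt_le_trans.
by apply: mulr_gt0 => //; have := depth 0; lra.
Qed.

(** Ordinate of the streamline -psi = s above the abscissa q; the label s is
    confined to its range so that the function is continuous on the plane. *)
Definition streamY (z : R * R) : R :=
  h (z.1, pin (- m) 0 z.2) - d.

Lemma streamYP q s : - m <= s <= 0 ->
  [/\ - d <= streamY (q, s), streamY (q, s) <= eta q & psi (q, streamY (q, s)) = - s].
Proof.
move=> /andP[ms s0].
have [||y] := @IVT R (fun y => psi (q, y)) (- d) (eta q) (- s) (ltW (depth q)).
- by apply: continuous_subspaceT; exact: continuous_xsection.
- rewrite psi_bottom psi_top ge_min le_max; have := bed_flux_gt0 => m0.
  by apply/andP; split; apply/orP; [right|left]; lra.
rewrite in_itv/= => yI E.
have -> : streamY (q, s) = y.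
  rewrite /streamY /= pin_id ?ms//.
  have -> : s = - psi (q, y) by rewrite E opprK.
  by rewrite hE// addrK.
by have /andP[] := yI.
Qed.

Lemma streamY_psi q y : - d <= y <= eta q -> streamY (q, - psi (q, y)) = y.
Proof.
move=> /andP[dy ye].
have p0 : 0 <= psi (q, y).
  have := @psi_decr q y (eta q) dy ye (lexx _); rewrite psi_top subr0.
  by apply: le_trans; apply: mulr_ge0; [exact: ltW|lra].
have pm : psi (q, y) <= m.
  have := @psi_decr q (- d) y (lexx _) dy ye; rewrite psi_bottom.
  by have : 0 <= dl * (y - - d) by [apply: mulr_ge0; [exact: ltW|lra]]; lra.
by rewrite /streamY /= pin_id ?hE ?dy ?addrK// lerN2 pm oppr_le0.
Qed.

Lemma streamY_top q : streamY (q, 0) = eta q.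
Proof. by rewrite -{1}[0]oppr0 -(psi_top q) streamY_psi// lexx ltW. Qed.

Lemma streamY_bot q : streamY (q, - m) = - d.
Proof. by rewrite -(psi_bottom q) streamY_psi// lexx ltW. Qed.

Lemma streamY_fluid q s : - m < s < 0 -> fluid d eta (q, streamY (q, s)).
Proof.
move=> /andP[ms s0]; have [|a b E] := @streamYP q s; first by rewrite !ltW.
rewrite /fluid /= !lt_neqAle a b !andbT; apply/andP; split; apply/eqP => F.
  by move: E; rewrite -F psi_bottom; lra.
by move: E; rewrite F psi_top; lra.
Qed.

Lemma streamY_le q s1 s2 : - m <= s1 -> s1 <= s2 -> s2 <= 0 ->
  streamY (q, s1) <= streamY (q, s2).
Proof.
move=> ms1 s12 s20.
have [|a1 b1 E1] := @streamYP q s1; first by rewrite ms1 (le_trans s12).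
have [|a2 b2 E2] := @streamYP q s2; first by rewrite (le_trans ms1).
rewrite leNgt; apply/negP => lt.
have := psi_decr a2 (ltW lt) b1; rewrite E1 E2.
have : 0 < dl * (streamY (q, s1) - streamY (q, s2)) by apply: mulr_gt0 => //; lra.
by lra.
Qed.

Lemma continuous_streamY : continuous streamY.
Proof.
move=> [q0 s0].
pose cs := pin (- m) 0.
have csI s : - m <= cs s <= 0 by apply: pin_itv; rewrite oppr_le0 ltW// bed_flux_gt0.
have ccs : continuous cs by exact: continuous_pin.
have clamped q s : streamY (q, s) = streamY (q, cs s) by rewrite /streamY /= (pin_id (csI s)).
(* The level y0, moved into the fluid above q, misses the streamline s by at
   most its error in psi divided by the minimal speed dl. *)
set y0 := streamY (q0, s0).
have [a0 b0 E0] := @streamYP q0 (cs s0) (csI s0); rewrite -clamped -/y0 in a0 b0 E0.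
pose k (z : R * R) := `|y0 - clamp d eta (z.1, y0)| +
  dl^-1 * `|psi (z.1, clamp d eta (z.1, y0)) + cs z.2|.
have ck : {for (q0, s0), continuous k}.
  have c1 : {for (q0, s0), continuous (fun z : R * R => clamp d eta (z.1, y0))}.
    apply: (@continuous_comp _ _ _ (fun z : R * R => (z.1, y0)) (clamp d eta)); last exact: continuous_clamp.
    by apply: (@continuous_pairing R _ fst (fun=> y0)); [exact: cvg_fst|exact: cvg_cst].
  apply: cvgD.
    apply: cvg_norm.
    by apply: cvgB; [exact: cvg_cst|exact: c1].
  apply: cvgM; first exact: cvg_cst.
  apply: cvg_norm.
  apply: cvgD; last by apply: continuous_comp; [exact: cvg_snd|exact: ccs].
  apply: (@continuous_comp _ _ _ (fun z : R * R => (z.1, clamp d eta (z.1, y0))) psi); last exact: cpsi.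
  by apply: (@continuous_pairing R _ fst); [exact: cvg_fst|exact: c1].
have k0 : k (q0, s0) = 0.
  by rewrite /k /= clamp_id ?a0// subrr normr0 E0 addNr normr0 mulr0 addr0.
have bound z : `|y0 - streamY z| <= k z.
  case: z => q s; rewrite clamped /k /=.
  have [a b E] := @streamYP q (cs s) (csI s).
  apply: (le_trans (ler_distD (clamp d eta (q, y0)) _ _)); apply: lerD => //.
  rewrite mulrC ler_pdivlMr// mulrC.
  have := @psi_dist q (clamp d eta (q, y0)) (streamY (q, cs s)).
  rewrite E opprK; apply; last by rewrite a.
  exact: (@clamp_itv _ _ _ depth (q, y0)).
apply/cvgrPdist_lt => e e0.
have /cvgrPdist_lt/(_ _ e0) := ck; rewrite k0.
apply: filterS => z; rewrite sub0r normrN => ke.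
by apply: (le_lt_trans (bound z)); apply: le_lt_trans ke; exact: ler_norm.
Qed.

Lemma is_derive_streamY_q q s : - m < s < 0 ->
  is_derive q 1 (fun q => streamY (q, s))
    (vh (q, streamY (q, s)) / (uh (q, streamY (q, s)) - c)).
Proof.
move=> sI; have fl := @streamY_fluid q s sI.
have nf := near_fluid ceta fl.
rewrite -[vh _]opprK.
apply: (@is_derive_implicit R psi (fun z => - vh z) (fun z => uh z - c) (fun q => streamY (q, s)) q).
- by near=> z; apply: psi_x; near: z.
- by near=> z; apply: psi_y; near: z.
- by apply: cvgN; exact: cv.
- by apply: cvgB; [exact: cu|exact: cvg_cst].
- exact: (@continuous_ysection R streamY s continuous_streamY).
- by rewrite -oppr_eq0 opprB gt_eqF// (lt_le_trans dl0).
- have ss : - m <= s <= 0 by have /andP[a b] := sI; rewrite !ltW.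
  by near=> t; have [_ _ ->] := @streamYP t s ss; have [_ _ ->] := @streamYP q s ss.
Unshelve. all: by end_near.
Qed.

Lemma is_derive_streamY_s q s : - m < s < 0 ->
  is_derive s 1 (fun s => streamY (q, s)) (c - uh (q, streamY (q, s)))^-1.
Proof.
move=> sI; have fl := @streamY_fluid q s sI.
have nf := near_fluid ceta fl.
have /near_boxP[r r0 Hr] := nf.
rewrite -opprB invrN -mulN1r.
apply: (@is_derive_implicit R (fun z => psi (q, z.2) + z.1) (fun=> 1) (fun z => uh (q, z.2) - c)
   (fun s => streamY (q, s)) s).
- near=> z; apply/is_derive_exE => /=.
  have := is_deriveD (is_derive_cst (psi (q, z.2)) z.1 (1 : R)) (is_derive_id z.1 (1 : R)).
  by rewrite add0r.
- apply/near_boxP; exists r => // x y _ yr; apply/is_derive_eyE => /=.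
  have fl' : fluid d eta (q, y) by apply: Hr => //; rewrite subrr normr0.
  have := is_deriveD ((is_derive_eyE psi (q, y) _).1 (psi_y fl')) (is_derive_cst x y (1 : R)).
  by rewrite addr0.
- exact: cvg_cst.
- apply: cvgB; last exact: cvg_cst.
  apply: (@continuous_comp _ _ _ (fun z : R * R => (q, z.2)) uh); last exact: cu.
  by apply: (@continuous_pairing R _ (fun=> q) snd); [exact: cvg_cst|exact: cvg_snd].
- exact: (@continuous_xsection R streamY q continuous_streamY).
- by rewrite -oppr_eq0 opprB gt_eqF// (lt_le_trans dl0).
- have /andP[ms s0] := sI.
  near=> t => /=.
  have [|_ _ ->] := @streamYP q t.
    by apply/andP; split; apply: ltW; near: t; [exact: lt_nbhsr|exact: lt_nbhsl].
  have [|_ _ ->] := @streamYP q s; first by rewrite !ltW.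
  by rewrite !addNr.
Unshelve. all: by end_near.
Qed.

End Streamlines.

(** * Conservation laws along streamlines *)

Section FluxThroughSections.
Context {R : realType}.
Notation mu := (@lebesgue_measure R).
Implicit Types (F G K : R * R -> R) (a b q s x y : R).

Lemma continuous_Rintegral_param K a b : continuous K -> a <= b ->
  continuous (fun s => \int[mu]_(x in `[a, b]) K (x, s)).
Proof.
move=> cK ab s; apply/cvgrPdist_le => e e0.
pose e1 := e / (b - a + 1).
have den : 0 < b - a + 1 by lra.
have e10 : 0 < e1 by exact: divr_gt0.
have unif : \forall s' \near s, forall x, `[a, b]%classic x -> `|K (x, s) - K (x, s')| <= e1.
  have NC := (compact_near_coveringP `[a, b]%classic).1 (@segment_compact R a b).
  apply: (NC R (nbhs s) (fun s' x => `|K (x, s) - K (x, s')| <= e1)) => x _.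
  have e20 : 0 < e1 / 2 by exact: divr_gt0.
  have : \forall z \near (x, s), `|K (x, s) - K z| <= e1 / 2.
    by move/cvgrPdist_le : (cK (x, s)); apply.
  move=> /near_boxP[r r0 H].
  exists (ball x r, ball s r); first by split; exact: nbhsx_ballx.
  move=> [x' s'] [/= xr sr].
  have H1 := H x' s'; have H2 := H x' s.
  rewrite /ball /= distrC in xr; rewrite /ball /= distrC in sr.
  have := H1 xr sr; have := H2 xr; rewrite subrr normr0 => /(_ r0).
  rewrite !ler_norml; lra.
apply: filterS unif => s' H.
rewrite -RintegralB_continuous; [|exact: continuous_ysection|exact: continuous_ysection].
apply: (@le_trans _ _ (e1 * (b - a))).
  apply: le_normr_Rintegral_cst => //.
  by move=> x; apply: cvgB; exact: continuous_ysection.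
by rewrite /e1 mulrAC ler_pdivrMr//; apply: ler_wpM2l; [exact: ltW|lra].
Qed.

(** Leibniz rule for a divergence-free field (F, G): through the moving
    section [Y1, Y2] the flux of F changes only by what crosses the two end
    curves.  Near the section the field has the C^1 stream function chi. *)
Lemma is_derive_flux F G (Y1 Y2 : R -> R) q d1 d2 r b0 t0 :
  continuous F -> continuous G -> 0 < r ->
  b0 < Y1 q -> Y1 q < Y2 q -> Y2 q < t0 ->
  (forall x1 x2 y1 y2, q - r < x1 -> x1 < x2 -> x2 < q + r ->
     b0 <= y1 -> y1 < y2 -> y2 <= t0 -> balance F G x1 x2 y1 y2) ->
  is_derive q 1 Y1 d1 -> is_derive q 1 Y2 d2 ->
  is_derive q 1 (fun x => \int[mu]_(y in `[Y1 x, Y2 x]) F (x, y))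
    (F (q, Y2 q) * d2 - G (q, Y2 q) - (F (q, Y1 q) * d1 - G (q, Y1 q))).
Proof.
move=> cF cG r0 bY1 Y12 Y2t bal dY1 dY2.
pose chi (z : R * R) := primitive (fun y => F (z.1, y)) z.2 - primitive (fun y => F (z.1, y)) b0.
have cFx x : continuous (fun y => F (x, y)) by exact: continuous_xsection.
pose U (z : R * R) := `|z.1 - q| < r /\ b0 < z.2 < t0.
have chi_y z : is_derive z (e_y R) chi (F z).
  apply/is_derive_eyE; rewrite /chi /= -[F z]subr0; apply: is_deriveB.
  by case: z => x y /=; exact: (@is_derive_primitive _ (fun y => F (x, y))).
have chi_x z : U z -> is_derive z (e_x R) chi (- G z + G (z.1, b0)).
  case: z => x y [/= xr /andP[by_ yt]]; apply/is_derive_exE => /=.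
  pose k (s : R) := G (s, y) - G (s, b0).
  have ck : continuous k by move=> s; apply: cvgB; exact: continuous_ysection.
  have inc x1 x2 : q - r < x1 -> x1 < x2 -> x2 < q + r ->
      chi (x2, y) + primitive k x2 = chi (x1, y) + primitive k x1.
    move=> qx1 x12 xq2.
    have := bal x1 x2 b0 y qx1 x12 xq2 (lexx _) by_ (ltW yt); rewrite /balance.
    rewrite (RintegralB_continuous b0 y (cFx x2) (cFx x1)).
    rewrite (Rintegral_primitive (cFx x2) (ltW by_)) (Rintegral_primitive (cFx x1) (ltW by_)).
    have -> : \int[mu]_(x in `[x1, x2]) (G (x, y) - G (x, b0)) = primitive k x2 - primitive k x1.
      exact: (Rintegral_primitive ck (ltW x12)).
    by rewrite /chi /=; lra.
  have cst_chi x' : `|x' - q| < r -> chi (x', y) = (chi (x, y) + primitive k x) - primitive k x'.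
    move: xr; rewrite !ltr_norml => xr x'r.
    by have [xx|xx|->] := ltgtP x x';
      [rewrite -(inc x x'); lra|rewrite (inc x' x); lra|lra].
  have -> : - G (x, y) + G (x, b0) = 0 - k x by rewrite /k; lra.
  apply: (near_eq_is_derive _ (is_deriveB (is_derive_cst (chi (x, y) + primitive k x) x (1 : R)) (is_derive_primitive x ck))).
  have rr : 0 < r - `|x - q| by rewrite subr_gt0.
  have near_x : \forall x' \near x, `|x - x'| < r - `|x - q|.
    by have /cvgrPdist_lt := @cvg_id _ (nbhs x); apply.
  near=> x'; rewrite (cst_chi x')//.
  have : `|x - x'| < r - `|x - q|.
    by near: x'.
  move=> H; apply: (le_lt_trans (ler_distD x _ _)).
  by rewrite (distrC x' x); lra.
have cchi_x : continuous (fun z : R * R => - G z + G (z.1, b0)).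
  move=> z; apply: cvgD; first by apply: cvgN; exact: cG.
  apply: (@continuous_comp _ _ _ (fun z : R * R => (z.1, b0)) G); last exact: cG.
  by apply: (@continuous_pairing R _ fst (fun=> b0)); [exact: cvg_fst|exact: cvg_cst].
have along (Y : R -> R) e : b0 < Y q < t0 -> is_derive q 1 Y e ->
    is_derive q 1 (fun x => chi (x, Y x)) (- G (q, Y q) + G (q, b0) + F (q, Y q) * e).
  move=> /andP[bY Yt] dY.
  apply: (@is_derive_along_curve R chi (fun z => - G z + G (z.1, b0)) F Y q e) => //; last 2 first.
  - exact: cchi_x.
  - exact: cF.
  - apply/near_boxP; exists (Num.min r (Num.min (Y q - b0) (t0 - Y q))).
      by rewrite !lt_min r0 !subr_gt0 bY.
    move=> x y; rewrite !lt_min => /and3P[xr _ _] /and3P[_ y1 y2].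
    by apply: chi_x; split => //=; move: y1 y2; rewrite !ltr_norml; lra.
  - by near=> z.
have := is_deriveB (along Y2 d2 _ dY2) (along Y1 d1 _ dY1).
have I2 : b0 < Y2 q < t0 by rewrite Y2t andbT (lt_trans bY1).
have I1 : b0 < Y1 q < t0 by rewrite bY1 (lt_trans Y12).
move=> /(_ I2 I1) D.
have -> : F (q, Y2 q) * d2 - G (q, Y2 q) - (F (q, Y1 q) * d1 - G (q, Y1 q)) =
  (- G (q, Y2 q) + G (q, b0) + F (q, Y2 q) * d2) -
  (- G (q, Y1 q) + G (q, b0) + F (q, Y1 q) * d1) by ring.
apply: near_eq_is_derive D.
have cY := is_derive1_continuous dY1; have cY2 := is_derive1_continuous dY2.
have gap : 0 < (Y2 q - Y1 q) / 2 by rewrite divr_gt0// subr_gt0.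
near=> x.
have H1 : `|Y1 q - Y1 x| < (Y2 q - Y1 q) / 2 by near: x; move/cvgrPdist_lt : cY; apply.
have H2 : `|Y2 q - Y2 x| < (Y2 q - Y1 q) / 2 by near: x; move/cvgrPdist_lt : cY2; apply.
rewrite Rintegral_primitive//; last by move: H1 H2; rewrite !ltr_norml; lra.
by rewrite /chi -[LHS]/(_ - _ - (_ - _)) /=; ring.
Unshelve. all: by end_near.
Qed.

End FluxThroughSections.

Section Dynamics.
Context {R : realType}.
Notation mu := (@lebesgue_measure R).
Variables (g d c dl : R) (eta : R -> R) (psi uh vh h Ph : R * R -> R).
Hypothesis S : stream_setting d c dl eta psi uh vh h.
Hypotheses (cP : continuous Ph) (P_top : forall x, Ph (x, eta x) = 0).
Implicit Types (q s x y : R).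
Notation m := (bed_flux d psi).
Notation Y := (streamY d psi h).
Notation Q := (bernoulli g c uh vh Ph).

Definition fluid_rect a b y0 y1 := exists2 e : R, 0 < e &
  `[a - e, b + e] `*` `[y0 - e, y1 + e] `<=` fluid d eta.

Hypothesis bal_momentum : forall a b y0 y1 : R, a < b -> y0 < y1 -> fluid_rect a b y0 y1 ->
  balance (fun z => (uh z - c) * vh z) (fun z => vh z ^+ 2 + Ph z + g * z.2) a b y0 y1.
Hypothesis bal_bernoulli : forall a b y0 y1 : R, a < b -> y0 < y1 -> fluid_rect a b y0 y1 ->
  balance (fun z => Q z * (uh z - c)) (fun z => Q z * vh z) a b y0 y1.

Let cu := st_u S.
Let cv := st_v S.
Let cY : continuous Y := continuous_streamY S.

Lemma slip_neq0 z : uh z - c != 0.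
Proof. by rewrite -oppr_eq0 opprB gt_eqF// (lt_le_trans (st_dl S) (st_speed S z)). Qed.

Lemma streamY_lt q s1 s2 : - m <= s1 -> s1 < s2 -> s2 <= 0 -> Y (q, s1) < Y (q, s2).
Proof.
move=> ms1 s12 s20; rewrite lt_neqAle (streamY_le S)// ?ltW// andbT.
apply/eqP => E.
have [|_ _ E1] := @streamYP _ _ _ _ _ _ _ _ _ S q s1; first by rewrite ms1 (le_trans (ltW s12)).
have [|_ _ E2] := @streamYP _ _ _ _ _ _ _ _ _ S q s2; first by rewrite s20 (le_trans ms1)// ltW.
by move: E1; rewrite E E2; lra.
Qed.

Lemma is_derive_flux_streamlines F G q s1 s2 :
  continuous F -> continuous G ->
  (forall a b y0 y1 : R, a < b -> y0 < y1 -> fluid_rect a b y0 y1 -> balance F G a b y0 y1) ->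
  - m < s1 -> s1 < s2 -> s2 < 0 ->
  let sl s := vh (q, Y (q, s)) / (uh (q, Y (q, s)) - c) in
  is_derive q 1 (fun x => \int[mu]_(y in `[Y (x, s1), Y (x, s2)]) F (x, y))
    (F (q, Y (q, s2)) * sl s2 - G (q, Y (q, s2)) -
     (F (q, Y (q, s1)) * sl s1 - G (q, Y (q, s1)))).
Proof.
move=> cF cG bal ms1 s12 s20 sl.
have I1 : - m < s1 < 0 by rewrite ms1 (lt_trans s12).
have I2 : - m < s2 < 0 by rewrite s20 (lt_trans ms1).
have /near_boxP[r1 r10 H1] := near_fluid (st_eta S) (streamY_fluid S q I1).
have /near_boxP[r2 r20 H2] := near_fluid (st_eta S) (streamY_fluid S q I2).
pose rho := Num.min r1 r2 / 2.
have rho0 : 0 < rho by rewrite divr_gt0// lt_min r10.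
have [rr1 rr2] : rho < r1 /\ rho < r2.
  have : rho < Num.min r1 r2 by move: rho0; rewrite /rho; lra.
  by rewrite lt_min => /andP.
have tube x y : `|x - q| <= rho -> Y (q, s1) - rho <= y <= Y (q, s2) + rho -> fluid d eta (x, y).
  move=> xr /andP[y1 y2].
  have F1 := H1 x (Y (q, s1) - rho) (le_lt_trans xr rr1).
  have F2 := H2 x (Y (q, s2) + rho) (le_lt_trans xr rr2).
  move: F1 F2; rewrite /fluid /=.
  have -> : `|Y (q, s1) - rho - Y (q, s1)| = rho by rewrite addrAC subrr sub0r normrN gtr0_norm.
  have -> : `|Y (q, s2) + rho - Y (q, s2)| = rho by rewrite addrAC subrr add0r gtr0_norm.
  by move=> /(_ rr1) + /(_ rr2); lra.
have lt12 := streamY_lt q (ltW ms1) s12 (ltW s20).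
apply: (@is_derive_flux R F G (fun x => Y (x, s1)) (fun x => Y (x, s2)) q (sl s1) (sl s2)
  (rho / 2) (Y (q, s1) - rho / 2) (Y (q, s2) + rho / 2)) => //; try lra.
- move=> x1 x2 y1 y2 a1 a2 a3 b1 b2 b3; apply: bal => //.
  exists (rho / 4); first by rewrite divr_gt0.
  move=> [x y] [/=]; rewrite !in_itv/= => xI yI; apply: tube; last lra.
  by rewrite ler_norml; lra.
- exact: (is_derive_streamY_q S).
- exact: (is_derive_streamY_q S).
Qed.

(** Q (u - c, v) is divergence free and tangent to the streamlines, so its
    flux between two streamlines does not depend on the section; so does then
    the flux density Q itself. *)
Lemma bernoulli_streamline q q' s : - m < s < 0 -> Q (q, Y (q, s)) = Q (q', Y (q', s)).
Proof.
move=> /andP[ms s0].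
have cQ : continuous Q by exact: continuous_bernoulli.
pose F z := Q z * (uh z - c).
have cF : continuous F by move=> z; apply: cvgM; [exact: cQ|apply: cvgB; [exact: cu|exact: cvg_cst]].
have cG : continuous (fun z => Q z * vh z) by move=> z; apply: cvgM; [exact: cQ|exact: cv].
have cst_flux x x' s1 s2 : - m < s1 -> s1 < s2 -> s2 < 0 ->
    \int[mu]_(y in `[Y (x, s1), Y (x, s2)]) F (x, y) =
    \int[mu]_(y in `[Y (x', s1), Y (x', s2)]) F (x', y).
  move=> ms1 s12 s20.
  apply: (@is_derive_0_is_cst R (fun x => \int[mu]_(y in `[Y (x, s1), Y (x, s2)]) F (x, y))) => t.
  have := is_derive_flux_streamlines t cF cG bal_bernoulli ms1 s12 s20.
  rewrite /F /=.
  set z1 := (t, Y (t, s1)); set z2 := (t, Y (t, s2)).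
  have -> : Q z2 * (uh z2 - c) * (vh z2 / (uh z2 - c)) - Q z2 * vh z2 -
    (Q z1 * (uh z1 - c) * (vh z1 / (uh z1 - c)) - Q z1 * vh z1) = 0; last exact.
  by field; rewrite !slip_neq0.
pose s1 := (s - m) / 2.
have [ms1 s1s] : - m < s1 /\ s1 < s by rewrite /s1; split; lra.
have density x : is_derive s 1 (fun s2 => \int[mu]_(y in `[Y (x, s1), Y (x, s2)]) F (x, y))
    (- Q (x, Y (x, s))).
  have sI : - m < s < 0 by rewrite ms.
  have cFx : continuous (fun y => F (x, y)) by exact: continuous_xsection.
  have D1 := @is_derive1_comp _ (primitive (fun y => F (x, y))) (fun s2 => Y (x, s2)) s _ _
    (is_derive_primitive _ cFx) (is_derive_streamY_s S x sI).
  have := is_deriveB D1 (is_derive_cst (primitive (fun y => F (x, y)) (Y (x, s1))) s (1 : R)).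
  have -> : F (x, Y (x, s)) * (c - uh (x, Y (x, s)))^-1 - 0 = - Q (x, Y (x, s)).
    rewrite subr0 /F -[c - _]opprB invrN mulrN -mulrA divff ?slip_neq0//.
    by rewrite mulr1.
  apply: near_eq_is_derive; near=> s2 => /=.
  rewrite Rintegral_primitive//; apply: (streamY_le S); first exact: ltW.
    by apply: ltW; near: s2; exact: lt_nbhsr.
  by apply: ltW; near: s2; exact: lt_nbhsl.
have [_ D] := density q; have [_ D'] := density q'.
apply: oppr_inj; rewrite -D -D'.
apply: near_eq_derive; near=> s2; apply: cst_flux => //.
  by near: s2; exact: lt_nbhsr.
by near: s2; exact: lt_nbhsl.
Unshelve. all: by end_near.
Qed.

Definition stream_pressure z : R := Ph (z.1, Y z) + g * Y z.
Notation T := stream_pressure.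

Lemma continuous_on_streamline (F : R * R -> R) : continuous F -> continuous (fun z : R * R => F (z.1, Y z)).
Proof.
move=> cF z; apply: (@continuous_comp _ _ _ (fun z : R * R => (z.1, Y z)) F); last exact: cF.
by apply: (@continuous_pairing R _ fst Y); [exact: cvg_fst|exact: cY].
Qed.

Lemma continuous_stream_pressure : continuous T.
Proof.
move=> z; apply: cvgD; first exact: continuous_on_streamline.
by apply: cvgM; [exact: cvg_cst|exact: cY].
Qed.

(** Vertical momentum carried through the section above the streamline s. *)
Definition lift q s : R := \int[mu]_(y in `[Y (q, s), eta q]) ((uh (q, y) - c) * vh (q, y)).

Let cmom : continuous (fun z => (uh z - c) * vh z).
Proof. by move=> z; apply: cvgM; [apply: cvgB; [exact: cu|exact: cvg_cst]|exact: cv]. Qed.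

Lemma lift_bound q s V : - m <= s <= 0 ->
  (forall y, - d <= y <= eta q -> `|vh (q, y)| <= V) -> `|lift q s| <= V * - s.
Proof.
move=> sI HV; have [a b E] := streamYP S q sI.
have -> : V * - s = \int[mu]_(y in `[Y (q, s), eta q]) (V * (c - uh (q, y))).
  rewrite RintegralZl_continuous; last exact: (continuous_speed S).
  by rewrite (psi_FTC S)// E (st_top S) subr0.
apply: le_normr_Rintegral_dom.
- exact: (@continuous_xsection R _ q cmom).
- by move=> y; apply: cvgM; [exact: cvg_cst|exact: (continuous_speed S)].
move=> y yI; rewrite normrM mulrC; apply: ler_pM => //; first by apply: HV; lra.
rewrite distrC ger0_norm//; apply: (le_trans (ltW (st_dl S))); exact: (st_speed S).
Qed.

(** Between two streamlines the flux of vertical momentum changes by the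
    difference of T, as the convective part of the flux through a streamline
    vanishes.  The upper streamline is then moved to the surface, where
    T = g eta. *)
Lemma lift_balance q0 q1 s : q0 <= q1 -> - m < s < 0 ->
  lift q1 s - lift q0 s = \int[mu]_(q in `[q0, q1]) (T (q, s) - g * eta q).
Proof.
move=> q01 /andP[ms s0].
pose F z := (uh z - c) * vh z; pose G z := vh z ^+ 2 + Ph z + g * z.2.
have cG : continuous G.
  move=> z; apply: cvgD; last by apply: cvgM; [exact: cvg_cst|exact: cvg_snd].
  by apply: cvgD; [apply: (@continuous_sqr _ _ z); exact: cv|exact: cP].
pose J q s2 := \int[mu]_(y in `[Y (q, s), Y (q, s2)]) F (q, y).
have cT := continuous_stream_pressure.
have cTs t : continuous (fun q => T (q, t)) by exact: continuous_ysection.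
have interior s2 : s < s2 -> s2 < 0 ->
    J q1 s2 - J q0 s2 = \int[mu]_(q in `[q0, q1]) (T (q, s) - T (q, s2)).
  move=> s12 s20.
  have dJ q : is_derive q 1 (fun q => J q s2) (T (q, s) - T (q, s2)).
    have := is_derive_flux_streamlines q cmom cG bal_momentum ms s12 s20.
    rewrite /G /T /stream_pressure /=.
    set z1 := (q, Y (q, s)); set z2 := (q, Y (q, s2)).
    have -> : (uh z2 - c) * vh z2 * (vh z2 / (uh z2 - c)) -
      (vh z2 ^+ 2 + Ph z2 + g * Y (q, s2)) -
      ((uh z1 - c) * vh z1 * (vh z1 / (uh z1 - c)) - (vh z1 ^+ 2 + Ph z1 + g * Y (q, s))) =
      Ph z1 + g * Y (q, s) - (Ph z2 + g * Y (q, s2)); last exact.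
    by field; rewrite !slip_neq0.
  symmetry; apply: Rintegral_FTC2 => //.
  - by move=> q; apply: cvgB; exact: cTs.
  - by apply: continuous_subspaceT => q; exact: is_derive1_continuous (dJ q).
(* The surface is reached by continuity in the label of the upper streamline. *)
pose k s2 := primitive (fun y => F (q1, y)) (Y (q1, s2)) - primitive (fun y => F (q1, y)) (Y (q1, s))
  - (primitive (fun y => F (q0, y)) (Y (q0, s2)) - primitive (fun y => F (q0, y)) (Y (q0, s)))
  - \int[mu]_(q in `[q0, q1]) (T (q, s) - T (q, s2)).
have cFx x : continuous (fun y => F (x, y)) by exact: continuous_xsection.
have ck : continuous k.
  have cprim x : continuous (fun s2 => primitive (fun y => F (x, y)) (Y (x, s2))).
    move=> t; apply: (@continuous_comp _ _ _ (fun s2 => Y (x, s2)) (primitive (fun y => F (x, y)))).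
      exact: (@continuous_xsection R Y x cY).
    exact: is_derive1_continuous (is_derive_primitive _ (cFx x)).
  move=> t; apply: cvgB.
    by apply: cvgB; (apply: cvgB; [exact: cprim|exact: cvg_cst]).
  apply: (@continuous_Rintegral_param R (fun z => T (z.1, s) - T z)) => // z.
  apply: cvgB; last exact: cT.
  by apply: (@continuous_comp _ _ _ fst (fun q => T (q, s))); [exact: cvg_fst|exact: cTs].
have k0 s2 : s < s2 -> s2 < 0 -> k s2 = 0.
  move=> a b; have := interior s2 a b; rewrite /k /J.
  have le x : Y (x, s) <= Y (x, s2) by apply: (streamY_le S); apply: ltW.
  rewrite (Rintegral_primitive (cFx q1) (le q1)) (Rintegral_primitive (cFx q0) (le q0)).
  by move=> ->; rewrite subrr.
have kz : k 0 = 0.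
  apply: contrapT => /eqP nz.
  have e0 : 0 < `|k 0| by rewrite normr_gt0.
  have /cvgrPdist_lt/(_ _ e0) := ck 0 => /(@nbhs_ballP _ _ (0 : R) _)[r /= r0 H].
  pose t := - (Num.min r (- s) / 2).
  have m0 : 0 < Num.min r (- s) by rewrite lt_min r0 oppr_gt0.
  have [mr ms'] : Num.min r (- s) <= r /\ Num.min r (- s) <= - s by rewrite !ge_min !lexx orbT.
  have tr : ball (0 : R) r t by rewrite /ball /= sub0r opprK gtr0_norm; lra.
  have := H t tr.
  rewrite (k0 t); [by rewrite subr0 ltxx|rewrite /t; lra|rewrite /t; lra].
move: kz; rewrite /k !(streamY_top S).
have le x : Y (x, s) <= eta x by rewrite -(streamY_top S x); apply: (streamY_le S) => //; exact: ltW.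
rewrite -(Rintegral_primitive (cFx q1) (le q1)) -(Rintegral_primitive (cFx q0) (le q0)).
have -> : \int[mu]_(q in `[q0, q1]) (T (q, s) - T (q, 0)) =
    \int[mu]_(q in `[q0, q1]) (T (q, s) - g * eta q).
  apply: eq_Rintegral => q _; congr (_ - _).
  by rewrite /T /stream_pressure /= (streamY_top S) P_top add0r.
by move=> /eqP; rewrite subr_eq0 => /eqP.
Qed.

End Dynamics.

(** * The flow at infinity *)

Section Asymptotics.
Context {R : realType}.
Notation mu := (@lebesgue_measure R).

Definition for_large (P : R -> Prop) := exists X : R, forall x, X <= x -> P x.

Lemma for_largeI (P P' : R -> Prop) : for_large P -> for_large P' ->
  for_large (fun x => P x /\ P' x).
Proof.
move=> [X HX] [X' HX']; exists (Num.max X X') => x; rewrite ge_max => /andP[a b].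
by split; [exact: HX|exact: HX'].
Qed.

Lemma for_largeS (P P' : R -> Prop) : (forall x, P x -> P' x) -> for_large P -> for_large P'.
Proof. by move=> PP [X HX]; exists X => x /HX/PP. Qed.

Lemma for_large_ex (P : R -> Prop) : for_large P -> exists x, P x.
Proof. by move=> [X HX]; exists X; exact: HX. Qed.

Lemma for_large_window (P : R -> Prop) : for_large P ->
  for_large (fun x => forall q, x <= q -> P q).
Proof. by move=> [X HX]; exists X => x Xx q xq; apply: HX; exact: le_trans xq. Qed.

Variables (g d c dl : R) (eta : R -> R) (psi uh vh h Ph : R * R -> R) (Uh : R -> R).
Hypothesis S : stream_setting d c dl eta psi uh vh h.
Hypotheses (cP : continuous Ph) (P_top : forall x, Ph (x, eta x) = 0).
Hypotheses (g0 : 0 < g) (d0 : 0 < d) (cU : continuous Uh) (U_speed : forall y, dl <= c - Uh y).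
Implicit Types (q s x y : R).
Notation m := (bed_flux d psi).
Notation Y := (streamY d psi h).
Notation Q := (bernoulli g c uh vh Ph).
Notation T := (stream_pressure g d psi h Ph).
Notation lift := (lift d c eta psi uh vh h).

Hypothesis bal_momentum : forall a b y0 y1 : R, a < b -> y0 < y1 -> fluid_rect d eta a b y0 y1 ->
  balance (fun z => (uh z - c) * vh z) (fun z => vh z ^+ 2 + Ph z + g * z.2) a b y0 y1.
Hypothesis bal_bernoulli : forall a b y0 y1 : R, a < b -> y0 < y1 -> fluid_rect d eta a b y0 y1 ->
  balance (fun z => Q z * (uh z - c)) (fun z => Q z * vh z) a b y0 y1.

Hypothesis u_lim : forall e : R, 0 < e ->
  for_large (fun x => forall y, - d <= y -> y <= eta x -> y <= 0 -> `|uh (x, y) - Uh y| < e).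
Hypothesis v_lim : forall e : R, 0 < e ->
  for_large (fun x => forall y, - d <= y <= eta x -> `|vh (x, y)| < e).
Hypothesis eta_lim : forall e : R, 0 < e -> for_large (fun x => `|eta x| < e).

Let cu := st_u S.
Let cv := st_v S.
Let cY : continuous Y := continuous_streamY S.
Let dl0 := st_dl S.
Let cW : continuous (fun y => c - Uh y).
Proof. by move=> y; apply: cvgB; [exact: cvg_cst|exact: cU]. Qed.

Definition limit_flux y : R := \int[mu]_(t in `[- d, y]) (c - Uh t).
Notation I := limit_flux.

Lemma limit_fluxB y1 y2 : - d <= y1 -> y1 <= y2 -> dl * (y2 - y1) <= I y2 - I y1.
Proof.
move=> dy y12; rewrite /I (@Rintegral_itv_chasles R _ (- d) y1 y2) ?dy//; last exact: continuous_integrable_itv.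
rewrite addrAC subrr add0r.
have -> : dl * (y2 - y1) = \int[mu]_(t in `[y1, y2]) (cst dl) t.
  by rewrite Rintegral_itv_cst.
apply: le_Rintegral => //.
- by apply: continuous_integrable_itv => t; exact: cvg_cst.
- exact: continuous_integrable_itv.
Qed.

Lemma limit_flux_le y1 y2 : - d <= y1 -> y1 <= y2 -> I y1 <= I y2.
Proof.
move=> a b; have := limit_fluxB a b.
have : 0 <= dl * (y2 - y1) by apply: mulr_ge0; [exact: ltW|lra].
by lra.
Qed.

Lemma continuous_limit_flux y e : - d < y -> 0 < e ->
  exists2 r, 0 < r & forall t, - d <= t -> `|t - y| < r -> `|I t - I y| < e.
Proof.
move=> dy e0.
have cp : {for y, continuous (primitive (fun y => c - Uh y))}.
  exact: is_derive1_continuous (is_derive_primitive _ cW).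
have /cvgrPdist_lt/(_ _ e0) := cp => /(@nbhs_ballP _ _ y _)[r /= r0 H].
exists r => // t dt ty; rewrite /I !(Rintegral_primitive cW)//; last exact: ltW.
have := H t; rewrite /ball /= distrC => /(_ ty); rewrite distrC.
by congr (`|_| < _); ring.
Qed.

(** Below the level 0 the flux down to the bed converges; y = 0 is excluded, as
    eta may be negative. *)
Lemma psi_limit y e : - d <= y -> y < 0 -> 0 < e ->
  for_large (fun x => y < eta x /\ `|psi (x, y) - (m - I y)| <= e).
Proof.
move=> dy y0 e0.
have ed0 : 0 < e / (d + 1) by rewrite divr_gt0//; lra.
have ny : 0 < - y by lra.
apply: for_largeS (for_largeI (eta_lim ny) (u_lim ed0)) => x [ex ux].
have yx : y < eta x by move: ex; rewrite ltr_norml; lra.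
split => //.
have := psi_FTC S (lexx _) dy (ltW yx); rewrite (psi_bottom S) => E.
have -> : psi (x, y) - (m - I y) =
    \int[mu]_(t in `[- d, y]) ((c - Uh t) - (c - uh (x, t))).
  rewrite RintegralB_continuous//; last exact: (continuous_speed S).
  by rewrite E /I; lra.
apply: (@le_trans _ _ (e / (d + 1) * (y - - d))).
  apply: le_normr_Rintegral_cst => //.
    by move=> t; apply: cvgB; [exact: cW|exact: (continuous_speed S)].
  move=> t tI; apply: ltW; have -> : c - Uh t - (c - uh (x, t)) = uh (x, t) - Uh t by ring.
  by apply: ux; lra.
by rewrite mulrAC ler_pdivrMr; [apply: ler_wpM2l; [exact: ltW|lra]|lra].
Qed.

Lemma limit_flux_le_bed y : - d <= y -> y < 0 -> I y <= m.
Proof.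
move=> dy y0; rewrite leNgt; apply/negP => lt.
have e0 : 0 < (I y - m) / 2 by rewrite divr_gt0// subr_gt0.
have [x [yx H]] := for_large_ex (psi_limit dy y0 e0).
have := psi_decr S dy (ltW yx) (lexx _); rewrite (st_top S) subr0.
have : 0 <= dl * (eta x - y) by apply: mulr_ge0; [exact: ltW|lra].
by move: H; rewrite ler_norml; lra.
Qed.

Lemma total_flux_le_bed : I 0 <= m.
Proof.
rewrite leNgt; apply/negP => lt.
have e0 : 0 < I 0 - m by rewrite subr_gt0.
have d00 : - d < 0 by rewrite oppr_lt0.
have [r r0 H] := continuous_limit_flux d00 e0.
pose t := - (Num.min r d / 2).
have m0 : 0 < Num.min r d by rewrite lt_min r0.
have [mr md] : Num.min r d <= r /\ Num.min r d <= d by rewrite !ge_min !lexx orbT.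
have dt : - d <= t by rewrite /t; lra.
have t0 : t < 0 by rewrite /t; lra.
have := limit_flux_le_bed dt t0.
have : `|t - 0| < r by rewrite subr0 ler0_norm; rewrite /t; lra.
by move=> /(H t dt); rewrite ltr_norml; lra.
Qed.

Lemma lift_lim e : 0 < e ->
  for_large (fun x => forall s, - m <= s <= 0 -> `|lift x s| <= e).
Proof.
move=> e0; have m0 := bed_flux_gt0 S.
have em0 : 0 < e / m by rewrite divr_gt0.
apply: for_largeS (v_lim em0) => x vx s sI.
apply: (le_trans (@lift_bound _ _ _ _ _ _ _ _ _ S x s (e / m) sI _)).
  by move=> y yI; apply: ltW; exact: vx.
rewrite mulrAC ler_pdivrMr//; apply: ler_wpM2l; [exact: ltW|lra].
Qed.

Let cT : continuous T := continuous_stream_pressure S cP.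

(** Far out the pressure along a streamline is hydrostatic in the mean over
    unit windows, since the vertical momentum flux dies out. *)
Lemma mean_stream_pressure_lim e : 0 < e ->
  for_large (fun x => forall s, - m < s < 0 -> `|\int[mu]_(q in `[x, x + 1]) T (q, s)| <= e).
Proof.
move=> e0.
have e30 : 0 < e / 3 by rewrite divr_gt0.
have e3g : 0 < e / 3 / g by rewrite divr_gt0.
apply: for_largeS (for_large_window (for_largeI (lift_lim e30) (eta_lim e3g))) => x H s sI.
have x1 : x <= x + 1 by lra.
have sI' : - m <= s <= 0 by have /andP[a b] := sI; rewrite !ltW.
have [L0 _] := H x (lexx _); have [L1 _] := H _ x1.
have := lift_balance S cP P_top bal_momentum x1 sI.
have cTs : continuous (fun q => T (q, s)) by exact: continuous_ysection.
have ceta : continuous (fun q => g * eta q).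
  by move=> q; apply: cvgM; [exact: cvg_cst|exact: (st_eta S)].
rewrite RintegralB_continuous// => E.
have HE : `|\int[mu]_(q in `[x, x + 1]) (g * eta q)| <= e / 3 * (x + 1 - x).
  apply: le_normr_Rintegral_cst => // q /andP[xq _].
  have [_ eq] := H q xq.
  by rewrite normrM gtr0_norm// mulrC -ler_pdivlMr// ltW.
have := L0 s sI'; have := L1 s sI'; move: HE.
rewrite !ler_norml; lra.
Qed.

Lemma bernoulli_stream q s :
  Q (q, Y (q, s)) = ((c - uh (q, Y (q, s))) ^+ 2 + vh (q, Y (q, s)) ^+ 2) / 2 + T (q, s).
Proof. by rewrite /bernoulli /T /stream_pressure /=; field. Qed.

(** The convex function t |-> t^(-1/2) lies above its tangent at a^2, taken at
    t = w^2: a mean square speed gives a lower bound for the mean of 1 / w. *)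
Lemma inv_ge_tangent (a w : R) : 0 < a -> 0 < w ->
  (3 * a ^+ 2 - w ^+ 2) / (2 * a ^+ 3) <= w^-1.
Proof.
move=> a0 w0; rewrite -subr_ge0.
have -> : w^-1 - (3 * a ^+ 2 - w ^+ 2) / (2 * a ^+ 3) =
    (w - a) ^+ 2 * (w + 2 * a) / (2 * a ^+ 3 * w).
  by field; rewrite !gt_eqF.
apply: mulr_ge0.
  by apply: mulr_ge0; [exact: sqr_ge0|lra].
by rewrite invr_ge0 !mulr_ge0 ?exprn_ge0// ltW.
Qed.

(** No flux is hidden in the vanishing layer between y = 0 and the surface,
    where u has no prescribed limit: that layer would have to be crossed at
    unbounded speed, while Bernoulli's law bounds the mean square speed on each
    streamline. *)
Lemma bed_flux_limit : m = I 0.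
Proof.
apply/eqP; rewrite eq_le total_flux_le_bed andbT leNgt; apply/negP => lt.
pose k := m - I 0.
have k0 : 0 < k by rewrite subr_gt0.
have nd0 : - d < 0 by rewrite oppr_lt0.
have I00 : 0 < I 0.
  have := @limit_fluxB (- d) 0 (lexx _) (ltW nd0).
  have -> : I (- d) = 0 by rewrite /I Rintegral_itv_id.
  have : 0 < dl * (0 - - d).
    by apply: mulr_gt0; [exact: dl0|rewrite sub0r opprK].
  by lra.
(* Two streamlines strictly inside the layer that carries the flux k. *)
pose s1 := - (2 * k / 3); pose s2 := - (k / 3).
have ms1 : - m < s1 by rewrite /s1 /k; lra.
have s12 : s1 < s2 by rewrite /s1 /s2; lra.
have s20 : s2 < 0 by rewrite /s2; lra.
have cQ : continuous Q by exact: continuous_bernoulli.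
have cQY : continuous (fun z : R * R => Q (z.1, Y z)) by exact: (continuous_on_streamline S cQ).
have [K K0 HK] := bounded_rect 0 0 s1 s2 cQY.
(* K bounds Bernoulli's constants and the mean of - 2 T is at most 2 far out;
   one more unit makes a at least 1. *)
pose a := 2 * K + 3.
have a0 : 0 < a by rewrite /a; lra.
have thin (e : R) : 0 < e -> for_large (fun x => Y (x, s2) - Y (x, s1) <= e).
  move=> e0; pose y := - (Num.min d (e / 2)).
  have e20 : 0 < e / 2 by rewrite divr_gt0.
  have mn0 : 0 < Num.min d (e / 2) by rewrite lt_min d0.
  have [mn1 mn2] : Num.min d (e / 2) <= d /\ Num.min d (e / 2) <= e / 2 by rewrite !ge_min !lexx orbT.
  have dy : - d <= y by rewrite /y; lra.
  have y0 : y < 0 by rewrite /y; lra.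
  have k40 : 0 < k / 4 by rewrite divr_gt0.
  apply: for_largeS (for_largeI (psi_limit dy y0 k40) (eta_lim e20)) => x [[yx px] ex].
  have [|a1 b1 E1] := @streamYP _ _ _ _ _ _ _ _ _ S x s1; first by lra.
  have [|a2 b2 E2] := @streamYP _ _ _ _ _ _ _ _ _ S x s2; first by lra.
  have yY : y <= Y (x, s1).
    rewrite leNgt; apply/negP => Yy.
    have := psi_decr S a1 (ltW Yy) (ltW yx); rewrite E1.
    have : 0 <= dl * (y - Y (x, s1)) by apply: mulr_ge0; [exact: ltW|lra].
    have := limit_flux_le dy (ltW y0).
    by move: px; rewrite ler_norml /s1 /k; lra.
  by move: ex yY b2; rewrite ltr_norml /y; lra.
(* The layer between the two streamlines has thickness at least (s2 - s1) / a
   in the mean: twice what is allowed here. *)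
have e0 : 0 < (s2 - s1) / a / 2 by rewrite !divr_gt0// subr_gt0.
have [x [HT Hthin]] := for_large_ex (for_largeI (mean_stream_pressure_lim ltr01) (for_large_window (thin _ e0))).
pose w (z : R * R) := c - uh (z.1, Y z).
have cw : continuous w.
  move=> z; apply: cvgB; first exact: cvg_cst.
  exact: (continuous_on_streamline S (F := uh) cu).
have wdl z : dl <= w z by exact: (st_speed S).
have w0 z : 0 < w z := lt_le_trans dl0 (wdl z).
have ciw : continuous (fun z => (w z)^-1).
  by move=> z; apply: cvgV; [rewrite gt_eqF|exact: cw].
have cw2 : continuous (fun z => w z ^+ 2) by move=> z; apply: (@continuous_sqr _ w z); exact: cw.
have x1 : x <= x + 1 by lra.
have w2 s : s1 <= s <= s2 -> \int[mu]_(q in `[x, x + 1]) (w (q, s) ^+ 2) <= a.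
  move=> sI; have sI' : - m < s < 0 by lra.
  have := HT s sI'; rewrite ler_norml => /andP[T1 _].
  have cTs : continuous (fun q => T (q, s)) by exact: continuous_ysection.
  apply: (@le_trans _ _ (\int[mu]_(q in `[x, x + 1]) (2 * K - 2 * T (q, s)))).
    apply: le_Rintegral => //.
    - by apply: continuous_integrable_itv; exact: (@continuous_ysection R (fun z => w z ^+ 2) s cw2).
    - apply: continuous_integrable_itv => q; apply: cvgB; first exact: cvg_cst.
      by apply: cvgM; [exact: cvg_cst|exact: cTs].
    move=> q _.
    have EB := bernoulli_streamline S cP bal_bernoulli q 0 sI'.
    have := HK 0 s; rewrite lexx /= => /(_ isT sI).
    rewrite -EB bernoulli_stream ler_norml => /andP[_].
    have := sqr_ge0 (vh (q, Y (q, s))); rewrite /w /=; lra.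
  rewrite RintegralB_continuous; first last.
  - by move=> q; apply: cvgM; [exact: cvg_cst|exact: cTs].
  - by move=> q; exact: cvg_cst.
  rewrite RintegralZl_continuous//.
  have -> : \int[mu]_(t in `[x, x + 1]) (2 * K) = 2 * K.
    by rewrite Rintegral_itv_cst// addrAC subrr add0r mulr1.
  by rewrite /a; lra.
have width q : Y (q, s2) - Y (q, s1) = \int[mu]_(s in `[s1, s2]) (w (q, s))^-1.
  symmetry; apply: (@Rintegral_FTC2 R _ (fun s => Y (q, s))); first exact: ltW.
  - exact: (@continuous_xsection R (fun z => (w z)^-1) q ciw).
  - by apply: continuous_subspaceT; exact: (@continuous_xsection R Y q cY).
  by move=> s sI; apply: (is_derive_streamY_s S); lra.
have up : \int[mu]_(q in `[x, x + 1]) (Y (q, s2) - Y (q, s1)) <= (s2 - s1) / a / 2.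
  have cD : continuous (fun q => Y (q, s2) - Y (q, s1)).
    by move=> q; apply: cvgB; exact: (@continuous_ysection R Y _ cY).
  apply: (le_trans (ler_norm _)).
  have -> : (s2 - s1) / a / 2 = (s2 - s1) / a / 2 * (x + 1 - x) by ring.
  apply: le_normr_Rintegral_cst => // q /andP[xq _].
  rewrite ger0_norm; first exact: Hthin.
  by rewrite subr_ge0; apply: (streamY_le S); lra.
move: up; under eq_Rintegral do rewrite width.
rewrite (@Rintegral_continuous_swap R (fun z => (w z)^-1))//.
have a1 : 1 <= a by rewrite /a; lra.
have low s : s1 <= s <= s2 -> a^-1 <= \int[mu]_(q in `[x, x + 1]) (w (q, s))^-1.
  move=> sI; pose C := (2 * a ^+ 3)^-1.
  have C0 : 0 < C by rewrite invr_gt0 mulr_gt0// exprn_gt0.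
  have cws : continuous (fun q => w (q, s) ^+ 2).
    exact: (@continuous_ysection R (fun z => w z ^+ 2) s cw2).
  have cCw : continuous (fun q => C * w (q, s) ^+ 2).
    by move=> q; apply: cvgM; [exact: cvg_cst|exact: cws].
  apply: (@le_trans _ _ (\int[mu]_(q in `[x, x + 1]) (3 * a ^+ 2 * C - C * w (q, s) ^+ 2))).
    rewrite RintegralB_continuous//; last by move=> q; exact: cvg_cst.
    rewrite (Rintegral_itv_cst (3 * a ^+ 2 * C) x1) RintegralZl_continuous// [x + 1 - x]addrAC subrr add0r mulr1.
    have H : C * \int[mu]_(q in `[x, x + 1]) (w (q, s) ^+ 2) <= C * a ^+ 2.
      apply: ler_wpM2l; first exact: ltW.
      by apply: (le_trans (w2 s sI)); rewrite -[leLHS]mulr1; apply: ler_pM => //; lra.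
    apply: (@le_trans _ _ (3 * a ^+ 2 * C - C * a ^+ 2)); last lra.
    rewrite /C le_eqVlt; apply/orP; left; apply/eqP.
    by field; rewrite gt_eqF.
  apply: le_Rintegral => //.
  - by apply: continuous_integrable_itv => q; apply: cvgB; [exact: cvg_cst|exact: cCw].
  - by apply: continuous_integrable_itv; exact: (@continuous_ysection R (fun z => (w z)^-1) s ciw).
  move=> q _; have := inv_ge_tangent a0 (w0 (q, s)).
  by rewrite -/C mulrBl (mulrC (w _ ^+ 2) C).
apply/negP; rewrite -ltNge.
apply: (@lt_le_trans _ _ ((s2 - s1) / a)).
  by rewrite ltr_pdivrMr//; have : 0 < (s2 - s1) / a by [rewrite divr_gt0// subr_gt0]; lra.
rewrite mulrC -Rintegral_itv_cst ?(ltW s12)//.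
apply: le_Rintegral => //.
- by apply: continuous_integrable_itv => q; exact: cvg_cst.
- apply: continuous_integrable_itv.
  have := @continuous_Rintegral_param R (fun z => (w z)^-1) x (x + 1) ciw x1; exact.
Qed.

Let mE := bed_flux_limit.

Lemma streamY_lim s (z : R) : - m < s < 0 -> - d < z < 0 -> I z = m + s ->
  forall e : R, 0 < e -> for_large (fun x => `|Y (x, s) - z| < e).
Proof.
move=> sI /andP[dz z0] Iz e e0.
pose e1 := Num.min e (Num.min (z + d) (- z)) / 2.
have mn0 : 0 < Num.min e (Num.min (z + d) (- z)) by rewrite !lt_min e0 /=; lra.
have [n1 n2 n3] : [/\ Num.min e (Num.min (z + d) (- z)) <= e,
    Num.min e (Num.min (z + d) (- z)) <= z + d & Num.min e (Num.min (z + d) (- z)) <= - z].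
  by split; rewrite !ge_min lexx ?orbT.
have e10 : 0 < e1 by rewrite /e1; lra.
have dlo : 0 < dl * e1 / 2 by rewrite divr_gt0// mulr_gt0.
have A1 : - d <= z - e1 by rewrite /e1; lra.
have A2 : z - e1 < 0 by rewrite /e1; lra.
have B1 : - d <= z + e1 by rewrite /e1; lra.
have B2 : z + e1 < 0 by rewrite /e1; lra.
apply: for_largeS (for_largeI (psi_limit A1 A2 dlo) (psi_limit B1 B2 dlo)) => x [[Ax Ap] [Bx Bp]].
have sI' : - m <= s <= 0 by have /andP[? ?] := sI; rewrite !ltW.
have [a b E] := streamYP S x sI'.
have L1 : z - e1 < Y (x, s).
  rewrite ltNge; apply/negP => le.
  have := psi_decr S a le (ltW Ax).
  have : 0 <= dl * (z - e1 - Y (x, s)) by apply: mulr_ge0; [exact: ltW|lra].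
  have := @limit_fluxB (z - e1) z A1 ltac:(lra).
  have -> : z - (z - e1) = e1 by ring.
  by move: Ap; rewrite ler_norml E Iz; lra.
have L2 : Y (x, s) < z + e1.
  rewrite ltNge; apply/negP => le.
  have := psi_decr S B1 le b.
  have : 0 <= dl * (Y (x, s) - (z + e1)) by apply: mulr_ge0; [exact: ltW|lra].
  have := @limit_fluxB z (z + e1) (ltW dz) ltac:(lra).
  have -> : z + e1 - z = e1 by ring.
  by move: Bp; rewrite ler_norml E Iz; lra.
by rewrite ltr_norml; move: L1 L2; rewrite /e1; lra.
Qed.

(** On the streamline T tends to B - (c - U)^2 / 2, where B is its Bernoulli
    constant, while the mean of T tends to zero. *)
Lemma stream_pressureE q s (z : R) : - m < s < 0 -> - d < z < 0 -> I z = m + s ->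
  T (q, s) = (c - Uh z) ^+ 2 / 2 -
    ((c - uh (q, Y (q, s))) ^+ 2 + vh (q, Y (q, s)) ^+ 2) / 2.
Proof.
move=> sI zI Iz; have /andP[dz z0] := zI.
pose B := Q (0, Y (0, s)).
suff EB : B = (c - Uh z) ^+ 2 / 2.
  have := bernoulli_stream q s.
  by rewrite (bernoulli_streamline S cP bal_bernoulli q 0 sI) -/B EB; lra.
apply/eqP; rewrite -subr_eq0; apply/negPn/negP => nz.
set D := B - _ in nz.
have D0 : 0 < `|D| by rewrite normr_gt0.
pose f (t : R) := (c - t) ^+ 2 / 2.
have cf : continuous f.
  move=> t; apply: cvgM; last exact: cvg_cst.
  by rewrite /continuous_at; under eq_fun do rewrite expr2; rewrite expr2;
    apply: cvgM; apply: cvgB; by [exact: cvg_cst|exact: cvg_id].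
have D40 : 0 < `|D| / 4 by rewrite divr_gt0.
have /cvgrPdist_lt/(_ _ D40) := cf (Uh z) => /(@nbhs_ballP _ _ (Uh z) _)[rho /= rho0 Hf].
have rho20 : 0 < rho / 2 by rewrite divr_gt0.
have /cvgrPdist_lt/(_ _ rho20) := @cU z => /(@nbhs_ballP _ _ z _)[r /= r0 HU].
pose r1 := Num.min r (- z).
have r10 : 0 < r1 by rewrite lt_min r0 oppr_gt0.
have e20 : 0 < Num.min 1 (`|D| / 2) by rewrite lt_min ltr01 divr_gt0.
have [x [H HT]] := for_large_ex (for_largeI
  (for_large_window (for_largeI (streamY_lim sI zI Iz r10)
    (for_largeI (u_lim rho20) (v_lim e20))))
  (mean_stream_pressure_lim D40)).
have sI' : - m <= s <= 0 by have /andP[? ?] := sI; rewrite !ltW.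
have x1 : x <= x + 1 by lra.
have cTs : continuous (fun q => T (q, s)) by exact: continuous_ysection.
have cTD : continuous (fun q => T (q, s) - D).
  by move=> t; apply: cvgB; [exact: cTs|exact: cvg_cst].
have close t : x <= t <= x + 1 -> `|T (t, s) - D| <= `|D| / 2.
  move=> /andP[xt _]; have [HY [Hu Hv]] := H t xt.
  have [a b E] := streamYP S t sI'.
  move: HY; rewrite lt_min => /andP[Yr Yz].
  have Y0 : Y (t, s) <= 0 by move: Yz; rewrite ltr_norml; lra.
  have Hu' := Hu _ a b Y0.
  have Hv' := Hv (Y (t, s)); rewrite a b in Hv'; have {}Hv' := Hv' isT.
  have := HU (Y (t, s)); rewrite /ball /= distrC => /(_ Yr) HU'.
  have := Hf (uh (t, Y (t, s))); rewrite /ball /=.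
  have near_u : `|Uh z - uh (t, Y (t, s))| < rho.
    by move: Hu' HU'; rewrite !ltr_norml; lra.
  move=> /(_ near_u); rewrite /f.
  have -> : T (t, s) - D = (c - Uh z) ^+ 2 / 2 - (c - uh (t, Y (t, s))) ^+ 2 / 2
      - vh (t, Y (t, s)) ^+ 2 / 2.
    have := bernoulli_stream t s.
    by rewrite (bernoulli_streamline S cP bal_bernoulli t 0 sI) -/B /D; lra.
  have : 0 <= vh (t, Y (t, s)) ^+ 2 <= `|D| / 2.
    rewrite sqr_ge0 /= -[leLHS]ger0_norm ?sqr_ge0// expr2 normrM.
    move: Hv'; rewrite lt_min => /andP[v1 v2].
    by apply: (@le_trans _ _ (1 * `|vh (t, Y (t, s))|)); [apply: ler_wpM2r => //; exact: ltW|rewrite mul1r ltW].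
  by rewrite ltr_norml ler_norml; lra.
have := le_normr_Rintegral_cst cTD x1 close.
rewrite RintegralB_continuous//; last by move=> t; exact: cvg_cst.
have := HT s sI.
rewrite Rintegral_itv_cst// [x + 1 - x]addrAC subrr add0r !mulr1 => h1 h2.
have := ler_distD (\int[mu]_(t in `[x, x + 1]) T (t, s)) D 0.
by rewrite !subr0 distrC; lra.
Qed.

End Asymptotics.

(** * The undisturbed stream *)

Section AsymptoticHeight.
Context {R : realType}.
Notation mu := (@lebesgue_measure R).
Variables (d c dl : R) (Uh H : R -> R).
Hypotheses (d0 : 0 < d) (dl0 : 0 < dl) (cU : continuous Uh)
  (U_speed : forall y, dl <= c - Uh y).
Notation I := (limit_flux d c Uh).
Notation m := (I 0).
Hypothesis HI : forall y, - d <= y <= 0 -> H (I y - m) = y + d.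
Implicit Types (s y : R).

Let W y := c - Uh y.
Let cW : continuous W.
Proof. by move=> y; apply: cvgB; [exact: cvg_cst|exact: cU]. Qed.
Let W0 y : 0 < W y. Proof. exact: lt_le_trans dl0 (U_speed y). Qed.
Let nd0 : - d < 0. Proof. by rewrite oppr_lt0. Qed.

Lemma limit_flux_bed : I (- d) = 0.
Proof. by rewrite /limit_flux Rintegral_itv_id. Qed.

Lemma limit_fluxE y : - d <= y -> I y = primitive W y - primitive W (- d).
Proof. by move=> dy; rewrite /limit_flux Rintegral_primitive. Qed.

Lemma limit_flux_ge0 : 0 <= m.
Proof.
have := @limit_fluxB R d c dl Uh cU U_speed (- d) 0 (lexx _) (ltW nd0).
rewrite limit_flux_bed subr0; apply: le_trans.
by rewrite sub0r opprK mulr_ge0// ltW.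
Qed.

(** Ordinate of the streamline s in the undisturbed stream; confining the label
    to its range makes it continuous on the line. *)
Definition level s : R := H (pin (- m) 0 s) - d.

Lemma levelP s : - m <= s <= 0 -> - d <= level s <= 0 /\ I (level s) = m + s.
Proof.
move=> /andP[ms s0].
have m0 := limit_flux_ge0.
have [||y] := @IVT R (fun y => primitive W y - primitive W (- d)) (- d) 0 (m + s) (ltW nd0).
- apply: continuous_subspaceT => y; apply: cvgB; last exact: cvg_cst.
  exact: is_derive1_continuous (is_derive_primitive y cW).
- rewrite subrr -(limit_fluxE (ltW nd0)) ge_min le_max.
  by apply/andP; split; apply/orP; [left|right]; lra.
rewrite in_itv/= => yI; have /andP[dy y0] := yI.
rewrite -(limit_fluxE dy) => E.
have -> : level s = y; last by [].
rewrite /level pin_id ?ms//.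
by have -> : s = I y - m by [lra]; rewrite HI// addrK.
Qed.

Lemma level_unique s y : - m <= s <= 0 -> - d <= y <= 0 -> I y = m + s -> level s = y.
Proof.
move=> sI yI E; rewrite /level pin_id//.
by have -> : s = I y - m by [lra]; rewrite HI// addrK.
Qed.

Lemma level_top : level 0 = 0.
Proof. by apply: level_unique; rewrite ?lexx ?oppr_le0 ?limit_flux_ge0 ?ltW ?addr0. Qed.

Lemma level_bed : level (- m) = - d.
Proof.
by apply: level_unique; rewrite ?lexx ?oppr_le0 ?limit_flux_ge0 ?ltW ?limit_flux_bed ?subrr.
Qed.

Lemma level_interior s : - m < s < 0 -> - d < level s < 0.
Proof.
move=> /andP[ms s0]; have [|/andP[a b] E] := @levelP s; first by rewrite !ltW.
rewrite !lt_neqAle a b !andbT; apply/andP; split; apply/eqP => F.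
  by move: E; rewrite -F limit_flux_bed; lra.
by move: E; rewrite F; lra.
Qed.

Lemma continuous_level : continuous level.
Proof.
pose cs := pin (- m) 0.
have csI s : - m <= cs s <= 0 by apply: pin_itv; rewrite oppr_le0 limit_flux_ge0.
have ccs : continuous cs by exact: continuous_pin.
have clamped s : level s = level (cs s) by rewrite /level (pin_id (csI s)).
have lip s t : dl * `|level s - level t| <= `|cs s - cs t|.
  rewrite (clamped s) (clamped t).
  have [/andP[a1 b1] E1] := levelP (csI s); have [/andP[a2 b2] E2] := levelP (csI t).
  have -> : cs s - cs t = I (level (cs s)) - I (level (cs t)) by rewrite E1 E2; ring.
  have [le|/ltW le] := leP (level (cs s)) (level (cs t)).
    rewrite distrC [leRHS]distrC ger0_norm ?subr_ge0//.
    by apply: le_trans (ler_norm _); exact: (limit_fluxB cU U_speed).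
  rewrite ger0_norm ?subr_ge0//.
  by apply: le_trans (ler_norm _); exact: (limit_fluxB cU U_speed).
move=> s; apply/cvgrPdist_lt => e e0.
have de : 0 < dl * e by exact: mulr_gt0.
have /cvgrPdist_lt/(_ _ de) := ccs s; apply: filterS => t H1.
by rewrite -(ltr_pM2l dl0); apply: le_lt_trans (lip s t) H1.
Qed.

Definition level_slope s : R := (W (level s))^-1.

Lemma continuous_level_slope : continuous level_slope.
Proof.
move=> s; apply: cvgV; first by rewrite gt_eqF.
by apply: (@continuous_comp _ _ _ level W); [exact: continuous_level|exact: cW].
Qed.

Lemma level_slope_gt0 s : 0 < level_slope s.
Proof. by rewrite invr_gt0. Qed.

Lemma level_slope_le s : level_slope s <= dl^-1.
Proof. by rewrite lef_pV2 ?posrE// U_speed. Qed.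

(** Implicit differentiation of int_(-d)^level (c - U) = m + s. *)
Lemma is_derive_level s : - m < s < 0 -> is_derive s 1 level (level_slope s).
Proof.
move=> sI; have -> : level_slope s = - (- 1) / W (level s) by rewrite opprK mul1r.
apply: (@is_derive_implicit R (fun z => primitive W z.2 - z.1) (fun=> - 1) (fun z => W z.2) level s).
- near=> z; apply/is_derive_exE => /=.
  have := is_deriveB (is_derive_cst (primitive W z.2) z.1 (1 : R)) (is_derive_id z.1 (1 : R)).
  by rewrite sub0r.
- near=> z; apply/is_derive_eyE => /=.
  have := is_deriveB (is_derive_primitive z.2 cW) (is_derive_cst z.1 z.2 (1 : R)).
  by rewrite subr0.
- exact: cvg_cst.
- by apply: (@continuous_comp _ _ _ snd W); [exact: cvg_snd|exact: cW].
- exact: continuous_level.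
- by rewrite gt_eqF.
- have E t : - m < t < 0 -> primitive W (level t) - t = m + primitive W (- d).
    move=> /andP[mt t0].
    have [|/andP[a _]] := @levelP t; first by rewrite !ltW.
    by rewrite (limit_fluxE a); lra.
  have /andP[ms s0] := sI.
  near=> t => /=; rewrite (E s sI) E//; apply/andP; split.
    by near: t; exact: lt_nbhsr.
  by near: t; exact: lt_nbhsl.
Unshelve. all: by end_near.
Qed.

Lemma derive1_height s : - m < s < 0 -> derive1 H s = level_slope s.
Proof.
move=> sI; rewrite derive1E; apply: derive_val.
have := is_deriveD (is_derive_level sI) (is_derive_cst d s (1 : R)); rewrite addr0.
apply: near_eq_is_derive; have /andP[ms s0] := sI.
near=> t; rewrite -[LHS]/(level t + d) /level pin_id ?subrK//.
by apply/andP; split; apply: ltW; near: t; [exact: lt_nbhsr|exact: lt_nbhsl].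
Unshelve. all: by end_near.
Qed.

Lemma Rintegral_level_slope : \int[mu]_(s in `[- m, 0]) level_slope s = d.
Proof.
transitivity (level 0 - level (- m)); last by rewrite level_top level_bed sub0r opprK.
apply: Rintegral_FTC2; rewrite ?oppr_le0 ?limit_flux_ge0//.
- exact: continuous_level_slope.
- by apply: continuous_subspaceT; exact: continuous_level.
- exact: is_derive_level.
Qed.

(** Change of variables from the stream label to the undisturbed level. *)
Lemma Rintegral_level_slope3 :
  \int[mu]_(s in `[- m, 0]) level_slope s ^+ 3 = \int[mu]_(y in `[- d, 0]) (c - Uh y) ^- 2.
Proof.
pose k y := (W y) ^- 2.
have ck : continuous k.
  move=> y; apply: cvgV; first by rewrite gt_eqF// exprn_gt0.
  rewrite /continuous_at; under eq_fun do rewrite expr2; rewrite expr2.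
  by apply: cvgM; exact: cW.
rewrite [RHS](Rintegral_primitive ck (ltW nd0)).
transitivity (primitive k (level 0) - primitive k (level (- m))); last by rewrite level_top level_bed.
apply: (@Rintegral_FTC2 R _ (fun s => primitive k (level s))); rewrite ?oppr_le0 ?limit_flux_ge0//.
- move=> s; rewrite /continuous_at; under eq_fun do rewrite exprSr expr2; rewrite exprSr expr2.
  by apply: cvgM; [apply: cvgM|]; exact: continuous_level_slope.
- apply: continuous_subspaceT => s; apply: (@continuous_comp _ _ _ level (primitive k)).
    exact: continuous_level.
  exact: is_derive1_continuous (is_derive_primitive _ ck).
move=> s sI; have := @is_derive1_comp _ (primitive k) level s _ _
  (is_derive_primitive _ ck) (is_derive_level sI).
by rewrite /k /level_slope -exprVn -exprSr.
Qed.

End AsymptoticHeight.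

(** * The integral identity *)

Section LimitIdentity.
Context {R : realType}.
Notation mu := (@lebesgue_measure R).

Variables (g d c dl : R) (eta : R -> R) (psi uh vh h Ph : R * R -> R) (Uh H : R -> R).
Hypothesis S : stream_setting d c dl eta psi uh vh h.
Hypotheses (cP : continuous Ph) (P_top : forall x, Ph (x, eta x) = 0).
Hypotheses (g0 : 0 < g) (d0 : 0 < d) (cU : continuous Uh) (U_speed : forall y, dl <= c - Uh y).
Implicit Types (q s x y p : R).
Notation I := (limit_flux d c Uh).
Notation m := (I 0).
Notation Y := (streamY d psi h).
Notation T := (stream_pressure g d psi h Ph).
Notation lift := (lift d c eta psi uh vh h).
Hypothesis bal_momentum : forall a b y0 y1 : R, a < b -> y0 < y1 -> fluid_rect d eta a b y0 y1 ->
  balance (fun z => (uh z - c) * vh z) (fun z => vh z ^+ 2 + Ph z + g * z.2) a b y0 y1.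
Hypothesis bal_bernoulli : forall a b y0 y1 : R, a < b -> y0 < y1 -> fluid_rect d eta a b y0 y1 ->
  balance (fun z => bernoulli g c uh vh Ph z * (uh z - c))
    (fun z => bernoulli g c uh vh Ph z * vh z) a b y0 y1.
Hypothesis u_lim : forall e : R, 0 < e ->
  for_large (fun x => forall y, - d <= y -> y <= eta x -> y <= 0 -> `|uh (x, y) - Uh y| < e).
Hypothesis v_lim : forall e : R, 0 < e ->
  for_large (fun x => forall y, - d <= y <= eta x -> `|vh (x, y)| < e).
Hypothesis v_lim_left : forall e : R, 0 < e ->
  for_large (fun x => forall y, - d <= y <= eta (- x) -> `|vh (- x, y)| < e).
Hypothesis eta_lim : forall e : R, 0 < e -> for_large (fun x => `|eta x| < e).
Hypothesis HI : forall y, - d <= y <= 0 -> H (I y - m) = y + d.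

Let cu := st_u S.
Let cY : continuous Y := continuous_streamY S.
Let dl0 := st_dl S.
Let cT : continuous T := continuous_stream_pressure S cP.
Let mE : bed_flux d psi = m :=
  bed_flux_limit S cP P_top g0 d0 cU U_speed bal_momentum bal_bernoulli u_lim v_lim eta_lim.
Let m0 : 0 < m. Proof. by rewrite -mE; exact: bed_flux_gt0 S. Qed.
Notation Hp := (level_slope d c Uh H).
Let cHp : continuous Hp := continuous_level_slope d0 dl0 cU U_speed HI.

Definition height_slope (z : R * R) : R := (c - uh (z.1, Y z))^-1.
Notation hp := height_slope.

Let speed0 z : 0 < c - uh z.
Proof. exact: lt_le_trans dl0 (st_speed S z). Qed.

Lemma continuous_height_slope : continuous hp.
Proof.
move=> z; apply: cvgV; first by rewrite gt_eqF.
apply: cvgB; first exact: cvg_cst.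
exact: (continuous_on_streamline S (F := uh) cu).
Qed.

Lemma streamY_height q p : - m <= p <= 0 -> h (q, p) = Y (q, p) + d.
Proof.
by move=> pI; rewrite /streamY mE /= pin_id// subrK.
Qed.

Lemma derive_height_x q p : - m < p < 0 ->
  'D_(e_x R) h (q, p) = vh (q, Y (q, p)) / (uh (q, Y (q, p)) - c).
Proof.
move=> pI; apply: derive_val; apply/is_derive_exE => /=.
have pI' : - bed_flux d psi < p < 0 by rewrite mE.
have := is_deriveD (is_derive_streamY_q S q pI') (is_derive_cst d q (1 : R)); rewrite addr0.
apply: near_eq_is_derive; near=> t.
by rewrite streamY_height//; have /andP[a b] := pI; rewrite !ltW.
Unshelve. all: by end_near.
Qed.

Lemma derive_height_y q p : - m < p < 0 -> 'D_(e_y R) h (q, p) = hp (q, p).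
Proof.
move=> pI; apply: derive_val; apply/is_derive_eyE => /=.
have pI' : - bed_flux d psi < p < 0 by rewrite mE.
have := is_deriveD (is_derive_streamY_s S q pI') (is_derive_cst d p (1 : R)); rewrite addr0.
have /andP[a b] := pI.
apply: near_eq_is_derive; near=> t.
rewrite streamY_height//; apply/andP; split; apply: ltW; near: t.
  exact: lt_nbhsr.
exact: lt_nbhsl.
Unshelve. all: by end_near.
Qed.

(** Eliminating the velocities by Bernoulli's law makes the integrand linear in
    the pressure on the streamline, with weight H_p^3. *)
Lemma integrandE q p : - m < p < 0 ->
  integrand h H q p = hp (q, p) - Hp p - Hp p ^+ 3 * T (q, p).
Proof.
move=> pI; rewrite /integrand derive_height_x// derive_height_y//.
rewrite (derive1_height d0 dl0 cU U_speed HI pI).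
have [|_ E] := levelP d0 dl0 cU U_speed HI (s := p).
  by have /andP[a b] := pI; rewrite !ltW.
have zI := level_interior d0 dl0 cU U_speed HI pI.
have := stream_pressureE S cP P_top g0 cU U_speed bal_momentum bal_bernoulli
  u_lim v_lim eta_lim q (s := p) (z := level d c Uh H p).
rewrite mE => /(_ pI zI E) ->.
rewrite /height_slope /level_slope /=.
have := speed0 (q, Y (q, p)).
have := lt_le_trans dl0 (U_speed (level d c Uh H p)).
rewrite -[uh _ - c]opprB.
move: (c - Uh _) (c - uh _) (vh _) => W w v W0 w0.
by field; rewrite !gt_eqF.
Qed.

Lemma Rintegral_height_slope q : \int[mu]_(p in `[- m, 0]) hp (q, p) = eta q + d.
Proof.
transitivity (Y (q, 0) - Y (q, - m)).
  apply: (@Rintegral_FTC2 R _ (fun p => Y (q, p))).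
  - by rewrite oppr_le0 ltW.
  - exact: (@continuous_xsection R hp q continuous_height_slope).
  - by apply: continuous_subspaceT; exact: (@continuous_xsection R Y q cY).
  by move=> p pI; apply: (is_derive_streamY_s S); rewrite mE.
by rewrite (streamY_top S) -mE (streamY_bot S) opprK.
Qed.

Let Hp3T (z : R * R) := Hp z.2 ^+ 3 * T z.

Let cHp3 : continuous (fun p => Hp p ^+ 3).
Proof.
move=> p; rewrite /continuous_at; under eq_fun do rewrite exprSr expr2; rewrite exprSr expr2.
by apply: cvgM; [apply: cvgM|]; exact: cHp.
Qed.

Let cHp3_snd : continuous (fun z : R * R => Hp z.2 ^+ 3).
Proof.
move=> z; apply: (@continuous_comp _ _ _ snd (fun p => Hp p ^+ 3)); first exact: cvg_snd.
exact: cHp3.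
Qed.

Let cHp3T : continuous Hp3T.
Proof. by move=> z; apply: cvgM; [exact: cHp3_snd|exact: cT]. Qed.

Lemma Rintegral_integrand q :
  \int[mu]_(p in `]- m, 0[) integrand h H q p =
  eta q - \int[mu]_(p in `[- m, 0]) (Hp p ^+ 3 * T (q, p)).
Proof.
have chp : continuous (fun p => hp (q, p)).
  exact: (@continuous_xsection R hp q continuous_height_slope).
have cd : continuous (fun p => hp (q, p) - Hp p) by move=> p; apply: cvgB; [exact: chp|exact: cHp].
have cHT : continuous (fun p => Hp p ^+ 3 * T (q, p)) by exact: (@continuous_xsection R Hp3T q cHp3T).
transitivity (\int[mu]_(p in `]- m, 0[) (hp (q, p) - Hp p - Hp p ^+ 3 * T (q, p))).
  by apply: eq_Rintegral => p; rewrite inE/= in_itv/= => pI; exact: integrandE.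
rewrite Rintegral_itvoo; last by move=> p; apply: cvgB; [exact: cd|exact: cHT].
rewrite RintegralB_continuous// RintegralB_continuous//.
by rewrite Rintegral_height_slope (Rintegral_level_slope d0 dl0 cU U_speed HI) addrK.
Qed.

(** The surface terms cancel: eta appears as int h_p dp - d with the sign
    opposite to the one it has in the first term, and the weight of g eta is
    int H_p^3 dp, which the change of level turns into int (c - U)^-2 dy. *)
Lemma integral_identity M : 0 <= M ->
  (g * \int[mu]_(y in `[- d, 0]) (c - Uh y) ^- 2 - 1) * \int[mu]_(x in `[- M, M]) eta x +
    \int[mu]_(q in `[- M, M]) \int[mu]_(p in `]- m, 0[) integrand h H q p =
  - \int[mu]_(p in `[- m, 0]) (Hp p ^+ 3 * \int[mu]_(q in `[- M, M]) (T (q, p) - g * eta q)).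
Proof.
move=> M0; rewrite -(Rintegral_level_slope3 d0 dl0 cU U_speed HI).
have ceta : continuous eta := st_eta S.
have cge : continuous (fun q => g * eta q).
  by move=> q; apply: cvgM; [exact: cvg_cst|exact: ceta].
have m0' : - m <= 0 by rewrite oppr_le0 ltW.
have MM : - M <= M by rewrite ge0_cp.
under [X in _ + X]eq_Rintegral do rewrite Rintegral_integrand.
rewrite RintegralB_continuous//; last first.
  by move=> q; apply: (@continuous_Rintegral_param R (fun z => Hp3T (z.2, z.1))) => // z;
    apply: (@continuous_comp _ _ _ (fun z : R * R => (z.2, z.1)) Hp3T);
    [apply: (@continuous_pairing R _ snd fst); [exact: cvg_snd|exact: cvg_fst]|exact: cHp3T].
rewrite (@Rintegral_continuous_swap R Hp3T)//.
have -> : \int[mu]_(p in `[- m, 0]) (Hp p ^+ 3 * \int[mu]_(q in `[- M, M]) (T (q, p) - g * eta q)) =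
    \int[mu]_(p in `[- m, 0]) (\int[mu]_(q in `[- M, M]) Hp3T (q, p) -
       (g * \int[mu]_(q in `[- M, M]) eta q) * Hp p ^+ 3).
  apply: eq_Rintegral => p _.
  have cTp : continuous (fun q => T (q, p)) by exact: (@continuous_ysection R T p cT).
  rewrite RintegralB_continuous// [X in _ - X]RintegralZl_continuous// /Hp3T /=.
  by rewrite RintegralZl_continuous//; ring.
rewrite RintegralB_continuous; first last.
- by move=> p; apply: cvgM; [exact: cvg_cst|exact: cHp3].
- exact: (@continuous_Rintegral_param R Hp3T).
by rewrite [X in - (_ - X)]RintegralZl_continuous//; ring.
Qed.

(** On each streamline the inner integral is a difference of two lifts, each at
    most m sup |v|, and H_p is at most 1 / dl. *)
Lemma integral_identity_lim e : 0 < e -> for_large (fun M =>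
  `|(g * \int[mu]_(y in `[- d, 0]) (c - Uh y) ^- 2 - 1) * \int[mu]_(x in `[- M, M]) eta x +
    \int[mu]_(q in `[- M, M]) \int[mu]_(p in `]- m, 0[) integrand h H q p| <= e).
Proof.
move=> e0.
pose k := (dl^-1) ^+ 3 * (2 * m) * m.
have k0 : 0 < k.
  apply: mulr_gt0; last exact: m0.
  by apply: mulr_gt0; [rewrite exprn_gt0// invr_gt0; exact: dl0|apply: mulr_gt0 => //; exact: m0].
have ek : 0 < e / k by rewrite divr_gt0.
have [X HX] := for_largeI (v_lim ek) (v_lim_left ek).
exists (Num.max X 0) => M; rewrite ge_max => /andP[XM M0].
have [vr vl] := HX M XM.
rewrite integral_identity// normrN.
have MM : - M <= M by rewrite ge0_cp.
have -> : e = (dl^-1) ^+ 3 * (2 * (e / k) * m) * (0 - - m).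
  by rewrite sub0r opprK /k; field; rewrite !gt_eqF.
apply: le_normr_Rintegral_itvoo.
- move=> p; apply: cvgM; first exact: cHp3.
  apply: (@continuous_Rintegral_param R (fun z => T z - g * eta z.1)) => // z.
  apply: cvgB; first exact: cT.
  apply: cvgM; first exact: cvg_cst.
  by apply: (@continuous_comp _ _ _ fst eta); [exact: cvg_fst|exact: (st_eta S)].
- by rewrite oppr_le0 ltW.
move=> p pI; have /andP[mp p0] := pI.
have pI' : - bed_flux d psi < p < 0 by rewrite mE.
have pI2 : - bed_flux d psi <= p <= 0 by rewrite mE !ltW.
rewrite normrM; apply: ler_pM => //.
  have Hp0 : 0 < Hp p by exact: (level_slope_gt0 d H dl0 U_speed).
  rewrite gtr0_norm ?exprn_gt0//; apply: lerXn2r.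
  - exact: ltW.
  - by rewrite nnegrE invr_ge0; exact: ltW.
  - exact: (level_slope_le d H dl0 U_speed).
rewrite -(lift_balance S cP P_top bal_momentum MM pI').
apply: (le_trans (ler_normB _ _)).
have L1 := lift_bound S pI2 (fun y yI => ltW (vr y yI)).
have L2 := lift_bound S pI2 (fun y yI => ltW (vl y yI)).
have : e / k * - p <= e / k * m by apply: ler_wpM2l; [exact: ltW|lra].
by lra.
Qed.

End LimitIdentity.

(** * Solitary waves *)

Section SolitaryWaves.
Context {R : realType}.
Notation mu := (@lebesgue_measure R).
Implicit Types (P : R -> Prop) (x y : R).

Lemma for_large_pinfty P : (\forall x \near +oo, P x) <-> for_large P.
Proof.
split=> [[M [_ HM]]|[X HX]].
  by exists (M + 1) => x Mx; apply: HM; apply: lt_le_trans Mx; rewrite ltrDl.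
by exists X; split; [exact: num_real|move=> x /ltW; exact: HX].
Qed.

Lemma for_large_ninfty P : (\forall x \near -oo, P x) -> for_large (fun x => P (- x)).
Proof.
move=> [M [_ HM]]; exists (- M + 1) => x Mx; apply: HM.
by rewrite ltrNl; apply: lt_le_trans Mx; rewrite ltrDl.
Qed.

Section Profile.
Variables (d : R) (U : R -> R).
Hypothesis d0 : 0 < d.
Hypothesis cU : {within `[- d, 0], continuous U}.

(** U is prescribed on [-d, 0] only. *)
Definition extend_profile y : R := U (pin (- d) 0 y).

Let nd0 : - d <= 0. Proof. by rewrite oppr_le0 ltW. Qed.

Lemma extend_profile_id y : - d <= y <= 0 -> extend_profile y = U y.
Proof. by move=> yI; rewrite /extend_profile pin_id. Qed.

Lemma continuous_extend_profile : continuous extend_profile.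
Proof.
move=> y; apply/cvgrPdist_lt => e e0.
pose k := pin (- d) 0.
have kI x : `[- d, 0]%classic (k x) by rewrite /= in_itv/=; exact: pin_itv.
have H := within_continuous_near cU (kI y) e0.
have {}H : \forall t \near y, `[- d, 0]%classic (k t) -> `|U (k y) - U (k t)| < e.
  exact: (@continuous_pin R (- d) 0 y _ H).
by apply: filterS H => t; apply; exact: kI.
Qed.

End Profile.

Variables (g d c r : R) (eta : R -> R) (u v P : R * R -> R) (U : R -> R).
Hypotheses (d0 : 0 < d) (W : solitary_wave g d c r eta u v P U).
Hypothesis ceta : continuous eta.
Notation Om := (closure (fluid d eta)).
Let depth := sw_depth W.

Lemma speed_gap : (ereal_sup [set (u z)%:E | z in Om] < c%:E)%E ->
  exists2 dl, 0 < dl & forall z, Om z -> dl <= c - u z.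
Proof.
move=> sup_c; set s := ereal_sup _ in sup_c.
have ub z : Om z -> ((u z)%:E <= s)%E by move=> Oz; apply: ereal_sup_ubound; exists z.
have bed : Om (0, - d) by apply: closure_fluid => //; rewrite lexx ltW.
move: sup_c ub; case: s => [s| |] // sc ub; last by have := ub _ bed.
exists (c - s); first by rewrite subr_gt0 -lte_fin.
by move=> z /ub; rewrite lee_fin; lra.
Qed.

Notation Uh := (extend_profile d U).
Let cU : continuous Uh := continuous_extend_profile d0 (sw_cont_U W).

Lemma eta_for_large (e : R) : 0 < e -> for_large (fun x => `|eta x| < e).
Proof.
move=> e0; have [/cvgrPdist_lt/(_ _ e0) H _] := sw_eta_cvg W.
by apply/for_large_pinfty; apply: filterS H => x; rewrite sub0r normrN.
Qed.

Lemma u_for_large (e : R) : 0 < e ->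
  for_large (fun x => forall y, - d <= y -> y <= eta x -> y <= 0 ->
    `|extend d eta u (x, y) - Uh y| < e).
Proof.
move=> e0; have [/for_large_pinfty[X HX] _] := sw_u_cvg W e0.
exists X => x Xx y dy ye y0; rewrite extend_id ?dy// extend_profile_id ?dy//.
by apply: HX => //=; rewrite dy le_min ye.
Qed.

Lemma v_for_large (e : R) : 0 < e ->
  for_large (fun x => forall y, - d <= y <= eta x -> `|extend d eta v (x, y)| < e).
Proof.
move=> e0; have [/for_large_pinfty[X HX] _] := sw_v_cvg W e0.
by exists X => x Xx y yI; rewrite extend_id// -[v _]subr0; exact: HX.
Qed.

Lemma v_for_large_left (e : R) : 0 < e ->
  for_large (fun x => forall y, - d <= y <= eta (- x) -> `|extend d eta v (- x, y)| < e).
Proof.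
move=> e0; have [_ /for_large_ninfty[X HX]] := sw_v_cvg W e0.
by exists X => x Xx y yI; rewrite extend_id// -[v _]subr0; exact: HX.
Qed.

(** The bound on u passes to the limit at each level y < 0, which the fluid
    reaches for x large, and to y = 0 by continuity of U. *)
Lemma profile_speed dl : (forall z, Om z -> dl <= c - u z) -> forall y, dl <= c - Uh y.
Proof.
move=> Hdl.
have neg y : - d <= y -> y < 0 -> dl <= c - Uh y.
  move=> dy y0; rewrite leNgt; apply/negP => lt.
  have e0 : 0 < dl - (c - Uh y) by rewrite subr_gt0.
  have ny : 0 < - y by rewrite oppr_gt0.
  have [x [ex ux]] := for_large_ex (for_largeI (eta_for_large ny) (u_for_large e0)).
  have yx : y <= eta x by move: ex; rewrite ltr_norml; lra.
  have := ux y dy yx (ltW y0); rewrite extend_id ?dy//.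
  have := Hdl (x, y) (closure_fluid depth _); rewrite dy yx => /(_ isT).
  by rewrite ltr_norml; lra.
have at0 : dl <= c - Uh 0.
  rewrite leNgt; apply/negP => lt.
  have e0 : 0 < dl - (c - Uh 0) by rewrite subr_gt0.
  have /cvgrPdist_lt/(_ _ e0) := @cU 0 => /(@nbhs_ballP _ _ (0 : R) _)[rho /= rho0 H].
  pose t := - (Num.min rho d / 2).
  have mn0 : 0 < Num.min rho d by rewrite lt_min rho0.
  have [m1 m2] : Num.min rho d <= rho /\ Num.min rho d <= d by rewrite !ge_min !lexx orbT.
  have dt : - d <= t by rewrite /t; lra.
  have t0 : t < 0 by rewrite /t; lra.
  have := H t; rewrite /ball /= sub0r normrN ltr0_norm// => /(_ ltac:(rewrite /t; lra)).
  by have := neg t dt t0; rewrite ltr_norml; lra.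
move=> y; pose z := pin (- d) 0 y.
have /andP[dz z0] : - d <= z <= 0 by apply: pin_itv; rewrite oppr_le0 ltW.
have -> : Uh y = Uh z by rewrite [RHS]extend_profile_id// dz.
have := z0; rewrite le_eqVlt => /orP[/eqP zz|]; last exact: neg.
by rewrite zz.
Qed.

Lemma wave_stream_setting psi h dl : 0 < dl ->
  (forall z, Om z -> dl <= c - u z) ->
  stream_function d c eta u v psi -> height_function d eta psi h ->
  stream_setting d c dl eta (extend d eta psi) (extend d eta u) (extend d eta v) h.
Proof.
move=> dl0 Hdl [cpsi psi_y psi_x psi_top] hE.
have near_ext z : fluid d eta z -> \forall t \near z, psi t = extend d eta psi t.
  move=> /(near_fluid ceta); apply: filterS => t ft; by rewrite extend_fluid.
split => //.
- exact: continuous_extend.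
- exact: (continuous_extend _ _ (sw_cont_u W)).
- exact: (continuous_extend _ _ (sw_cont_v W)).
- by case=> x y; apply: Hdl; apply: closure_fluid => //; exact: clamp_itv.
- move=> z fz; rewrite extend_fluid//; apply: (near_eq_is_derive (near_ext z fz)).
  exact: psi_y.
- move=> z fz; rewrite extend_fluid//; apply: (near_eq_is_derive (near_ext z fz)).
  exact: psi_x.
- by move=> x; rewrite extend_id ?psi_top// lexx ltW.
- by move=> x; rewrite extend_id ?(sw_bottom W)// lexx ltW.
- by move=> x y xy; rewrite extend_id// hE//; exact: closure_fluid.
Qed.

Lemma asymptotic_streamE y : - d <= y <= 0 ->
  - asymptotic_stream c U y = limit_flux d c Uh y - limit_flux d c Uh 0.
Proof.
move=> /andP[dy y0]; rewrite /limit_flux (@Rintegral_itv_chasles R _ (- d) y 0) ?dy//; last first.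
  by apply: continuous_integrable_itv => t; apply: cvgB; [exact: cvg_cst|exact: cU].
have -> : asymptotic_stream c U y = \int[mu]_(t in `[y, 0]) (c - Uh t).
  apply: eq_Rintegral => t; rewrite inE/= in_itv/= => /andP[yt t0].
  by rewrite extend_profile_id// (le_trans dy).
by ring.
Qed.

Lemma flux_profileE : flux d c U = limit_flux d c Uh 0.
Proof.
by apply: eq_Rintegral => t; rewrite inE/= in_itv/= => tI; rewrite extend_profile_id.
Qed.

End SolitaryWaves.

Theorem lemma3p1 (R : realType) (g d c : R) (eta : R -> R)
    (u v P : R * R -> R) (U : R -> R) (alpha r F m : R)
    (psi h : R * R -> R) (H : R -> R) :
  0 < g -> 0 < d -> 0 < c ->
  0 < alpha < 1 -> r = 2 / (1 - alpha) ->
  solitary_wave g d c r eta u v P U ->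
  (ereal_sup [set (u z)%:E | z in closure (fluid d eta)] < c%:E)%E ->
  in_W1r_loc r (closure (fluid d eta)) u ->
  in_W1r_loc r (closure (fluid d eta)) v ->
  in_W1r_loc r (closure (fluid d eta)) P ->
  in_C1alpha alpha eta ->
  in_W1r1 r `]- d, 0[ U ->
  froude g d c U F ->
  m = flux d c U ->
  stream_function d c eta u v psi ->
  height_function d eta psi h ->
  asymptotic_height d c U H ->
  (F ^- 2 - 1) * \int[leb]_(x in `[- M, M]) eta x +
    \int[leb]_(q in `[- M, M]) \int[leb]_(p in `]- m, 0[) integrand h H q p
    @[M --> +oo] --> (0 : R).
Proof.
move=> g0 d0 c0 /andP[al0 al1] rE W sup_c _ _ _ [deta _ _] _ [_ FE] -> SF HF HA.
have r1 : 1 <= r.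
  by rewrite rE ler_pdivlMr; lra.
have ceta : continuous eta := fun x => is_derive1_continuous (derivableP (deta x)).
have depth := sw_depth W.
have [dl dl0 Hdl] := speed_gap W sup_c.
have S := wave_stream_setting W ceta dl0 Hdl SF HF.
have cU := continuous_extend_profile d0 (sw_cont_U W).
have cP := continuous_extend ceta depth (sw_cont_P W).
have P_top x : extend d eta P (x, eta x) = 0.
  by rewrite extend_id ?(sw_dynamic W)// lexx ltW.
have bal a b y0 y1 (ab : a < b) (y01 : y0 < y1) (KD : fluid_rect d eta a b y0 y1) :=
  let: ex_intro2 e e0 sub := KD in
  euler_balance r1 (st_u S) (st_v S) cP (extend_fluid u) (extend_fluid v)
    (extend_fluid P) e0 ab y01 sub (sw_euler W).
have HI y : - d <= y <= 0 ->
    H (limit_flux d c (extend_profile d U) y - limit_flux d c (extend_profile d U) 0) = y + d.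
  by move=> yI; rewrite -(asymptotic_streamE d0 W yI) HA.
rewrite (flux_profileE d c U) FE.
have -> : \int[leb]_(y in `[- d, 0]) (c - U y) ^- 2 =
    \int[leb]_(y in `[- d, 0]) (c - extend_profile d U y) ^- 2.
  by apply: eq_Rintegral => y; rewrite inE/= in_itv/= => yI; rewrite extend_profile_id.
apply/cvgrPdist_le => e e0; apply/for_large_pinfty.
have := integral_identity_lim S cP P_top g0 d0 cU (profile_speed d0 W Hdl)
  (fun a b y0 y1 ab y01 K => (bal a b y0 y1 ab y01 K).1)
  (fun a b y0 y1 ab y01 K => (bal a b y0 y1 ab y01 K).2)
  (u_for_large W) (v_for_large W) (v_for_large_left W) (eta_for_large W) HI e0.
by apply: for_largeS => M; rewrite sub0r normrN.
Qed.
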